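(* Let $p\in[1,\infty)$, let $X=(X,d,\mu)$ be a $p$-admissible metric measure space, let $\theta\in(0,p)$, and let $E\subset X$ be a (closed) Ahlfors--David codimension-$\theta$ regular set. Then there exists a bounded nonlinear extension operator $$\operatorname{Ext}:L_p(E,\mathcal H_\theta\lfloor_E)\to B^{\theta/p}_{p,1}(X)$$ which is a right inverse to the trace operator, that is, $\operatorname{Tr}\circ\operatorname{Ext}=\operatorname{Id}_{L_p(E,\mathcal H_\theta\lfloor_E)}$.
   Context: A bounded nonlinear operator is a map, not assumed to be linear, for which there is a constant $C>0$ with $\|\operatorname{Ext}\phi\|_{B^{\theta/p}_{p,1}(X)}\le C\|\phi\|_{L_p(E,\mathcal H_\theta\lfloor_E)}$ for all $\phi$. A metric measure space $(X,d,\mu)$ consists of a complete separable metric space $(X,d)$ and a Borel regular (outer) measure $\mu$ with $0<\mu(B_r(x))<\infty$ for all $x\in X$, $r>0$, where $B_r(x)$ is the open ball. For a Lipschitz function $f:X\to\mathbb R$, $\operatorname{lip}f(x)=\limsup_{y\to x}\frac{|f(y)-f(x)|}{d(y,x)}$ if $x$ is an accumulation point and $\operatorname{lip}f(x)=0$ if $x$ is isolated. For $q\in[1,\infty)$, the space is $q$-admissible if: (1) $\mu$ is uniformly locally doubling: for every $R>0$ there is $C_\mu(R)>0$ with $\mu(B_{2r}(x))\le C_\mu(R)\mu(B_r(x))$ for all $x\in X$, $r\in(0,R]$; (2) it supports a local weak $(1,q)$-Poincaré inequality: for every $R>0$ there are $C=C(R)>0$, $\lambda=\lambda(R)\ge1$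 such that for every Lipschitz $f:X\to\mathbb R$, all $x\in X$ and $r\in(0,R]$, $$\frac1{\mu(B_r(x))}\int_{B_r(x)}\Big|f-\frac1{\mu(B_r(x))}\int_{B_r(x)}f\,d\mu\Big|\,d\mu\le Cr\Big(\frac1{\mu(B_{\lambda r}(x))}\int_{B_{\lambda r}(x)}(\operatorname{lip}f)^q\,d\mu\Big)^{1/q}.$$ Codimension-$\theta$ Hausdorff measure: for $F\subset X$, $\delta>0$, $\mathcal H_{\theta,\delta}(F)=\inf\{\sum_i\mu(B_{r_i}(x_i))r_i^{-\theta}\}$ over at most countable coverings $F\subset\bigcup_iB_{r_i}(x_i)$ with $0<r_i<\delta$, and $\mathcal H_\theta(F)=\lim_{\delta\to0}\mathcal H_{\theta,\delta}(F)$. $\mathcal H_\theta\lfloor_E(G)=\mathcal H_\theta(G\cap E)$. A closed set $E\subset X$ is Ahlfors--David codimension-$\theta$ regular if there are $c_1,c_2>0$ with $c_1\frac{\mu(B_r(x))}{r^\theta}\le\mathcal H_\theta(B_r(x)\cap E)\le c_2\frac{\mu(B_r(x))}{r^\theta}$ for all $x\in E$, $r\in(0,1]$. For $f\in L_1^{\mathrm{loc}}(X)$ (integrable on balls) and $t>0$, put $$\overline\Delta_tf(x)=\frac1{\mu(B_t(x))}\int_{B_t(x)}\Big|f(y)-\frac1{\mu(B_t(x))}\int_{B_t(x)}f\,d\mu\Big|\,d\mu(y).$$ For $s\in(0,1)$, $B^s_{p,1}(X)$ consists of all $f\in L_p(X)=L_p(X,\mu)$ with $\|f\|_{b^s_{p,1}(X)}:=\int_0^1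 t^{-s}\|\overline\Delta_tf\|_{L_p(X)}\frac{dt}{t}<\infty$, with norm $\|f\|_{B^s_{p,1}(X)}=\|f\|_{L_p(X)}+\|f\|_{b^s_{p,1}(X)}$. With $\nu=\mathcal H_\theta\lfloor_E$: a $\nu$-measurable $\phi:E\to\mathbb R$ is a trace of $f\in L_1^{\mathrm{loc}}(X)$ to $E$ if $\lim_{r\to0}\frac1{\mu(B_r(x))}\int_{B_r(x)}|f(y)-\phi(x)|\,d\mu(y)=0$ for $\nu$-a.e. $x\in E$; its class modulo $\nu$-negligible sets is $\operatorname{Tr}f$. *)

(* Defs.v *)
From HB Require Import structures.
From mathcomp Require Import all_boot all_order all_algebra.
From mathcomp Require Import all_classical all_reals all_analysis.

Set Implicit Arguments.
Unset Strict Implicit.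
Unset Printing Implicit Defensive.

Import Order.TTheory GRing.Theory Num.Theory.
Import numFieldNormedType.Exports.

Local Open Scope classical_set_scope.
Local Open Scope ring_scope.

(* [Complete] is a pointed structure in the library, so these spaces are
   nonempty. *)
#[short(type="completeMetricType")]
HB.structure Definition CompleteMetric (R : numDomainType) :=
  {T of Complete T & Metric R T}.

(* Measurability and integrability with respect to an outer measure always
   refer to its Caratheodory sigma-algebra. *)
Definition cara_measure (R : realType) (T : pointedType)
    (mu : {outer_measure set T -> \bar R}) :
    {measure set (caratheodory_type mu) -> \bar R} :=
  mu : set (caratheodory_type mu) -> \bar R.

Section outer_restriction.
Local Open Scope ereal_scope.
Context {R : realType} {T : Type}.
Variables (mu : {outer_measure set T -> \bar R}) (E : set T).

Definition outer_restr (G : set T) : \bar R := mu (G `&` E).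

Let outer_restr0 : outer_restr set0 = 0.
Proof. by rewrite /outer_restr set0I outer_measure0. Qed.

Let outer_restr_ge0 G : 0 <= outer_restr G.
Proof. exact: outer_measure_ge0. Qed.

Let le_outer_restr : {homo outer_restr : A B / A `<=` B >-> A <= B}.
Proof. by move=> A B AB; apply: le_outer_measure; exact: setSI. Qed.

Let outer_restr_sigma_subadditive : sigma_subadditive outer_restr.
Proof.
by move=> F; rewrite /outer_restr setI_bigcupl outer_measure_sigma_subadditive.
Qed.

HB.instance Definition _ := isOuterMeasure.Build R T outer_restr
  outer_restr0 outer_restr_ge0 le_outer_restr outer_restr_sigma_subadditive.

End outer_restriction.

Section codimension_hausdorff.
Local Open Scope ereal_scope.
Context {R : realType} {X : completeMetricType R}.
Variables (mu : {outer_measure set X -> \bar R}) (theta : R).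

Definition codim_gauge (x : X) (r : R) : \bar R :=
  mu (ball x r) * (r `^ (- theta))%:E.

(* An at most countable family of balls is given by an index set [J] of natural
   numbers, possibly finite or empty, with centers [x] and radii [r]; the
   values of [x] and [r] outside [J] are irrelevant. *)
Definition codim_cover (delta : R) (F : set X) (J : set nat) (x : nat -> X)
    (r : nat -> R) : Prop :=
  (forall i, J i -> (0 < r i < delta)%R) /\
  F `<=` \bigcup_(i in J) ball (x i) (r i).

Definition codim_content (delta : R) (F : set X) : \bar R :=
  ereal_inf [set s | exists J x r, codim_cover delta F J x r /\
                       s = \esum_(i in J) codim_gauge (x i) (r i)].

Definition codim_hausdorff (F : set X) : \bar R :=
  lim (codim_content delta F @[delta --> (0%R : R)^'+]).

Let gauge_ge0 x r : 0 <= codim_gauge x r.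
Proof. by rewrite mule_ge0 ?outer_measure_ge0// lee_fin powR_ge0. Qed.

Lemma codim_content_ge0 delta F : 0 <= codim_content delta F.
Proof.
apply: le_ereal_inf_tmp => _ [J [x [r [_ ->]]]].
by apply: esum_ge0 => i _; exact: gauge_ge0.
Qed.

Lemma codim_content0 delta : codim_content delta set0 = 0.
Proof.
apply/eqP; rewrite eq_le codim_content_ge0 andbT.
apply: ereal_inf_lbound; exists set0, (fun=> point), (fun=> 0%R).
by split; [split|rewrite esum_set0].
Qed.

Lemma le_codim_content delta :
  {homo codim_content delta : A B / A `<=` B >-> A <= B}.
Proof.
move=> A B AB; apply: ereal_inf_le_tmp => _ [J [x [r [[rJ BJ] ->]]]].
by exists J, x, r; split => //; split => //; exact: subset_trans AB BJ.
Qed.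

Lemma codim_content_nonincreasing F :
  {homo codim_content^~ F : d1 d2 / (d1 <= d2)%R >-> d2 <= d1}.
Proof.
move=> d1 d2 d12; apply: ereal_inf_le_tmp => _ [J [x [r [[rJ FJ] ->]]]].
exists J, x, r; split => //; split => // i /rJ/andP[-> /=].
by move=> /lt_le_trans; exact.
Qed.

Lemma codim_content_sigma_subadditive delta :
  sigma_subadditive (codim_content delta).
Proof.
move=> A; have [[i ioo]|] := pselect (exists i, codim_content delta (A i) = +oo).
  rewrite (eseries_pinfty _ _ ioo) ?leey// => n _.
  by rewrite -ltNye (lt_le_trans _ (codim_content_ge0 _ _)).
rewrite -forallNE => Aoo.
suff add2e (e : {posnum R}) : codim_content delta (\bigcup_n A n) <=
    \sum_(i <oo) codim_content delta (A i) + e%:num%:E.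
  by apply/lee_addgt0Pr => _/posnumP[].
rewrite (le_trans _ (epsilon_trick _ _ _))//; last first.
  by move=> n; exact: codim_content_ge0.
pose P n (c : set nat * (nat -> X) * (nat -> R)) :=
  codim_cover delta (A n) c.1.1 c.1.2 c.2 /\
  \esum_(k in c.1.1) codim_gauge (c.1.2 k) (c.2 k) <=
    codim_content delta (A n) + (e%:num / (2 ^ n.+1)%:R)%:E.
have [c Pc] : {c & forall n, P n (c n)}.
  apply: (@choice _ _ P) => n.
  have en1 : (0 < e%:num / (2 ^ n.+1)%:R :> R)%R by [].
  have fin : codim_content delta (A n) \is a fin_num.
    by rewrite ge0_fin_numE ?codim_content_ge0// ltey; exact/eqP/Aoo.
  have [_ [J [x [r [cJ ->]]]] Jlt] := lb_ereal_inf_adherent en1 fin.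
  by exists (J, x, r); split => //=; exact: ltW.
have /card_esym/ppcard_eqP[f] := card_nat2.
pose K := [set k | (c (f k).1).1.1 (f k).2].
apply: (@le_trans _ _
    (\esum_(k in K) codim_gauge ((c (f k).1).1.2 (f k).2)
                                ((c (f k).1).2 (f k).2))).
  apply: ereal_inf_lbound => /=.
  exists K, (fun k => (c (f k).1).1.2 (f k).2),
    (fun k => (c (f k).1).2 (f k).2); split => //; split.
    by move=> k Kk; exact: (Pc (f k).1).1.1.
  move=> t [i _ Ait]; have [j Jj tj] := (Pc i).1.2 _ Ait.
  by exists (f^-1%FUN (i, j)); rewrite /K/= invK ?inE.
rewrite nneseries_esumT; last first.
  by move=> n; rewrite adde_ge0 ?codim_content_ge0// lee_fin divr_ge0.
apply: (@le_trans _ _ (\esum_(n in setT) \esum_(j in (c n).1.1)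
    codim_gauge ((c n).1.2 j) ((c n).2 j))); last first.
  by apply: le_esum => n _; exact: (Pc n).2.
rewrite esum_esum//.
rewrite (@reindex_esum _ _ _ K _ f) ?lexx//.
split=> [k Kk|k l _ _|[i j] [_ /= Jij]]; first by [].
  by apply: inj; rewrite inE.
by exists (f^-1%FUN (i, j)); rewrite /K/= invK ?inE.
Qed.

Lemma codim_content_cvg F : codim_content delta F @[delta --> (0%R : R)^'+] -->
  ereal_sup [set codim_content delta F | delta in [set` `]0%R, +oo[%R]].
Proof.
apply: (nonincreasing_at_right_cvge +oo%O) => // d1 d2 _ _.
exact: codim_content_nonincreasing.
Qed.

Lemma codim_hausdorffE F : codim_hausdorff F =
  ereal_sup [set codim_content delta F | delta in [set` `]0%R, +oo[%R]].
Proof. by apply/cvg_lim => //; exact: codim_content_cvg. Qed.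

Let codim_hausdorff_ge F delta : (0 < delta)%R ->
  codim_content delta F <= codim_hausdorff F.
Proof.
move=> d0; rewrite codim_hausdorffE; apply: ereal_sup_ubound.
by exists delta => //=; rewrite in_itv/= d0.
Qed.

Let codim_hausdorff_le F M : (forall delta, (0 < delta)%R ->
  codim_content delta F <= M) -> codim_hausdorff F <= M.
Proof.
move=> h; rewrite codim_hausdorffE; apply: ge_ereal_sup => _ [d /= + <-].
by rewrite in_itv/= andbT; exact: h.
Qed.

Let codim_hausdorff_ge0 F : 0 <= codim_hausdorff F.
Proof. exact: le_trans (codim_content_ge0 1 _) (codim_hausdorff_ge _ ltr01). Qed.

Let codim_hausdorff0 : codim_hausdorff set0 = 0.
Proof.
apply/eqP; rewrite eq_le codim_hausdorff_ge0 andbT.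
by apply: codim_hausdorff_le => d _; rewrite codim_content0.
Qed.

Let le_codim_hausdorff : {homo codim_hausdorff : A B / A `<=` B >-> A <= B}.
Proof.
move=> A B AB; apply: codim_hausdorff_le => d d0.
exact: le_trans (le_codim_content _ AB) (codim_hausdorff_ge _ d0).
Qed.

Let codim_hausdorff_sigma_subadditive : sigma_subadditive codim_hausdorff.
Proof.
move=> F; apply: codim_hausdorff_le => d d0.
apply: le_trans (codim_content_sigma_subadditive _ _) _.
by apply: lee_nneseries => n _ *; [exact: codim_content_ge0|exact: codim_hausdorff_ge].
Qed.

HB.instance Definition _ := isOuterMeasure.Build R X codim_hausdorff
  codim_hausdorff0 codim_hausdorff_ge0 le_codim_hausdorff
  codim_hausdorff_sigma_subadditive.

End codimension_hausdorff.

(* Classes of mu-measurable real functions modulo mu-a.e. equality. *)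
Notation L0 mu :=
  {mfun_ (cara_measure mu), (caratheodory_type mu) >-> (measurableTypeR _)}.

Section metric_measure_spaces.
Local Open Scope ereal_scope.
Context {R : realType} {X : completeMetricType R}.
Implicit Types (mu nu : {outer_measure set X -> \bar R}) (f : X -> R) (E : set X).

Definition separable_space := exists2 D : set X, countable D & dense D.

Definition borel_sets : set (set X) := <<s open >>.

Definition borel_regular mu :=
  borel_sets `<=` mu.-caratheodory /\
  forall A, exists B, [/\ borel_sets B, A `<=` B & mu B = mu A].

Definition metric_measure_space mu :=
  [/\ separable_space, borel_regular mu &
      forall (x : X) (r : R), (0 < r)%R -> 0 < mu (ball x r) < +oo].

Definition avg mu (A : set X) (g : X -> \bar R) : \bar R :=
  (mu A)^-1 * \int[cara_measure mu]_(y in A) g y.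

Definition mean_osc mu f (t : R) (x : X) : \bar R :=
  avg mu (ball x t) (fun y => `|(f y)%:E - avg mu (ball x t) (EFin \o f)|).

Definition lipschitz_fun f :=
  exists L : R, forall x y, (`|f x - f y| <= L * mdist x y)%R.

Definition lip f (x : X) : \bar R :=
  if x \in limit_point [set: X] then
    limf_esup (fun y => (`|f y - f x| / mdist y x)%:E) x^'
  else 0.

Definition uniformly_locally_doubling mu := forall rho : R, (0 < rho)%R ->
  exists2 C : R, (0 < C)%R & forall (x : X) (r : R), (0 < r <= rho)%R ->
    mu (ball x (2 * r)%R) <= C%:E * mu (ball x r).

Definition local_poincare mu (q : R) := forall rho : R, (0 < rho)%R ->
  exists C lambda : R, [/\ (0 < C)%R, (1 <= lambda)%R &
    forall f, lipschitz_fun f -> forall (x : X) (r : R), (0 < r <= rho)%R ->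
      mean_osc mu f r x <= (C * r)%:E *
        (avg mu (ball x (lambda * r)%R) (fun y => lip f y `^ q)) `^ q^-1].

Definition admissible mu (q : R) :=
  uniformly_locally_doubling mu /\ local_poincare mu q.

Definition ahlfors_david_regular mu (theta : R) E :=
  closed E /\
  exists c1 c2 : R, [/\ (0 < c1)%R, (0 < c2)%R &
    forall (x : X) (r : R), E x -> (0 < r <= 1)%R ->
      c1%:E * codim_gauge mu theta x r
        <= codim_hausdorff mu theta (ball x r `&` E)
        <= c2%:E * codim_gauge mu theta x r].

(* L_p(X, mu), as almost-everywhere classes. For [mu := outer_restr H E] this
   is L_p(E, H restricted to E): the complement of [E] is then negligible, so
   a class is determined by the values on [E] of any representative. *)
Definition Lp mu (p : R) (p1 : 1 <= p%:E) := LspaceType (cara_measure mu) p1.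

Definition Lp_norm mu (p : R) f : \bar R :=
  'N[cara_measure mu]_(p%:E)[EFin \o f].

Definition besov_seminorm mu (s p : R) f : \bar R :=
  \int[lebesgue_measure]_(t in `]0%R, 1%R[)
    ((t `^ (- s))%:E * 'N[cara_measure mu]_(p%:E)[mean_osc mu f t]
      * (t^-1)%:E).

Definition besov_norm mu (s p : R) f : \bar R :=
  Lp_norm mu p f + besov_seminorm mu s p f.

Definition besov mu (s p : R) (p1 : 1 <= p%:E) : set (Lp mu p1) :=
  [set f | besov_seminorm mu s p f < +oo].

Definition is_trace mu nu E f (phi : X -> R) : Prop :=
  {ae cara_measure nu, forall x, E x ->
    avg mu (ball x r) (fun y => `|f y - phi x|%:E) @[r --> (0%R : R)^'+] --> 0}.

(* The trace as a relation on classes: a trace need not exist, and it is unique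
   when [f] is locally integrable and [nu] is concentrated on [E]; "the trace
   of [f] is [phi]" is [Tr mu nu E f = [set phi]]. *)
Definition Tr mu nu E f : set (L0 nu) :=
  [set phi : L0 nu | is_trace mu nu E f phi].

End metric_measure_spaces.

Arguments Tr {R X} mu nu E f.
Arguments besov {R X} mu s {p} p1.

(* Main.v *)
Require Import Defs.
From HB Require Import structures.
From mathcomp Require Import all_boot all_order all_algebra.
From mathcomp Require Import all_classical all_reals all_analysis.
From mathcomp Require Import measurable_realfun ring lra zify.

(** Write [nu] for the codimension-[theta] Hausdorff measure restricted to [E]
    and [s = theta / p].

    One layer.  Let [G] be a bounded Lipschitz function of bounded support and
    let [f] be the product of [G] with a cutoff that equals 1 on [E] and
    vanishes at distance [e] from [E].  Ahlfors--David regularity makes [mu],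
    on the layer of width [t] around [E], comparable with [t ^ theta] times
    [nu], so an L_p norm over that layer is at most [t ^ s] times an L_p norm
    over [E] (ball_transfer, mu_nu_Lnorm).  Consider the oscillation of [f] at
    scale [t].  If [t <= e] it is of order [t / e] times [|G|] on the layer of
    width [e]: after multiplication by [t ^ (- s)] its norm is of order
    [(t / e) ^ (1 - s)] times the norm of [G].  If [e <= t] the layer of width
    [e] fills only the fraction [(e / t) ^ theta] of a ball of radius [t], and
    the norm is of order [(e / t) ^ theta] times that of [G].  Over dyadic
    scales these are two geometric series whose sum does not depend on [e],
    because [0 < s < 1] and [0 < theta].  Scales so large that [G] is not
    almost constant on balls contribute as little as desired once [e] is small
    enough, as the layer shrinks to a null set.  Hence, for every [d > 0], a
    sufficiently thin layer gives an extension of [G] whose Besov norm is at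
    most [C * (N + d)], where [N] bounds the norm of [G] in [L_p(nu)]
    (exists_layer_extension).  How thin depends on the size, the support and
    the Lipschitz constant of [G], which is where linearity is lost.

    All layers.  Bounded Lipschitz functions of bounded support are dense in
    [L_p(nu)] (Lp_approximable), because the Hausdorff measure is a metric
    outer measure and [nu] is outer regular in balls.  Choose such [g k] with
    [g 0 = 0] and with the norm of [phi - g k] at most [2 ^ (- k)] times that
    of [phi], extend each difference [g k.+1 - g k] in its own layer with an
    error [d k] of the same order, and sum the extensions.  The seminorm is
    subadditive over the series, so the sum has norm at most a constant times
    the norm of [phi] (besov_layered_sum, exists_extends).

    Trace.  Since the norms of [phi - g k] are summable, [sum |phi - g k|] is
    finite at [nu]-almost every point [x].  The averages around such an [x] of
    the k-th extension are at most [|g k.+1 x - g k x| + d k] for every radius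
    below 1, so the tail of the series is small uniformly in the radius, while
    the remaining finitely many terms are Lipschitz and agree with
    [g k.+1 - g k] on [E].  The averages of the distance from the sum to
    [phi x] thus tend to 0 (trace_layered_sum).  A function has at most one
    trace up to [nu]-null sets (is_trace_unique), which turns this into an
    equality of sets of classes. *)

Set Implicit Arguments.
Unset Strict Implicit.
Unset Printing Implicit Defensive.

Import Order.TTheory GRing.Theory Num.Theory.
Import numFieldNormedType.Exports.

Local Open Scope classical_set_scope.
Local Open Scope ring_scope.

(** * Inequalities for integrals and L_p norms *)

Section integral_generalities.
Local Open Scope ereal_scope.
Context d (T : measurableType d) (R : realType) (m : {measure set T -> \bar R}).
Implicit Types (f g : T -> \bar R) (p : R).
Import HBNNSimple.

(** The integral of a nonnegative function is a supremum over simple minorants,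
    which makes it monotone also for functions not known to be measurable, such as
    the mean oscillation of a function as a function of the centre. *)
Lemma le_nnintegral (D : set T) f g : (forall x, D x -> 0 <= f x) ->
  (forall x, D x -> f x <= g x) ->
  \int[m]_(x in D) f x <= \int[m]_(x in D) g x.
Proof.
move=> f0 fg; have g0 x : D x -> 0 <= g x by move=> Dx; rewrite (le_trans (f0 x Dx)) ?fg.
rewrite !ge0_integralE//; apply: ereal_sup_le => /= _ [h hf <-].
exists h => // x; rewrite (le_trans (hf x))//.
by rewrite /patch; case: ifPn => //; rewrite inE; exact: fg.
Qed.

Lemma le_poweR p (a b : \bar R) : (0 <= p)%R -> 0 <= a -> a <= b -> a `^ p <= b `^ p.
Proof.
move=> p0 a0 ab; apply: gt0_ler_poweR => //.
  by rewrite in_itv/= a0 leey.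
by rewrite in_itv/= (le_trans a0 ab) leey.
Qed.

Lemma le_Lnorm p f g : (0 < p)%R -> (forall x, `|f x| <= `|g x|) ->
  'N[m]_p%:E[f] <= 'N[m]_p%:E[g].
Proof.
move=> p0 fg; rewrite unlock /Lnorm; apply: le_poweR.
- by rewrite invr_ge0 ltW.
- by apply: integral_ge0 => x _; exact: poweR_ge0.
- apply: le_nnintegral => x _; first exact: poweR_ge0.
  by apply: le_poweR => //; rewrite ltW.
Qed.

(** Minkowski's inequality for the partial sums passes to the limit by monotone
    convergence of their p-th powers. *)
Lemma Lnorm_nneseries p (h : nat -> T -> R) : (1 <= p)%R ->
  (forall k, measurable_fun setT (h k)) -> (forall k x, (0 <= h k x)%R) ->
  'N[m]_p%:E[(fun x => \sum_(k <oo) (h k x)%:E)] <=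
  \sum_(k <oo) 'N[m]_p%:E[EFin \o h k].
Proof.
move=> p1 mh h0; have p0 : (0 < p)%R := lt_le_trans ltr01 p1.
have ip0 : (0 <= p^-1)%R by rewrite invr_ge0 ltW.
pose S n x : R := (\sum_(0 <= k < n) h k x)%R.
have S0 n x : (0 <= S n x)%R by apply: sumr_ge0.
have mS n : measurable_fun setT (S n) by apply: measurable_sum.
pose L := \sum_(k <oo) 'N[m]_p%:E[EFin \o h k]; rewrite -/L.
have L0 : 0 <= L by apply: nneseries_ge0 => n _ _; exact: Lnorm_ge0.
have SL n : 'N[m]_p%:E[EFin \o S n] <= L.
  apply: (@le_trans _ _ (\sum_(0 <= k < n) 'N[m]_p%:E[EFin \o h k])); last first.
    by apply: nneseries_lim_ge => k _ _; exact: Lnorm_ge0.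
  elim: n => [|n ih].
    rewrite /S big_geq//; have -> : EFin \o (fun x => \sum_(0 <= k < 0) h k x)%R = cst 0 :> (T -> \bar R).
      by apply/funext => x /=; rewrite big_geq.
    by rewrite Lnorm0// gt_eqF.
  rewrite big_nat_recr//=; apply: le_trans (leeD ih (lexx _)).
  have -> : EFin \o S n.+1 = EFin \o (S n \+ h n)%R.
    by apply/funext => x /=; rewrite /S big_nat_recr.
  exact: minkowski_EFin.
have sE x : \sum_(k <oo) (h k x)%:E = limn (fun n => (S n x)%:E).
  by apply/congr_lim/funext => n; rewrite sumEFin.
have ndS x : nondecreasing_seq (fun n => (S n x)%:E).
  move=> i j ij; rewrite lee_fin /S (@big_cat_nat _ _ _ i 0 j)//= lerDl.
  by apply: sumr_ge0.
have ndSp x : nondecreasing_seq (fun n => (S n x)%:E `^ p).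
  by move=> i j ij; apply: le_poweR; [exact: ltW|rewrite lee_fin|exact: ndS].
rewrite {1}unlock /Lnorm -[leRHS]poweRe1// -(@mulfV _ p) ?gt_eqF// poweRrM.
apply: le_poweR => //; first by apply: integral_ge0 => x _; exact: poweR_ge0.
apply: (@le_trans _ _ (\int[m]_x limn (fun n => (S n x)%:E `^ p))).
  apply: le_nnintegral => x _; first exact: poweR_ge0.
  have F0 : 0 <= \sum_(k <oo) (h k x)%:E.
    by apply: nneseries_ge0 => n _ _; rewrite lee_fin.
  rewrite gee0_abs// sE.
  have cvp := @ereal_nondecreasing_is_cvgn _ _ (ndSp x).
  have l0 : 0 <= limn (fun n => (S n x)%:E `^ p).
    by apply: lime_ge => //; apply: nearW => n; exact: poweR_ge0.
  rewrite -[leRHS]poweRe1// -(@mulVf _ p) ?gt_eqF// poweRrM.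
  apply: le_poweR; first exact: ltW.
    by rewrite -sE; apply: nneseries_ge0 => n _ _; rewrite lee_fin.
  apply: lime_le; first exact: ereal_nondecreasing_is_cvgn.
  apply: nearW => n; rewrite -[leLHS]poweRe1 ?lee_fin// -(@mulfV _ p) ?gt_eqF// poweRrM.
  apply: le_poweR => //; first exact: poweR_ge0.
  rewrite (cvg_lim _ (ereal_nondecreasing_cvgn (ndSp x)))//.
  by apply: ereal_sup_ubound; exists n.
rewrite monotone_convergence//; last 2 first.
- move=> n; have mSn : measurable_fun setT (fun x => (S n x)%:E : \bar R) by exact/measurable_EFinP.
  exact: (measurableT_comp (measurable_poweR p) mSn).
- by move=> n x _; exact: poweR_ge0.
have eqI n : \int[m]_x (S n x)%:E `^ p = 'N[m]_p%:E[EFin \o S n] `^ p.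
  rewrite poweR_Lnorm ?gt_eqF//; apply: eq_integral => x _ /=.
  by rewrite ger0_norm.
apply: lime_le.
  apply: ereal_nondecreasing_is_cvgn => i j ij; apply: le_nnintegral => x _.
    exact: poweR_ge0.
  exact: ndSp.
by apply: nearW => n; rewrite eqI; apply: le_poweR => //; [exact: ltW|exact: Lnorm_ge0].
Qed.

Lemma Lnorm_scale p k (h : T -> R) : (0 < p)%R -> (0 <= k)%R ->
  measurable_fun setT h ->
  'N[m]_p%:E[EFin \o (fun x => k * h x)%R] = k%:E * 'N[m]_p%:E[EFin \o h].
Proof.
move=> p0 k0 mh; rewrite unlock /Lnorm.
have mhp : measurable_fun setT (fun x => `|(h x)%:E| `^ p : \bar R).
  have mah : measurable_fun setT (fun x => `|(h x)%:E| : \bar R).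
    by apply: measurableT_comp => //; exact/measurable_EFinP.
  exact: (measurableT_comp (measurable_poweR p) mah).
rewrite (eq_integral (fun x => (k `^ p)%:E * `|(h x)%:E| `^ p)); last first.
  move=> x _; rewrite -[(EFin \o _) x]/((k * h x)%:E) EFinM abseM poweRM ?abse_ge0//.
  by rewrite gee0_abs// -poweR_EFin.
rewrite ge0_integralZl_EFin ?powR_ge0//; last by move=> x _; exact: poweR_ge0.
rewrite poweRM ?lee_fin ?powR_ge0 ?integral_ge0//; last first.
  by move=> x _; exact: poweR_ge0.
by rewrite poweR_EFin -powRrM mulfV ?gt_eqF// powRr1.
Qed.

(** The sum has finite L_p norm by the countable Minkowski inequality, and a
    function of finite L_p norm is finite almost everywhere. *)
Lemma ae_nneseries_lty p (h : nat -> T -> R) : (1 <= p)%R ->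
  (forall k, measurable_fun setT (h k)) -> (forall k x, (0 <= h k x)%R) ->
  \sum_(k <oo) 'N[m]_p%:E[EFin \o h k] < +oo ->
  {ae m, forall x, \sum_(k <oo) (h k x)%:E < +oo}.
Proof.
move=> p1 mh h0 hoo; have p0 : (0 < p)%R := lt_le_trans ltr01 p1.
pose F x : \bar R := \sum_(k <oo) (h k x)%:E.
have F0 x : 0 <= F x by apply: nneseries_ge0 => n _ _; rewrite lee_fin.
have mF : measurable_fun setT F.
  by apply: ge0_emeasurable_sum => [k x _ _|k _]; [rewrite lee_fin|exact/measurable_EFinP].
have : 'N[m]_p%:E[F] < +oo by apply: le_lt_trans hoo; exact: Lnorm_nneseries.
rewrite unlock /Lnorm => /lty_poweRy; rewrite invr_eq0 gt_eqF// => /(_ isT) Foo.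
have intF : m.-integrable setT (fun x => F x `^ p).
  apply/integrableP; split.
    exact: (measurableT_comp (measurable_poweR p) mF).
  apply: le_lt_trans Foo; apply: le_nnintegral => x _; first exact: abse_ge0.
  by rewrite !gee0_abs// poweR_ge0.
have [N [mN N0 NF]] := integrable_ae measurableT intF.
exists N; split => // x /= Fx; apply: NF => /= /(_ Logic.I) Fxp; apply: Fx.
apply: (@lty_poweRy _ _ p); first by rewrite gt_eqF.
by rewrite -/(F x) ltey; case: (F x `^ p) Fxp.
Qed.

End integral_generalities.

(** * Metric outer measures and the codimension Hausdorff measure *)

Section metric_outer_measure.
Local Open Scope ereal_scope.
Context {R : realType} {X : completeMetricType R}.

Definition metric_outer_measure (nu : {outer_measure set X -> \bar R}) :=
  forall (A B : set X) (d : R), (0 < d)%R ->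
    (forall a b, A a -> B b -> (d <= mdist a b)%R) ->
    nu A + nu B <= nu (A `|` B).

(** Caratheodory's criterion.  Cut a test set [A] into shells on which [u] lies
    between consecutive reciprocals of integers.  Since [u] is 1-Lipschitz, shells
    with indices of the same parity are at positive distance, so their measures add
    up to at most that of [A] and the measures of all shells are summable.  Hence
    the part of [A] where [u] is positive is exhausted, up to a small tail, by the
    set where [u] exceeds a positive constant, and that set is at positive distance
    from the part of [A] where [u] is nonpositive. *)
Lemma caratheodory_superlevel (nu : {outer_measure set X -> \bar R})
    (u : X -> R) : metric_outer_measure nu ->
  (forall x y, (u x - u y <= mdist x y)%R) ->
  nu.-caratheodory [set x | (0 < u x)%R].
Proof.
move=> nuD ulip; apply: le_caratheodory_measurable => A.
have [->|Aoo] := eqVneq (nu A) +oo; first by rewrite leey.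
pose c n : R := (n.+1%:R^-1)%R.
have c_gt0 n : (0 < c n)%R by rewrite invr_gt0.
have c_dec n : (c n.+1 < c n)%R by rewrite ltf_pV2 ?posrE// ltr_nat.
pose P n := A `&` [set x | (c n < u x)%R].
pose r n := A `&` [set x | (c n.+2 < u x <= c n.+1)%R].
(* induction adds a shell separated from the preceding ones of its parity [e] *)
have sumr e N : \sum_(0 <= k < N) nu (r (k.*2 + e)%N) <= nu (P (N.*2 + e)%N).
  elim: N => [|N ih]; first by rewrite big_geq ?outer_measure_ge0.
  rewrite big_nat_recr//=; apply: le_trans (leeD ih (lexx _)) _.
  have d0 : (0 < c (N.*2 + e)%N - c (N.*2 + e).+1)%R by rewrite subr_gt0.
  apply: le_trans (nuD _ _ _ d0 _) _.
    move=> a b [_ /= Pa] [_ /andP[_ rb]].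
    by apply: le_trans (ulip a b); rewrite lerB// ltW.
  apply: le_outer_measure => x []; rewrite /P /r doubleS !addSn => -[Ax /=].
    by move=> cx; split => //=; rewrite (lt_trans (c_dec _))// (lt_trans (c_dec _)).
  by move=> /andP[cx _]; split.
have sumr2 N : \sum_(0 <= k < N.*2) nu (r k) =
    \sum_(0 <= k < N) nu (r (k.*2 + 0)%N) + \sum_(0 <= k < N) nu (r (k.*2 + 1)%N).
  elim: N => [|N ih]; first by rewrite !big_geq// adde0.
  by rewrite doubleS !big_nat_recr//= ih addn0 addn1 -!addeA; congr (_ + _);
    rewrite addeCA.
have PA n : nu (P n) <= nu A by apply: le_outer_measure => x [].
have sum_lty : \sum_(k <oo) nu (r k) < +oo.
  apply: (@le_lt_trans _ _ (nu A + nu A)); last by rewrite lte_add_pinfty ?ltey.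
  apply: lime_le; first by apply: is_cvg_nneseries => *; exact: outer_measure_ge0.
  apply: nearW => n; apply: (@le_trans _ _ (\sum_(0 <= k < n.*2) nu (r k))).
    apply: lee_sum_nneg_natr => [k _ _|]; first exact: outer_measure_ge0.
    by rewrite -addnn leq_addr.
  by rewrite sumr2 leeD// (le_trans (sumr _ _)).
(* it suffices to bound the sum by [nu A] plus a tail of the series *)
have tail : nu A + \sum_(n <= k <oo) nu (r k) @[n --> \oo] --> nu A.
  rewrite -[X in _ --> X]adde0; apply: cvgeD; rewrite ?fin_num_adde_defl//.
    exact: cvg_cst.
  by apply: nneseries_tail_cvg => // *; exact: outer_measure_ge0.
apply: (cvge_ge _ tail); apply: nearW => n.
have AP : nu (A `&` [set x | (0 < u x)%R]) <= nu (P n.+1) + \sum_(n <= k <oo) nu (r k).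
  rewrite -nneseries_addn; last by move=> *; exact: outer_measure_ge0.
  apply: le_trans (leeD (lexx _) (outer_measure_sigma_subadditive nu (fun k => r (k + n)%N))).
  apply: le_trans (outer_measureU2 _ _ _); apply: le_outer_measure => x [Ax /= ux].
  have exm : exists m, (c m < u x)%R.
    have [m _ hm] := near_infty_natSinv_lt (PosNum ux).
    by exists m; exact: (hm m (leqnn m)).
  have [cx|xc] := ltP (c n.+1) (u x); first by left; split.
  right; case: (ex_minnP exm) => m cm mmin.
  have nm : (n.+1 < m)%N.
    rewrite ltnNge; apply/negP => mn; move: cm; rewrite ltNge => /negP; apply.
    by rewrite (le_trans xc)// lef_pV2 ?posrE// ler_nat.
  exists (m - n.+2)%N => //; rewrite /r; split => //=.
  have -> : (m - n.+2 + n)%N = m.-2 by rewrite -(subnKC nm); lia.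
  have m2 : m.-2.+2 = m by move: nm; clear; case: m => [|[|m]].
  rewrite m2 cm/= leNgt; apply/negP => /mmin.
  by rewrite -[in X in (X <= _)%N]m2 ltnn.
have sep : nu (P n.+1) + nu (A `&` ~` [set x | (0 < u x)%R]) <= nu A.
  apply: le_trans (nuD _ _ _ (c_gt0 n.+1) _) _.
    move=> a b [_ /= ca] [_ /= /negP]; rewrite -leNgt => ub.
    by apply: le_trans (ulip a b); rewrite (le_trans (ltW ca))// lerBrDr gerDl.
  by apply: le_outer_measure => x [] [].
apply: le_trans (leeD AP (lexx _)) _.
by rewrite addeAC; exact: leeD.
Qed.

Lemma outer_restr_caratheodory (nu : {outer_measure set X -> \bar R})
    (E A : set X) : nu.-caratheodory A -> (outer_restr nu E).-caratheodory A.
Proof. by move=> nuA B; rewrite /= /outer_restr nuA setIAC -!setIA (setIC E). Qed.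

End metric_outer_measure.

Section codim_hausdorff_metric.
Local Open Scope ereal_scope.
Context {R : realType} {X : completeMetricType R}.
Variables (mu : {outer_measure set X -> \bar R}) (theta : R).

Lemma codim_gauge_ge0 x r : 0 <= codim_gauge mu theta x r.
Proof. by rewrite mule_ge0 ?outer_measure_ge0// lee_fin powR_ge0. Qed.

Lemma codim_content_le_hausdorff F delta : (0 < delta)%R ->
  codim_content mu theta delta F <= codim_hausdorff mu theta F.
Proof.
move=> d0; rewrite codim_hausdorffE; apply: ereal_sup_ubound.
by exists delta => //=; rewrite in_itv/= d0.
Qed.

(** A ball of radius less than [d] cannot meet both sets, so a cover of the union
    splits into disjoint families of balls covering each of them. *)
Lemma codim_contentD (A B : set X) (d : R) :
  (forall a b, A a -> B b -> (2 * d <= mdist a b)%R) ->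
  codim_content mu theta d A + codim_content mu theta d B <=
  codim_content mu theta d (A `|` B).
Proof.
move=> AB; apply: le_ereal_inf_tmp => _ [J [x [r [[Jr ABJ] ->]]]].
pose sub (C : set X) := J `&` [set i | ball (x i) (r i) `&` C !=set0].
have coverC C : C `<=` A `|` B ->
    codim_content mu theta d C <= \esum_(i in sub C) codim_gauge mu theta (x i) (r i).
  move=> CAB; apply: ereal_inf_lbound; exists (sub C), x, r; split => //; split.
    by move=> i [/Jr].
  by move=> t Ct; have [i Ji ti] := ABJ t (CAB t Ct); exists i => //; split => //; exists t.
apply: le_trans (leeD (coverC A _) (coverC B _)) _; [by left|by right|].
rewrite !(esum_mkcond (sub _)) (esum_mkcond J) -esumD; last 2 first.
- by move=> i _; case: ifP => // _; exact: codim_gauge_ge0.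
- by move=> i _; case: ifP => // _; exact: codim_gauge_ge0.
apply: le_esum => i _; case: ifPn => [|_]; rewrite ?inE.
  move=> [Ji [a [xa Aa]]]; case: ifPn => [|_]; last by rewrite adde0 mem_set.
  rewrite inE => -[_ [b [xb Bb]]]; exfalso.
  have /andP[_ rd] := Jr i Ji; move: (AB a b Aa Bb); rewrite leNgt => /negP; apply.
  move: xa xb; rewrite ballEmdist/= => xa xb.
  have := metric_triangle a (x i) b; rewrite (metric_sym a (x i)); lra.
rewrite add0e; case: ifPn => [|_]; first by rewrite inE => -[Ji _]; rewrite mem_set.
by case: ifP => // _; exact: codim_gauge_ge0.
Qed.

Lemma codim_hausdorff_metric : metric_outer_measure (codim_hausdorff mu theta).
Proof.
move=> A B d d0 AB.
have cv F : codim_content mu theta delta F @[delta --> (0%R : R)^'+] -->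
    codim_hausdorff mu theta F.
  by rewrite codim_hausdorffE; exact: codim_content_cvg.
apply: (cvge_le _ (cvgeD _ (cv A) (cv B))); last first.
  by rewrite ge0_adde_def// inE outer_measure_ge0.
near=> e; apply: le_trans (codim_contentD _) _; last first.
  by apply: codim_content_le_hausdorff; near: e; exact: nbhs_right_gt.
move=> a b Aa Bb; apply: le_trans (AB a b Aa Bb).
rewrite mulrC -ler_pdivlMr//; near: e; apply: nbhs_right_le.
by rewrite divr_gt0.
Unshelve. all: by end_near. Qed.

End codim_hausdorff_metric.

(** * Comparison of two measures along a separated net *)

Section separated_nets.
Context {R : realType} {X : completeMetricType R}.

(** Choose a point of [E] near every member of a countable dense set; a maximal
    disjoint subfamily of the balls of radius [t] around these points does it.
    Indeed a point of [E] lies within [t] of a chosen point, whose ball meets a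
    selected one by maximality, and [t + t + t = 3 * t]. *)
Lemma separated_net (E : set X) (t : R) : separable_space (X := X) -> E !=set0 -> 0 < t ->
  exists (J : set nat) (z : nat -> X), [/\ forall j, E (z j),
    trivIset J (fun j => ball (z j) t) &
    E `<=` \bigcup_(j in J) ball (z j) (3 * t)].
Proof.
move=> [D /countable_injP[f finj] denseD] [e0 Ee0] t0.
have /choice[q qP] : forall n, exists y, forall x, D x -> f x = n -> y = x.
  move=> n; have [[y Dy fy]|no] := pselect (exists2 y, D y & f y = n).
    by exists y => x Dx fx; apply: finj; rewrite ?inE ?fy.
  by exists e0 => x Dx fx; exfalso; apply: no; exists x.
have [z zE] : exists z : nat -> X, forall j, E (z j) /\
    ((ball (q j) (t / 2) `&` E) !=set0 -> ball (q j) (t / 2) (z j)).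
  have /choice[z zP] : forall j, exists y, E y /\
    ((ball (q j) (t / 2) `&` E) !=set0 -> ball (q j) (t / 2) y).
    move=> j; have [[y [qy Ey]]|no] := pselect ((ball (q j) (t / 2) `&` E) !=set0).
      by exists y.
    by exists e0; split.
  by exists z.
have [J [_ tJ maxJ]] := ex_maximal_disjoint_subcollection (fun j => ball (z j) t) setT.
exists J, z; split => // [j|e Ee]; first by have [] := zE j.
have [j ezj] : exists j, mdist e (z j) < t.
  have t20 : 0 < t / 2 by rewrite divr_gt0.
  have [|x [+ Dx]] := denseD (ball e (t / 2))^° _ (@open_interior _ _).
    by exists e; exact: nbhsx_ballx.
  move=> /interior_subset; rewrite -(qP _ x Dx erefl) => xe.
  have [_ zq] := zE (f x); exists (f x).
  have {}zq : ball (q (f x)) (t / 2) (z (f x)).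
    by apply: zq; exists e; split => //; exact: ball_sym.
  have := metric_triangle e (q (f x)) (z (f x)).
  move: xe zq; rewrite !ballEmdist/=; lra.
have [i [Ji [y [jy iy]]]] : exists i, J i /\ (ball (z j) t `&` ball (z i) t) !=set0.
  apply: contrapT => no; apply: (maxJ (J `|` [set j])) => //.
    split; first by left.
    move=> /(_ j (or_intror erefl)) Jj; apply: no; exists j; split => //.
    by exists (z j); split; exact: ballxx.
  move=> a b [Ja|->] [Jb|->] // abn0; first exact: tJ.
    by exfalso; apply: no; exists a; split => //; rewrite setIC.
  by exfalso; apply: no; exists b.
exists i => //; move: jy iy; rewrite !ballEmdist/= => jy iy.
have := metric_triangle (z i) y e; have := metric_triangle y (z j) e.
rewrite (metric_sym y (z j)) (metric_sym (z j) e); lra.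
Qed.

End separated_nets.

Section transfer.
Local Open Scope ereal_scope.
Context {R : realType} {X : completeMetricType R}.

Lemma nneseries_ge_term (f : nat -> \bar R) j : (forall k, 0 <= f k) ->
  f j <= \sum_(k <oo) f k.
Proof.
move=> f0; rewrite (@nneseriesD1 _ f j xpredT)// leeDl// nneseries_ge0//.
Qed.

Lemma integral_simple_series d (T : measurableType d)
    (m : {measure set T -> \bar R}) (b : nat -> \bar R) (B : nat -> set T) :
  (forall j, 0 <= b j) -> (forall j, measurable (B j)) ->
  \int[m]_x (\sum_(j <oo) b j * (\1_(B j) x)%:E) = \sum_(j <oo) b j * m (B j).
Proof.
move=> b0 mB; rewrite integral_nneseries//; last 2 first.
- move=> j; apply: measurable_funeM; apply/measurable_EFinP.
  exact: measurable_indic.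
- by move=> j x _; rewrite mule_ge0// lee_fin.
apply: eq_eseriesr => j _; rewrite ge0_integralZl//; last first.
  by apply/measurable_EFinP; exact: measurable_indic.
by rewrite integral_indic// setIT.
Qed.

(** Discretization along a net of [E].  The sum over the net of the suprema of [u]
    on the balls of radius [4 * t], times their indicators, dominates [u].  With the
    balls of radius [t] instead it is dominated by [v], because those balls are
    disjoint and points of concentric balls are within [5 * t].  The comparison of
    the measures of balls then compares the two integrals term by term. *)
Lemma ball_transfer (m1 m2 : {outer_measure set X -> \bar R}) (E : set X)
    (t c : R) (u v : X -> \bar R) :
  separable_space (X := X) -> (0 < t)%R -> (0 <= c)%R ->
  (forall x r, m1.-caratheodory (ball x r)) ->
  (forall x r, m2.-caratheodory (ball x r)) ->
  (forall z, E z -> m1 (ball z (4 * t)%R) <= c%:E * m2 (ball z t)) ->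
  (forall y, 0 <= u y) -> (forall y, 0 <= v y) ->
  (forall y, 0 < u y -> exists2 z, E z & (mdist y z < t)%R) ->
  (forall y z, (mdist y z < 5 * t)%R -> u y <= v z) ->
  \int[cara_measure m1]_x u x <= c%:E * \int[cara_measure m2]_x v x.
Proof.
move=> sX t0 c0 mb1 mb2 m12 u0 v0 uE uv.
have [E0|/set0P En0] := eqVneq E set0.
  rewrite (_ : (fun x => u x) = cst 0) ?integral0 ?mule_ge0 ?integral_ge0//.
  apply/funext => y; apply/eqP; rewrite eq_le u0 andbT leNgt; apply/negP.
  by move=> /uE[z]; rewrite E0.
have [J [z [zE tJ EJ]]] := separated_net sX En0 t0.
(* outside [J] the coefficient is 0, which extends sums over [J] to all indices *)
pose b j := if j \in J then ereal_sup (u @` ball (z j) (4 * t)%R) else 0.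
have b0 j : 0 <= b j.
  rewrite /b; case: ifP => // _; apply: le_trans (u0 (z j)) _.
  apply: ereal_sup_ubound; exists (z j) => //; apply: ballxx.
  by rewrite mulr_gt0.
pose S r x : \bar R := \sum_(j <oo) b j * (\1_(ball (z j) r) x)%:E.
have term0 r x j : 0 <= b j * (\1_(ball (z j) r) x)%:E.
  by rewrite mule_ge0// lee_fin.
have uS x : u x <= S (4 * t)%R x.
  have [ux|] := ltP 0 (u x); last first.
    by move=> /le_trans; apply; apply: nneseries_ge0 => *; exact: term0.
  have [e Ee xe] := uE _ ux; have [j Jj je] := EJ _ Ee.
  have jx : ball (z j) (4 * t)%R x.
    move: je; rewrite !ballEmdist/= => je.
    have := metric_triangle (z j) e x; rewrite (metric_sym e x); lra.
  apply: le_trans (nneseries_ge_term j (term0 _ x)).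
  rewrite indicE mem_set// mule1 /b mem_set//; apply: ereal_sup_ubound.
  by exists x.
have Sv x : S t x <= v x.
  have [[j Jj jx]|no] := pselect (exists2 j, J j & ball (z j) t x); last first.
    rewrite /S eseries0// => j _ _; rewrite /b; case: ifPn => [|_]; last by rewrite mul0e.
    rewrite inE => Jj; rewrite indicE memNset ?mule0// => jx.
    by apply: no; exists j.
  rewrite /S (@nneseriesD1 _ _ j)//= eseries0 => [|k _ /= kj]; last first.
    rewrite /b; case: ifPn => [|_]; last by rewrite mul0e.
    rewrite inE => Jk; rewrite indicE memNset ?mule0// => kx.
    by move/eqP : kj; apply; apply: (tJ _ _ Jk Jj); exists x.
  rewrite adde0 indicE mem_set// mule1 /b mem_set//.
  apply: ge_ereal_sup => _ [y jy <-]; apply: uv.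
  move: jx jy; rewrite !ballEmdist/= => jx jy.
  have := metric_triangle y (z j) x; rewrite (metric_sym y (z j)); lra.
apply: (@le_trans _ _ (\int[cara_measure m1]_x S (4 * t)%R x)).
  by apply: le_nnintegral => x _; [exact: u0|exact: uS].
rewrite (@integral_simple_series _ (caratheodory_type m1) (cara_measure m1) b
  (fun j => ball (z j) (4 * t)%R))//; last by move=> j; exact: mb1.
apply: (@le_trans _ _ (c%:E * \int[cara_measure m2]_x S t x)); last first.
  rewrite lee_wpmul2l// ?lee_fin//; apply: le_nnintegral => x _ //.
  by apply: nneseries_ge0 => *; exact: term0.
rewrite (@integral_simple_series _ (caratheodory_type m2) (cara_measure m2) b
  (fun j => ball (z j) t))//; last by move=> j; exact: mb2.
rewrite -nneseriesZl; last first.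
  by move=> j _; rewrite mule_ge0// outer_measure_ge0.
apply: lee_nneseries => [j _ _|j _]; first by rewrite mule_ge0// outer_measure_ge0.
by rewrite muleCA lee_wpmul2l// m12.
Qed.

Lemma ball_transfer_Lnorm (m1 m2 : {outer_measure set X -> \bar R}) (E : set X)
    (t c p : R) (u v : X -> \bar R) :
  separable_space (X := X) -> (0 < t)%R -> (0 <= c)%R -> (0 < p)%R ->
  (forall x r, m1.-caratheodory (ball x r)) ->
  (forall x r, m2.-caratheodory (ball x r)) ->
  (forall z, E z -> m1 (ball z (4 * t)%R) <= c%:E * m2 (ball z t)) ->
  (forall y, 0 <= u y) -> (forall y, 0 <= v y) ->
  (forall y, 0 < u y -> exists2 z, E z & (mdist y z < t)%R) ->
  (forall y z, (mdist y z < 5 * t)%R -> u y <= v z) ->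
  'N[cara_measure m1]_p%:E[u] <= (c `^ p^-1)%:E * 'N[cara_measure m2]_p%:E[v].
Proof.
move=> sX t0 c0 p0 mb1 mb2 m12 u0 v0 uE uv; rewrite unlock /Lnorm.
rewrite -poweR_EFin -poweRM ?lee_fin//; last first.
  by apply: integral_ge0 => x _; exact: poweR_ge0.
apply: le_poweR.
- by rewrite invr_ge0 ltW.
- by apply: integral_ge0 => x _; exact: poweR_ge0.
apply: (ball_transfer sX t0 c0 mb1 mb2 m12) => [y|y|y|y z yz].
- exact: poweR_ge0.
- exact: poweR_ge0.
- by rewrite gee0_abs// => /(gt0_poweR p0 (u0 y)); exact: uE.
- by rewrite !gee0_abs//; apply: le_poweR; rewrite ?uv// ltW.
Qed.

End transfer.

(** * Distance to a set and measurability of Lipschitz functions *)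

Section set_distance.
Context {R : realType} {X : completeMetricType R}.
Implicit Types (A : set X) (x y z : X).

(** The infimum of the empty set is 0, so the distance to the empty set vanishes;
    lemmas that produce a point of [A] therefore ask for [A] to be nonempty. *)
Definition set_dist A x : R := inf [set mdist x z | z in A].

Lemma set_dist_has_lbound A x : has_lbound [set mdist x z | z in A].
Proof. by exists 0 => _ [z _ <-]; exact: mdist_ge0. Qed.

Lemma set_dist_ge0 A x : 0 <= set_dist A x.
Proof.
have [->|/set0P[a Aa]] := eqVneq A set0; first by rewrite /set_dist image_set0 inf0.
by apply: lb_le_inf => [|_ [z _ <-]]; [exists (mdist x a), a|exact: mdist_ge0].
Qed.

Lemma set_dist_le A x z : A z -> set_dist A x <= mdist x z.
Proof. by move=> Az; apply: (ge_inf (set_dist_has_lbound A x)); exists z. Qed.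

Lemma set_dist0 A x : A x -> set_dist A x = 0.
Proof.
move=> Ax; apply/eqP; rewrite eq_le set_dist_ge0 andbT.
by rewrite -(mdistxx x) set_dist_le.
Qed.

Lemma set_dist_lt A x t : A !=set0 -> set_dist A x < t -> exists2 z, A z & mdist x z < t.
Proof.
move=> [a Aa] At; have [|_ [z Az <-] zt] := inf_lt _ At.
  by exists (mdist x a), a.
by exists z.
Qed.

Lemma set_dist_lip A x y : set_dist A x - set_dist A y <= mdist x y.
Proof.
have [->|/set0P An0] := eqVneq A set0.
  by rewrite /set_dist !image_set0 subrr mdist_ge0.
rewrite lerBlDr; apply/ler_addgt0Pr => e e0.
have [|z Az yz] := @set_dist_lt A y (set_dist A y + e) An0; first by rewrite ltrDl.
have := set_dist_le x Az; have := metric_triangle x y z; lra.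
Qed.

Lemma set_dist_gt0 A x : closed A -> A !=set0 -> ~ A x -> 0 < set_dist A x.
Proof.
move=> cA An0 nAx; rewrite lt_neqAle set_dist_ge0 andbT eq_sym; apply/eqP => d0.
apply: nAx; apply: cA => B /nbhs_ballP[e /= e0 eB].
have [z Az xz] : exists2 z, A z & mdist x z < e.
  by apply: set_dist_lt => //; rewrite d0.
by exists z; split => //; apply: eB; rewrite ballEmdist.
Qed.

End set_distance.

Section lipschitz_measurability.
Local Open Scope ereal_scope.
Context {R : realType} {X : completeMetricType R}.
Implicit Types (m : {outer_measure set X -> \bar R}).

(** One inequality suffices: exchanging the two points gives the other half of
    the 1-Lipschitz condition. *)
Definition short (u : X -> R) := forall x y, (u x - u y <= mdist x y)%R.

(** This property is shared by Borel regular outer measures and by the restricted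
    Hausdorff measure, and makes balls, thickenings, open sets and Lipschitz
    functions measurable; it allows both measures to be treated at once. *)
Definition superlevel_measurable m := forall u : X -> R, short u ->
  m.-caratheodory [set x | (0 < u x)%R].

Lemma open_superlevel (u : X -> R) : short u -> open [set x | (0 < u x)%R].
Proof.
move=> ulip; rewrite openE => x /= ux; apply/nbhs_ballP; exists (u x) => //= y.
rewrite ballEmdist/= => xy; have := ulip x y; lra.
Qed.

Lemma borel_regular_superlevel m : borel_regular m -> superlevel_measurable m.
Proof.
move=> [bm _] u ulip; apply: bm; apply: sub_sigma_algebra.
exact: open_superlevel.
Qed.

Lemma short_ball (x : X) (r : R) : short (fun y => r - mdist x y)%R.
Proof.
move=> y z; have := metric_triangle x y z; rewrite /=.
lra.
Qed.

Lemma superlevel_ball m x r : superlevel_measurable m -> m.-caratheodory (ball x r).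
Proof.
move=> mm; have -> : ball x r = [set y | (0 < r - mdist x y)%R].
  by rewrite ballEmdist; apply/seteqP; split => y /=; rewrite subr_gt0.
by apply: mm; exact: short_ball.
Qed.

Lemma superlevel_thickening m (A : set X) t : superlevel_measurable m ->
  m.-caratheodory [set x | (set_dist A x < t)%R].
Proof.
move=> mm; have -> : [set x | (set_dist A x < t)%R] = [set x | (0 < t - set_dist A x)%R].
  by apply/seteqP; split => y /=; rewrite subr_gt0.
apply: mm => x y; have := set_dist_lip A y x; rewrite metric_sym; lra.
Qed.

Lemma measurable_lipschitz m (f : X -> R) : superlevel_measurable m ->
  lipschitz_fun f -> measurable_fun [set: caratheodory_type m] (f : caratheodory_type m -> R).
Proof.
move=> mm [L fL]; apply: (measurability _ (RGenOInfty.measurableE R)) => //.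
move=> _ [_ [a ->] <-]; rewrite setTI.
pose K := (`|L| + 1)%R; have K0 : (0 < K)%R by rewrite ltr_wpDl.
have -> : f @^-1` `]a, +oo[%classic = [set x | (0 < K^-1 * (f x - a))%R].
  apply/seteqP; split => x /=; rewrite in_itv/= andbT pmulr_rgt0 ?invr_gt0//.
    by rewrite subr_gt0.
  by rewrite subr_gt0.
apply: mm => x y; rewrite -mulrBr ler_pdivrMl//.
have := fL x y; have := ler_norm (f x - f y)%R; have := ler_norm L.
have := mdist_ge0 x y; rewrite /K; nra.
Qed.

End lipschitz_measurability.

(** * Layers around a codimension regular set *)

Section codimension_geometry.
Local Open Scope ereal_scope.
Context {R : realType} {X : completeMetricType R}.
Variables (mu : {outer_measure set X -> \bar R}) (theta : R) (E : set X).
Hypotheses (mmsX : metric_measure_space mu)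
  (dblX : uniformly_locally_doubling mu) (theta0 : (0 < theta)%R)
  (ADE : ahlfors_david_regular mu theta E) (En0 : E !=set0).

Local Notation nu := (outer_restr (codim_hausdorff mu theta) E
  : {outer_measure set X -> \bar R}).

Lemma mu_superlevel : superlevel_measurable mu.
Proof. by have [_ + _] := mmsX; exact: borel_regular_superlevel. Qed.

(** The Hausdorff measure is a metric outer measure, and restriction to a set
    preserves Caratheodory measurability. *)
Lemma nu_superlevel : superlevel_measurable nu.
Proof.
move=> u ulip; apply: outer_restr_caratheodory.
by apply: caratheodory_superlevel => //; exact: codim_hausdorff_metric.
Qed.

Lemma mu_ballE x r : (0 < r)%R -> exists2 a : R, (0 < a)%R & mu (ball x r) = a%:E.
Proof.
move=> r0; have [_ _ /(_ x r r0)/andP[m0 moo]] := mmsX.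
exists (fine (mu (ball x r))); first by rewrite fine_gt0// m0.
by rewrite fineK// ge0_fin_numE// ltW.
Qed.

Lemma ball_subset (x y : X) (r s : R) : (mdist x y + r <= s)%R -> ball y r `<=` ball x s.
Proof.
move=> rs z; rewrite !ballEmdist/= => yz.
by have := metric_triangle x y z; lra.
Qed.

Lemma doubling_pow (rho : R) k : (0 < rho)%R -> exists2 C : R, (0 < C)%R &
  forall (x : X) (r : R), (0 < r <= rho)%R ->
    mu (ball x (2 ^+ k * r)%R) <= C%:E * mu (ball x r).
Proof.
move=> rho0; elim: k => [|k [C C0 ih]].
  by exists 1%R => // x r _; rewrite expr0 mul1r mul1e.
have [D D0 dD] := dblX (mulr_gt0 (exprn_gt0 k (ltr0n R 2)) rho0).
exists (D * C)%R; first exact: mulr_gt0.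
move=> x r /andP[r0 rrho]; rewrite exprS -mulrA EFinM -muleA.
apply: le_trans (dD _ _ _) _; first by rewrite mulr_gt0 ?exprn_gt0//= ler_pM2l ?exprn_gt0.
apply: lee_wpmul2l; first by rewrite lee_fin ltW.
by apply: ih; rewrite r0.
Qed.

(** Doubling brings the ball of radius [4 * t] back to radius [t], where the lower
    regularity bound applies. *)
Lemma nu_ball_ge : exists2 C : R, (0 < C)%R & forall (z : X) (t : R), E z -> (0 < t <= 1)%R ->
  mu (ball z (4 * t)%R) <= (C * t `^ theta)%:E * nu (ball z t).
Proof.
have [_ [c1 [c2 [c10 c20 AD]]]] := ADE.
have [D D0 dD] := @doubling_pow 1 2 ltr01.
exists (D * c1^-1)%R; first by rewrite mulr_gt0 ?invr_gt0.
move=> z t Ez t01; have /andP[t0 t1] := t01.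
have := dD z t t01; rewrite (_ : 2 ^+ 2 = 4 :> R)%R; last by rewrite -natrX.
move=> /le_trans; apply.
have /andP[+ _] := AD z t Ez t01; rewrite /codim_gauge.
have [a a0 ->] := mu_ballE z t0; rewrite -!EFinM => le1.
apply: (@le_trans _ _ ((D * c1^-1 * t `^ theta)%:E * (c1 * (a * t `^ (- theta)))%:E)).
  rewrite -EFinM lee_fin le_eqVlt; apply/orP; left; apply/eqP.
  by rewrite powRN; field; rewrite !gt_eqF// powR_gt0.
by rewrite lee_wpmul2l// lee_fin !mulr_ge0 ?powR_ge0 ?invr_ge0 ?ltW.
Qed.

(** The upper regularity bound at radius [4 * t], which has to be at most 1, and
    doubling to return to radius [t]. *)
Lemma nu_ball_le : exists2 C : R, (0 < C)%R & forall (z : X) (t : R), E z -> (0 < t <= 4^-1)%R ->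
  nu (ball z (4 * t)%R) <= (C * t `^ (- theta))%:E * mu (ball z t).
Proof.
have [_ [c1 [c2 [c10 c20 AD]]]] := ADE.
have [D D0 dD] := @doubling_pow 1 2 ltr01.
exists (c2 * D)%R; first by rewrite mulr_gt0.
move=> z t Ez /andP[t0 t4]; have t41 : (0 < 4 * t <= 1)%R by apply/andP; split; lra.
have /andP[_ /le_trans] := AD z _ Ez t41; apply; rewrite /codim_gauge.
have t01 : (0 < t <= 1)%R by apply/andP; split; lra.
have := dD z t t01; rewrite (_ : 2 ^+ 2 = 4 :> R)%R; last by rewrite -natrX.
have [a a0 ->] := mu_ballE z t0.
have [|b b0 ->] := @mu_ballE z (4 * t)%R; first by lra.
rewrite -!EFinM !lee_fin => ab.
have le4 : ((4 * t) `^ (- theta) <= t `^ (- theta))%R.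
  rewrite !powRN lef_pV2 ?posrE ?powR_gt0//; last by lra.
  by apply: ge0_ler_powR; rewrite ?nnegrE; [exact: ltW|lra|lra|lra].
have -> : (c2 * D * t `^ (- theta) * a = c2 * (D * a * t `^ (- theta)))%R by ring.
by rewrite ler_pM2l// ler_pM ?powR_ge0// ltW.
Qed.

(** Regularity speaks of balls of radius at most 1 centred in [E].  Comparing the
    indicator of an arbitrary ball with that of a slightly larger ball, from [nu] to
    [mu], gives finiteness in general. *)
Lemma nu_ball_fin x r : nu (ball x r) < +oo.
Proof.
have [C C0 le1] := nu_ball_le.
pose t : R := (4^-1)%R; have t0 : (0 < t)%R by rewrite invr_gt0.
have tt : (0 < t <= 4^-1)%R by rewrite t0 lexx.
pose A := ball x r `&` [set y | (set_dist E y < t)%R].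
have mA : nu.-caratheodory A.
  apply: caratheodory_measurable_setI; first exact: superlevel_ball nu_superlevel.
  exact: superlevel_thickening nu_superlevel.
have -> : nu (ball x r) = nu A.
  rewrite /= /outer_restr; congr (codim_hausdorff mu theta _).
  apply/seteqP; split => [y [xy Ey]|y [[xy _] Ey]] //; split => //; split => //=.
  by rewrite set_dist0.
have -> : nu A = \int[cara_measure nu]_y (\1_A y)%:E.
  by rewrite (@integral_indic _ (caratheodory_type nu) R (cara_measure nu) setT measurableT A mA) setIT.
have sX : separable_space (X := X) by have [] := mmsX.
apply: le_lt_trans (@ball_transfer _ _ nu mu E t (C * t `^ (- theta)) _
  (fun y => (\1_(ball x (r + 5 * t)%R) y)%:E) sX t0 _ _ _ _ _ _ _ _) _.
- by rewrite mulr_ge0 ?powR_ge0// ltW.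
- by move=> y s; exact: superlevel_ball nu_superlevel.
- by move=> y s; exact: superlevel_ball mu_superlevel.
- by move=> z Ez; exact: le1.
- by move=> y; rewrite lee_fin.
- by move=> y; rewrite lee_fin.
- move=> y; rewrite lte_fin indicE; have [|] := boolP (y \in A); last by rewrite ltxx.
  by rewrite inE => -[_ /= yE] _; exact: set_dist_lt.
- move=> y z yz; rewrite lee_fin !indicE; have [|//] := boolP (y \in A).
  rewrite inE => -[xy _]; rewrite mem_set//.
  move: xy; rewrite !ballEmdist/= => xy; have := metric_triangle x y z; lra.
have [r5|r5] := ltP 0%R (r + 5 * t)%R; last first.
  rewrite (_ : ball x (r + 5 * t)%R = set0).
    by under eq_integral do rewrite indic0/=; rewrite integral0 mule0.
  apply/seteqP; split => // y; rewrite ballEmdist/= => xy.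
  by have := mdist_ge0 x y; lra.
have mB : mu.-caratheodory (ball x (r + 5 * t)%R) by exact: superlevel_ball mu_superlevel.
rewrite (@integral_indic _ (caratheodory_type mu) R (cara_measure mu) setT measurableT _ mB) setIT.
have [a a0 aE] := mu_ballE x r5.
by rewrite /cara_measure/= aE -EFinM ltry.
Qed.

(** The factor [t ^ theta] in the comparison of the measures of balls becomes
    [t ^ (theta / p)] in L_p, which is the power that the weight [t ^ (- s)] of the
    Besov seminorm cancels. *)
Lemma mu_nu_Lnorm (p : R) : (0 < p)%R -> exists2 C : R, (0 < C)%R &
  forall (t : R) (u v : X -> \bar R), (0 < t <= 1)%R ->
  (forall y, 0 <= u y) -> (forall y, 0 <= v y) ->
  (forall y, 0 < u y -> (set_dist E y < t)%R) ->
  (forall y z, (mdist y z < 5 * t)%R -> u y <= v z) ->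
  'N[cara_measure mu]_p%:E[u] <=
    (C * t `^ (theta / p))%:E * 'N[cara_measure nu]_p%:E[v].
Proof.
move=> p0; have [C C0 geC] := nu_ball_ge.
exists (C `^ p^-1)%R; first exact: powR_gt0.
move=> t u v t01 u0 v0 uE uv; have /andP[t0 t1] := t01.
rewrite powRrM -powRM ?powR_ge0 ?(ltW C0)//.
have sX : separable_space (X := X) by have [] := mmsX.
apply: (@ball_transfer_Lnorm _ _ mu nu E t _ p u v sX t0) => //.
- by rewrite mulr_ge0 ?powR_ge0// ltW.
- by move=> y s; exact: superlevel_ball mu_superlevel.
- by move=> y s; exact: superlevel_ball nu_superlevel.
- by move=> z Ez; exact: geC.
- by move=> y /uE; exact: set_dist_lt.
Qed.

Lemma integral_indic_cara (m : {outer_measure set X -> \bar R}) (A : set X) :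
  m.-caratheodory A -> \int[cara_measure m]_y (\1_A y)%:E = m A.
Proof.
move=> mA; rewrite (@integral_indic _ (caratheodory_type m) R (cara_measure m)
  setT measurableT A mA).
by rewrite setIT.
Qed.

Lemma Lnorm_indic (m : {outer_measure set X -> \bar R}) (A : set X) (p : R) :
  (0 < p)%R -> m.-caratheodory A ->
  'N[cara_measure m]_p%:E[EFin \o \1_A] = m A `^ p^-1.
Proof.
move=> p0 mA; rewrite unlock /Lnorm; congr (_ `^ _).
rewrite (eq_integral (fun x : caratheodory_type m => (\1_A x)%:E)).
  exact: integral_indic_cara.
move=> x _ /=; rewrite indicE; case: (x \in A) => /=.
  by rewrite normr1 powR1.
by rewrite normr0 powR0// gt_eqF.
Qed.

Lemma Lnorm1_indic (m : {outer_measure set X -> \bar R}) (A : set X) :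
  m.-caratheodory A -> 'N[cara_measure m]_1%:E[(fun y => (\1_A y)%:E)] = m A.
Proof. by move=> mA; rewrite (Lnorm_indic ltr01 mA) invr1 poweRe1. Qed.

(** The case of indicators and exponent 1 of the comparison of norms. *)
Lemma mu_layer_le : exists2 C : R, (0 < C)%R & forall (x : X) (r t : R),
  (0 < t <= 1)%R ->
  mu (ball x r `&` [set y | (set_dist E y < t)%R]) <=
  (C * t `^ theta)%:E * nu (ball x (r + 5 * t)%R).
Proof.
have [C C0 geC] := mu_nu_Lnorm ltr01.
exists C => // x r t t01.
have mA : mu.-caratheodory (ball x r `&` [set y | (set_dist E y < t)%R]).
  apply: caratheodory_measurable_setI; first exact: superlevel_ball mu_superlevel.
  exact: superlevel_thickening mu_superlevel.
have mB : nu.-caratheodory (ball x (r + 5 * t)%R) by exact: superlevel_ball nu_superlevel.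
have := geC t (fun y => (\1_(ball x r `&` [set y | (set_dist E y < t)%R]) y)%:E)
  (fun y => (\1_(ball x (r + 5 * t)%R) y)%:E) t01.
rewrite !Lnorm1_indic// divr1; apply.
- by move=> y; rewrite lee_fin.
- by move=> y; rewrite lee_fin.
- move=> y; rewrite lte_fin indicE; case: (boolP (y \in _)); last by rewrite ltxx.
  by rewrite inE => -[_].
- move=> y z yz; rewrite lee_fin !indicE; case: (boolP (y \in _)) => //.
  rewrite inE => -[xy _]; rewrite mem_set//.
  move: xy; rewrite !ballEmdist/= => xy; have := metric_triangle x y z; lra.
Qed.

(** The layer of width [e] has measure of order [e ^ theta] times the [nu]-measure
    of a comparable ball, and the latter is of order [t ^ (- theta)] times its
    [mu]-measure. *)
Lemma mu_layer_density : exists2 C : R, (0 < C)%R & forall (x : X) (e t : R),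
  (0 < e <= t)%R -> (t <= 8^-1)%R -> (set_dist E x < 2 * t)%R ->
  mu (ball x t `&` [set y | (set_dist E y < e)%R]) <=
  (C * (e / t) `^ theta)%:E * mu (ball x t).
Proof.
have [C C0 leC] := mu_layer_le; have [B B0 leB] := nu_ball_le.
have [D D0 dD] := @doubling_pow 1 2 ltr01.
exists (C * B * D)%R; first by rewrite !mulr_gt0.
move=> x e t /andP[e0 et] t8 xt.
have t0 : (0 < t)%R by lra.
have [z Ez xz] := set_dist_lt En0 xt.
apply: (le_trans (leC x t e _)); first by apply/andP; split; lra.
have nule : nu (ball x (t + 5 * e)%R) <= (B * t `^ (- theta))%:E * (D%:E * mu (ball x t)).
  apply: (@le_trans _ _ (nu (ball z (4 * (2 * t))%R))).
    apply: le_outer_measure; apply: ball_subset; rewrite metric_sym; lra.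
  apply: le_trans (leB z _ Ez _) _; first by apply/andP; split; lra.
  apply: lee_pmul.
  - by rewrite lee_fin mulr_ge0 ?powR_ge0// ltW.
  - exact: outer_measure_ge0.
  - rewrite lee_fin ler_pM2l// !powRN lef_pV2 ?posrE ?powR_gt0//; last by lra.
    by apply: ge0_ler_powR; rewrite ?nnegrE; [exact: ltW|lra|lra|lra].
  - apply: le_trans (dD x t _); last by apply/andP; split; lra.
    rewrite (_ : 2 ^+ 2 = 4 :> R)%R; last by rewrite -natrX.
    by apply: le_outer_measure; apply: ball_subset; lra.
apply: le_trans (lee_wpmul2l _ nule) _; first by rewrite lee_fin mulr_ge0 ?powR_ge0// ltW.
rewrite !muleA -!EFinM; apply: lee_wpmul2r; first exact: outer_measure_ge0.
have -> : ((e / t) `^ theta = e `^ theta * t `^ (- theta))%R.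
  by rewrite powRM ?invr_ge0 ?(ltW e0) ?(ltW t0)// -powR_inv1 ?(ltW t0)// -powRrM mulN1r.
by rewrite lee_fin le_eqVlt; apply/orP; left; apply/eqP; ring.
Qed.

(** Doubling each such ball a fixed number of times covers the ball around [x0]. *)
Lemma mu_ball_ge (x0 : X) (r t : R) : (0 < t)%R -> exists2 c : R, (0 < c)%R &
  forall x, ball x0 r x -> c%:E <= mu (ball x t).
Proof.
move=> t0; have [r0|r0] := leP r 0%R.
  exists 1%R => // x; rewrite ballEmdist/= => xr.
  by exfalso; have := mdist_ge0 x0 x; lra.
pose k := Num.bound (2 * r / t).
have kr : (2 * r <= 2 ^+ k * t)%R.
  rewrite -ler_pdivrMr//; apply: ltW.
  apply: lt_trans (archi_boundP _) _; first by rewrite mulr_ge0 ?invr_ge0 ?mulr_ge0// ltW.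
  by rewrite -natrX ltr_nat ltn_expl.
have [D D0 dD] := doubling_pow k t0.
have [a a0 aE] := mu_ballE x0 r0.
exists (D^-1 * a)%R; first by rewrite mulr_gt0 ?invr_gt0.
move=> x xr; have [b b0 bE] := mu_ballE x t0.
rewrite bE lee_fin ler_pdivrMl// -lee_fin EFinM -bE -aE.
apply: le_trans (dD x t _); last by rewrite t0 lexx.
apply: le_outer_measure; apply: ball_subset; rewrite metric_sym.
by move: xr; rewrite ballEmdist/=; lra.
Qed.

(** The width enters the bound for the layer through [e ^ theta], and the
    [nu]-measure of the ball is finite. *)
Lemma mu_layer_vanish (x : X) (r d : R) : (0 < d)%R -> exists2 e0 : R, (0 < e0)%R &
  forall e, (0 < e <= e0)%R ->
  mu (ball x r `&` [set y | (set_dist E y < e)%R]) <= d%:E.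
Proof.
move=> d0; have [C C0 leC] := mu_layer_le.
have := nu_ball_fin x (r + 5)%R; set N := nu _ => Noo.
have N0 : 0 <= N by exact: outer_measure_ge0.
have Nf : N \is a fin_num by rewrite ge0_fin_numE.
pose b := fine N; have b0 : (0 <= b)%R by rewrite fine_ge0.
pose eta := (d / (C * b + 1))%R.
have Cb : (0 < C * b + 1)%R by rewrite ltr_wpDl// mulr_ge0// ltW.
have eta0 : (0 < eta)%R by rewrite divr_gt0.
exists (Num.min 1 (eta `^ theta^-1))%R; first by rewrite lt_min ltr01 powR_gt0.
move=> e /andP[e0]; rewrite le_min => /andP[e1 ee].
apply: le_trans (leC x r e _) _; first by rewrite e0.
apply: (@le_trans _ _ ((C * eta)%:E * N)).
  apply: lee_pmul.
  - by rewrite lee_fin mulr_ge0 ?powR_ge0// ltW.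
  - exact: outer_measure_ge0.
  - rewrite lee_fin ler_pM2l// -[leRHS](powRr1 (ltW eta0)) -(@mulVf _ theta) ?gt_eqF//.
    by rewrite powRrM; apply: ge0_ler_powR; rewrite ?nnegrE ?powR_ge0// ltW.
  - by apply: le_outer_measure; apply: ball_subset; rewrite mdistxx; lra.
rewrite -(fineK Nf) -/b -EFinM lee_fin /eta mulrAC mulrCA.
by rewrite ler_piMr ?(ltW d0)// ler_pdivrMr// mul1r lerDl.
Qed.

End codimension_geometry.

(** * Averages over balls and cutoff functions *)

Section averages.
Local Open Scope ereal_scope.
Context {R : realType} {X : completeMetricType R}.
Variables (mu : {outer_measure set X -> \bar R}).
Hypotheses (mmsX : metric_measure_space mu).

Lemma avg_ge0 (x : X) (r : R) (g : X -> \bar R) : (0 < r)%R ->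
  (forall y, ball x r y -> 0 <= g y) -> 0 <= avg mu (ball x r) g.
Proof.
move=> r0 g0; rewrite /avg; have [a a0 ->] := mu_ballE mmsX x r0.
rewrite inver gt_eqF//; apply: mule_ge0; last exact: integral_ge0.
by rewrite lee_fin invr_ge0 ltW.
Qed.

Lemma le_avg (x : X) (r : R) (f g : X -> \bar R) : (0 < r)%R ->
  (forall y, ball x r y -> 0 <= f y) -> (forall y, ball x r y -> f y <= g y) ->
  avg mu (ball x r) f <= avg mu (ball x r) g.
Proof.
move=> r0 f0 fg; rewrite /avg; have [a a0 ->] := mu_ballE mmsX x r0.
rewrite inver gt_eqF//; apply: lee_wpmul2l; first by rewrite lee_fin invr_ge0 ltW.
exact: le_nnintegral.
Qed.

(** The bound used for functions supported in a layer: [k] is the fraction of the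
    ball that the layer fills. *)
Lemma avg_indic_le (x : X) (r b k : R) (A : set X) (g : X -> \bar R) :
  (0 < r)%R -> (0 <= b)%R -> mu.-caratheodory A ->
  (forall y, ball x r y -> 0 <= g y) ->
  (forall y, ball x r y -> g y <= (b * \1_A y)%:E) ->
  mu (ball x r `&` A) <= k%:E * mu (ball x r) ->
  avg mu (ball x r) g <= (b * k)%:E.
Proof.
move=> r0 b0 mA g0 gb le_k; apply: le_trans (le_avg r0 g0 gb) _.
have mB : mu.-caratheodory (ball x r) by exact: superlevel_ball (mu_superlevel mmsX).
rewrite /avg; have [a a0 aE] := mu_ballE mmsX x r0.
rewrite (eq_integral (fun y : caratheodory_type mu => b%:E * (\1_A y)%:E)); last by move=> y _; rewrite EFinM.
rewrite ge0_integralZl_EFin//; last first.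
  apply/measurable_EFinP.
  exact: (@measurable_indic _ (caratheodory_type mu) R _ A mA).
rewrite (@integral_indic _ (caratheodory_type mu) R (cara_measure mu) _ mB A mA).
move: le_k; rewrite /cara_measure/= aE setIC => le_k.
rewrite inver gt_eqF// muleA -EFinM.
apply: le_trans (lee_wpmul2l _ le_k) _.
  by rewrite lee_fin mulr_ge0// invr_ge0 ltW.
by rewrite -!EFinM lee_fin le_eqVlt; apply/orP; left; apply/eqP; field; rewrite gt_eqF.
Qed.

Lemma avg_le (x : X) (r b : R) (g : X -> \bar R) : (0 < r)%R -> (0 <= b)%R ->
  (forall y, ball x r y -> 0 <= g y) -> (forall y, ball x r y -> g y <= b%:E) ->
  avg mu (ball x r) g <= b%:E.
Proof.
move=> r0 b0 g0 gb; rewrite -[b]mulr1; apply: (@avg_indic_le _ _ _ _ setT) => //.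
- by rewrite -setC0; apply: caratheodory_measurable_setC; exact: caratheodory_measurable_set0.
- by move=> y xy; rewrite indicT mulr1; exact: gb.
- by rewrite setIT mul1e.
Qed.

End averages.

Section bump.
Context {R : realType} {X : completeMetricType R}.
Variables (E : set X) (G : X -> R) (L M K e : R) (x0 : X).
Hypotheses (L0 : 0 <= L) (e0 : 0 < e)
  (GL : forall y z, `|G y - G z| <= L * mdist y z)
  (GM : forall y, `|G y| <= M)
  (Gsupp : forall y, G y != 0 -> mdist x0 y < K).

Definition cutoff (y : X) : R := Num.max 0 (1 - set_dist E y / e).

Definition bump (y : X) : R := G y * cutoff y.

Lemma cutoff_ge0 y : 0 <= cutoff y.
Proof. by rewrite le_max lexx. Qed.

Lemma cutoff_le1 y : cutoff y <= 1.
Proof. by rewrite ge_max ler01/= gerBl divr_ge0 ?set_dist_ge0// ltW. Qed.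

Lemma cutoff_neq0 y : cutoff y != 0 -> set_dist E y < e.
Proof.
apply: contra_neqT; rewrite -leNgt => ey; apply/max_idPl.
by rewrite subr_le0 ler_pdivlMr// mul1r.
Qed.

Lemma cutoff_lip y z : `|cutoff y - cutoff z| <= mdist y z / e.
Proof.
wlog yz : y z / cutoff z <= cutoff y.
  move=> wl; have [/wl//|/ltW/wl] := leP (cutoff z) (cutoff y).
  by rewrite distrC metric_sym.
rewrite ger0_norm ?subr_ge0// lerBlDr ge_max; apply/andP; split.
  by rewrite addr_ge0 ?divr_ge0 ?mdist_ge0 ?cutoff_ge0// ltW.
have : 1 - set_dist E z / e <= cutoff z by rewrite le_max lexx orbT.
have : (set_dist E z - set_dist E y) / e <= mdist y z / e.
  by rewrite ler_pM2r ?invr_gt0// metric_sym set_dist_lip.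
by rewrite mulrBl; lra.
Qed.

Lemma bump_on y : E y -> bump y = G y.
Proof. by move=> Ey; rewrite /bump /cutoff set_dist0// mul0r subr0 max_r// mulr1. Qed.

Lemma bump_le y : `|bump y| <= `|G y|.
Proof.
by rewrite normrM ler_piMr// ger0_norm ?cutoff_ge0// cutoff_le1.
Qed.

Lemma bump_neq0 y : bump y != 0 -> set_dist E y < e /\ mdist x0 y < K.
Proof.
by rewrite mulf_eq0 negb_or => /andP[Gy /cutoff_neq0]; split => //; exact: Gsupp.
Qed.

(** Product rule, with the first factor estimated at [x], so that the bound involves
    [G] at the centre of the ball only. *)
Lemma bump_osc x y : `|bump y - bump x| <= L * mdist x y + `|G x| * (mdist x y / e).
Proof.
have -> : bump y - bump x = (G y - G x) * cutoff y + G x * (cutoff y - cutoff x).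
  by rewrite /bump; ring.
apply: le_trans (ler_normD _ _) _; rewrite !normrM lerD//.
  rewrite -[leRHS]mulr1 ler_pM//; first by rewrite metric_sym.
  by rewrite ger0_norm ?cutoff_ge0// cutoff_le1.
by rewrite ler_wpM2l// metric_sym; exact: cutoff_lip.
Qed.

Lemma bump_lipschitz : lipschitz_fun bump.
Proof.
exists (L + M / e) => x y; rewrite distrC; apply: le_trans (bump_osc x y) _.
rewrite mulrDl lerD2l mulrAC mulrA ler_pM2r ?invr_gt0// ler_wpM2r ?mdist_ge0//.
Qed.

End bump.

(** * Geometric weights over dyadic scales *)

Section dyadic_sums.
Context {R : realType}.

Lemma exists_pow_half (e : R) : 0 < e -> exists n, (2^-1 : R) ^+ n <= e.
Proof.
move=> e0; exists (Num.bound e^-1).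
rewrite exprVn -[leRHS]invrK lef_pV2 ?posrE ?exprn_gt0 ?invr_gt0//.
apply: ltW; apply: lt_trans (archi_boundP _) _; first by rewrite invr_ge0 ltW.
by rewrite -natrX ltr_nat ltn_expl.
Qed.

(** One of the two truncated differences vanishes, so the general term is [q] to
    the power [|k - m|].  The bound is uniform in [m], that is, in the width of the
    layer. *)
Lemma two_sided_geometric (q : R) (m n : nat) : 0 < q < 1 ->
  \sum_(0 <= k < n) q ^+ (k - m) * q ^+ (m - k) <= 2 / (1 - q).
Proof.
move=> /andP[q0 q1].
have geo j : \sum_(0 <= k < j) q ^+ k <= (1 - q)^-1.
  rewrite -[leRHS]mul1r ler_pdivlMr ?subr_gt0// mulrC.
  elim: j => [|j ih]; first by rewrite big_geq// mulr0.
  suff -> : (1 - q) * \sum_(0 <= k < j.+1) q ^+ k = 1 - q ^+ j.+1.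
    by rewrite gerBl exprn_ge0// ltW.
  elim: j {ih} => [|j ih]; first by rewrite big_nat1 expr0 expr1 mulr1.
  by rewrite big_nat_recr//= mulrDr ih [in RHS]exprS; ring.
suff : \sum_(0 <= k < n) q ^+ (k - m) * q ^+ (m - k) <=
    \sum_(0 <= k < n) q ^+ k + \sum_(0 <= k < m.+1) q ^+ k.
  by move/le_trans; apply; rewrite mulrDl mul1r lerD.
elim: m n => [|m ih] n.
  under eq_bigr do rewrite subn0 sub0n expr0 mulr1.
  by rewrite lerDl big_nat1 expr0.
case: n => [|n].
  by rewrite [leLHS]big_geq// addr_ge0// sumr_ge0// => i _; rewrite exprn_ge0// ltW.
rewrite big_nat_recl//= sub0n expr0 mul1r subn0.
under eq_bigr do rewrite !subSS.
apply: (@le_trans _ _ (q ^+ m.+1 + (\sum_(0 <= k < n) q ^+ k + \sum_(0 <= k < m.+1) q ^+ k))).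
  by rewrite lerD2l.
rewrite [X in _ <= _ + X]big_nat_recr//= addrCA lerD//; last by rewrite addrC.
by rewrite big_nat_recr//= lerDl exprn_ge0// ltW.
Qed.

Lemma half_pow_sum (n : nat) : \sum_(0 <= k < n) (2^-1 : R) ^+ k.+1 <= 1.
Proof.
suff -> : \sum_(0 <= k < n) (2^-1 : R) ^+ k.+1 = 1 - 2^-1 ^+ n.
  by rewrite gerBl exprn_ge0// invr_ge0.
elim: n => [|n ih]; first by rewrite big_geq// expr0 subrr.
rewrite big_nat_recr//= ih exprS; lra.
Qed.

Lemma powR_exprn (x r : R) (k : nat) : 0 <= x -> (x ^+ k) `^ r = (x `^ r) ^+ k.
Proof.
move=> x0; elim: k => [|k ih]; first by rewrite !expr0 powR1.
by rewrite !exprS powRM ?exprn_ge0// ih.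
Qed.

(** For [t = 2 ^- n <= e = 2 ^- m] one has
    [t / e * e ^ s = t ^ s * (t / e) ^ (1 - s)]; the surplus factor is a power of
    [q] with the number of dyadic steps from [e] to [t] as exponent. *)
Lemma small_scale_weight (s q : R) (m n : nat) : 0 <= s <= 1 -> (m <= n)%N ->
  2^-1 `^ (1 - s) <= q ->
  2^-1 ^+ n / 2^-1 ^+ m * (2 * 2^-1 ^+ m) `^ s <=
  2 `^ s * (2^-1 ^+ n) `^ s * q ^+ (n - m).
Proof.
move=> /andP[s0 s1] mn hq; have h0 : 0 < (2^-1 : R) by rewrite invr_gt0.
have am0 : 0 < (2^-1 : R) ^+ m by rewrite exprn_gt0.
have ak0 : 0 < (2^-1 : R) ^+ (n - m) by rewrite exprn_gt0.
have nE : (2^-1 : R) ^+ n = 2^-1 ^+ (n - m) * 2^-1 ^+ m by rewrite -exprD subnK.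
rewrite nE mulfK ?gt_eqF// !powRM ?(ltW am0) ?(ltW ak0)//.
have akE : 2^-1 ^+ (n - m) = (2^-1 ^+ (n - m)) `^ s * (2^-1 ^+ (n - m)) `^ (1 - s) :> R.
  rewrite -powRD; first by rewrite addrC subrK powRr1 // ltW.
  by apply/implyP => _; rewrite gt_eqF.
rewrite [X in X * _ <= _]akE.
rewrite [leLHS](_ : _ = 2 `^ s * ((2^-1 ^+ (n - m)) `^ s * (2^-1 ^+ m) `^ s) *
  (2^-1 ^+ (n - m)) `^ (1 - s)); last by ring.
apply: ler_wpM2l; first by rewrite !mulr_ge0 ?powR_ge0.
rewrite powR_exprn ?(ltW h0)//; apply: lerXn2r => //.
  by rewrite nnegrE powR_ge0.
by rewrite nnegrE (le_trans _ hq)// powR_ge0.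
Qed.

(** The counterpart for a layer of width [2 ^- m] seen from a larger scale [t]: the
    fraction of the ball filled by the layer decays geometrically. *)
Lemma mid_scale_weight (s r q t : R) (m n : nat) : 0 <= s -> 0 <= r -> (n < m)%N ->
  2^-1 `^ r <= q -> 2^-1 ^+ n.+1 <= t < 2^-1 ^+ n ->
  (2^-1 ^+ m / t) `^ r * (2 * t) `^ s <=
  2 `^ r * 2 `^ s * (2^-1 ^+ n) `^ s * q ^+ (m - n).
Proof.
move=> s0 r0 nm hq /andP[tn tn1]; have h0 : 0 < (2^-1 : R) by rewrite invr_gt0.
have t0 : 0 < t by apply: lt_le_trans tn; rewrite exprn_gt0.
have an0 : 0 < (2^-1 : R) ^+ n by rewrite exprn_gt0.
have -> : 2 `^ r * 2 `^ s * (2^-1 ^+ n) `^ s * q ^+ (m - n) =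
  (2 `^ r * q ^+ (m - n)) * (2 * 2^-1 ^+ n) `^ s.
  by rewrite powRM ?(ltW an0)//; ring.
apply: ler_pM; rewrite ?powR_ge0//; last first.
  by apply: ge0_ler_powR => //; rewrite ?nnegrE ?mulr_ge0 ?ler_pM2l ?(ltW t0) ?(ltW an0) ?(ltW tn1).
apply: (@le_trans _ _ ((2 * 2^-1 ^+ (m - n)) `^ r)).
  apply: ge0_ler_powR => //.
  - by rewrite nnegrE divr_ge0 ?exprn_ge0 ?ltW.
  - by rewrite nnegrE mulr_ge0 ?exprn_ge0 ?ltW.
  have mE : (2^-1 : R) ^+ m = 2^-1 ^+ (m - n) * 2^-1 ^+ n by rewrite -exprD subnK// ltnW.
  rewrite ler_pdivrMr// mE mulrAC.
  rewrite [leRHS]mulrC ler_wpM2l ?exprn_ge0 ?(ltW h0)//.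
  by move: tn; rewrite exprS; lra.
rewrite powRM ?exprn_ge0 ?(ltW h0)// ler_wpM2l ?powR_ge0//.
rewrite powR_exprn ?(ltW h0)//; apply: lerXn2r => //.
  by rewrite nnegrE powR_ge0.
by rewrite nnegrE (le_trans _ hq)// powR_ge0.
Qed.

End dyadic_sums.

(** * Extension of a Lipschitz function into a thin layer *)

Section layer_extension.
Local Open Scope ereal_scope.
Context {R : realType} {X : completeMetricType R}.
Variables (mu : {outer_measure set X -> \bar R}) (theta p : R) (E : set X).
Hypotheses (mmsX : metric_measure_space mu)
  (dblX : uniformly_locally_doubling mu) (theta0 : (0 < theta)%R)
  (ADE : ahlfors_david_regular mu theta E) (En0 : E !=set0)
  (p1 : (1 <= p)%R) (thetap : (theta < p)%R).

Local Notation nu := (outer_restr (codim_hausdorff mu theta) E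
  : {outer_measure set X -> \bar R}).
Local Notation s := (theta / p)%R.

(** Control of mean oscillation at the scales [t] of order [2 ^- n] by a function
    [h] of norm at most [b n].  Mean values are replaced by arbitrary constants [c x],
    which are easier to choose and can be added up.  They vanish at scales above [d]:
    in a series of such functions with [d] tending to 0, only finitely many constants
    are nonzero at each scale. *)
Definition oscillation_bounds (d : R) (b : nat -> R) (f : X -> R) : Prop :=
  forall n t, (2^-1 ^+ n.+1 <= t < 2^-1 ^+ n)%R ->
  exists c h : X -> R, [/\
    measurable_fun [set: caratheodory_type mu] (h : caratheodory_type mu -> R),
    (forall x, (0 <= h x)%R),
    (forall x, avg mu (ball x t) (fun y => `|f y - c x|%:E) <= (h x)%:E),
    ('N[cara_measure mu]_p%:E[EFin \o h] <= (b n)%:E) &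
    ((d <= t)%R -> forall x, c x = 0%R)].

(** What a single layer provides, with [N] a bound for the norm of [G] in
    [L_p(nu)] and [d] an error at our disposal.  The bound on averages is uniform in
    the radius, which is what passes to a series; the last field is the dyadic form
    of a bound on the Besov seminorm. *)
Record layer_extension (C N d : R) (G f : X -> R) : Prop := {
  layer_lipschitz : lipschitz_fun f ;
  layer_trace : forall x, E x -> f x = G x ;
  layer_averages : forall x r, E x -> (0 < r < 1)%R ->
    avg mu (ball x r) (fun y => `|f y|%:E) <= (`|G x| + d)%:E ;
  layer_Lp : 'N[cara_measure mu]_p%:E[EFin \o f] <= (C * (N + d))%:E ;
  layer_besov : exists2 b : nat -> R,
    (forall n, \sum_(0 <= k < n) ((2^-1 ^+ k) `^ (- s) * b k) <= C * (N + d))%R &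
    oscillation_bounds d b f
}.

(** The scales that govern a bump of width [e].  Below [rho] the function [G] varies
    by at most [d1] on the balls that occur; above [rho] the layer is too thin to
    matter. *)
Record bump_scales (G : X -> R) (x0 : X) (L K e rho d1 : R) : Prop := {
  scale_L0 : (0 <= L)%R ;
  scale_e0 : (0 < e)%R ;
  scale_erho : (e <= rho)%R ;
  scale_rho16 : (rho <= 16^-1)%R ;
  scale_Lrho : (L * (10 * rho) <= d1)%R ;
  scale_lip : forall y z, (`|G y - G z| <= L * mdist y z)%R ;
  scale_supp : forall y, G y != 0%R -> (mdist x0 y < K)%R
}.

(** A majorant of the bump and of its averages that depends on the centre [x] only:
    the constant [c] absorbs the variation of [G] over a ball. *)
Definition envelope (G : X -> R) (x0 : X) (c r : R) (A : set X) (x : X) : R :=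
  ((`|G x| + c) * \1_(ball x0 r `&` A) x)%R.

Definition thickening (t : R) : set X := [set y | (set_dist E y < t)%R].

Section scales.
Implicit Types (G : X -> R) (x y z : X) (L K e rho t c r d : R) (A : set X).

Lemma scale_d10 G o L K e rho d : bump_scales G o L K e rho d -> (0 <= d)%R.
Proof.
case=> L0 e0 erho _ Lrho _ _.
by apply: le_trans Lrho; apply: mulr_ge0 => //; lra.
Qed.

Lemma envelope_ge0 G o c r A x : (0 <= c)%R -> (0 <= envelope G o c r A x)%R.
Proof. by move=> c0; rewrite /envelope mulr_ge0// addr_ge0. Qed.

Lemma measurable_envelope (m : {outer_measure set X -> \bar R}) G o c r A :
  lipschitz_fun G -> superlevel_measurable m -> m.-caratheodory A ->
  measurable_fun [set: caratheodory_type m] (envelope G o c r A : caratheodory_type m -> R).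
Proof.
move=> GL mm mA; apply: measurable_funM.
  apply: measurable_funD => //; apply: measurableT_comp => //.
  exact: measurable_lipschitz.
apply: (@measurable_indic _ (caratheodory_type m) R).
by apply: caratheodory_measurable_setI => //; exact: superlevel_ball.
Qed.

(** The hypothesis under which the norm of an envelope over a layer is controlled by
    the norm of an envelope over [E]: within [5 * t <= 10 * rho] the function [G]
    varies by at most [d], hence the constant [2 * d] on the right. *)
Lemma envelope_transfer G o L K e rho d t y z : bump_scales G o L K e rho d ->
  (t <= 2 * rho)%R -> (mdist y z < 5 * t)%R ->
  (envelope G o d (K + 1) (thickening t) y <= envelope G o (2 * d) (K + 2) setT z)%R.
Proof.
move=> sc; have d0 := scale_d10 sc; have [L0 e0 erho rho16 Lrho GL Gsupp] := sc.
move=> tr yz; rewrite /envelope !indicE.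
have [|_] := boolP (y \in _); last first.
  by rewrite mulr0 mulr_ge0 ?ler0n// addr_ge0// mulr_ge0.
rewrite inE => -[+ _]; rewrite ballEmdist/= => xy.
have mz : z \in ball o (K + 2) `&` setT.
  rewrite inE; split => //; rewrite ballEmdist/=.
  by have := metric_triangle o y z; lra.
rewrite mz !mulr1.
have Gyz : (`|G y| <= `|G z| + `|G y - G z|)%R.
  by rewrite -[in leLHS](subrK (G z) (G y)) addrC ler_normD.
have : (L * mdist y z <= L * (10 * rho))%R by rewrite ler_wpM2l//; lra.
by have := GL y z; lra.
Qed.

Lemma envelope_bump G o L K e rho d y t x : bump_scales G o L K e rho d ->
  (0 < t <= rho)%R -> (mdist x y < t)%R -> bump E G e y != 0%R ->
  (ball o (K + 1) `&` thickening (e + t)) x.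
Proof.
move=> sc; have d0 := scale_d10 sc; have [L0 e0 erho rho16 Lrho GL Gsupp] := sc.
move=> /andP[t0 tr] xy /(bump_neq0 e0 Gsupp)[yE yK]; split.
  rewrite ballEmdist/=; have := metric_triangle o y x.
  by rewrite (metric_sym y x); lra.
by rewrite /thickening/=; have := set_dist_lip E x y; lra.
Qed.

(** The cutoff has Lipschitz constant [1 / e], and that of [G] is at most [d / e]
    by the choice of [rho]. *)
Lemma bump_small_scale G o L K e rho d t x y : bump_scales G o L K e rho d ->
  (0 < t <= e)%R -> (mdist x y < t)%R ->
  (`|bump E G e y - bump E G e x| <= t / e * envelope G o d (K + 1) (thickening (2 * e)) x)%R.
Proof.
move=> sc; have d0 := scale_d10 sc; have [L0 e0 erho rho16 Lrho GL Gsupp] := sc.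
move=> /andP[t0 te] xy.
have [[fy fx]|neq0] := pselect (bump E G e y = 0%R /\ bump E G e x = 0%R).
  by rewrite fy fx subrr normr0 mulr_ge0 ?envelope_ge0// divr_ge0// ltW.
have xin : (ball o (K + 1) `&` thickening (2 * e)) x.
  have [fy|fy] := eqVneq (bump E G e y) 0%R; last first.
    have [] := @envelope_bump _ _ _ _ _ _ _ y t x sc _ xy fy; first by rewrite t0 (le_trans te).
    by move=> xK xE; split => //; move: xE; rewrite /thickening/=; lra.
  have fx : bump E G e x != 0%R by apply/eqP => fx; apply: neq0.
  have [||xK xE] := @envelope_bump _ _ _ _ _ _ _ x e x sc _ _ fx; first by rewrite e0.
    by rewrite mdistxx.
  by split => //; move: xE; rewrite /thickening/=; lra.
rewrite /envelope indicE mem_set// mulr1.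
apply: le_trans (bump_osc E e0 GL x y) _.
have xyt : (mdist x y / e <= t / e)%R by rewrite ler_pM2r ?invr_gt0// ltW.
have Le : (L * e <= d)%R.
  by apply: le_trans Lrho; rewrite ler_wpM2l//; lra.
rewrite mulrDr addrC lerD//.
  by rewrite mulrC ler_wpM2r.
apply: (@le_trans _ _ (L * t)%R); first by rewrite ler_wpM2l// ltW.
have -> : (L * t = t / e * (L * e))%R by field; rewrite gt_eqF.
by rewrite ler_wpM2l// divr_ge0// ltW.
Qed.

(** At scales above [e] the bump is not compared with a constant: only its size and
    the smallness of its support count. *)
Lemma bump_mid_scale G o L K e rho d t x y : bump_scales G o L K e rho d ->
  (e <= t < rho)%R -> (mdist x y < t)%R ->
  (`|bump E G e y| <= envelope G o d (K + 1) (thickening (2 * t)) x * \1_(thickening e) y)%R.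
Proof.
move=> sc; have d0 := scale_d10 sc; have [L0 e0 erho rho16 Lrho GL Gsupp] := sc.
move=> /andP[et tr] xy.
have [fy|fy] := eqVneq (bump E G e y) 0%R.
  by rewrite fy normr0 mulr_ge0// envelope_ge0.
have [|xK xE] := @envelope_bump _ _ _ _ _ _ _ y t x sc _ xy fy; first by apply/andP; split; lra.
have [yE _] := bump_neq0 e0 Gsupp fy.
rewrite /envelope !indicE !mem_set//; last first.
  by split => //; move: xE; rewrite /thickening/=; lra.
rewrite !mulr1; apply: le_trans (bump_le E G e0 y) _.
have Gyx : (`|G y| <= `|G x| + `|G y - G x|)%R.
  by rewrite -[in leLHS](subrK (G x) (G y)) addrC ler_normD.
apply: (le_trans Gyx); rewrite lerD2l; apply: le_trans (GL y x) _.
apply: le_trans Lrho; rewrite ler_wpM2l// metric_sym; lra.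
Qed.

Lemma bump_le_envelope G o L K e rho d y : bump_scales G o L K e rho d ->
  (`|bump E G e y| <= envelope G o d (K + 1) (thickening (2 * e)) y)%R.
Proof.
move=> sc; have d0 := scale_d10 sc; have [L0 e0 erho rho16 Lrho GL Gsupp] := sc.
have [fy|fy] := eqVneq (bump E G e y) 0%R; first by rewrite fy normr0 envelope_ge0.
have [||yK yE] := @envelope_bump _ _ _ _ _ _ _ y e y sc _ _ fy; first by rewrite e0.
  by rewrite mdistxx.
rewrite /envelope indicE mem_set ?mulr1.
  by apply: le_trans (bump_le E G e0 y) _; rewrite lerDl.
by split => //; move: yE; rewrite /thickening/=; lra.
Qed.

End scales.

Let p0 : (0 < p)%R. Proof. exact: lt_le_trans p1. Qed.

Lemma Lnorm_indic_lty (m : {outer_measure set X -> \bar R}) (A : set X) :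
  m.-caratheodory A -> m A < +oo ->
  'N[cara_measure m]_p%:E[EFin \o \1_A] < +oo.
Proof. by move=> mA Aoo; rewrite (Lnorm_indic p0 mA); exact: poweR_lty. Qed.

Lemma Lnorm_envelope_nu (G : X -> R) (o : X) (c r : R) : lipschitz_fun G -> (0 <= c)%R ->
  'N[cara_measure nu]_p%:E[EFin \o envelope G o c r setT] <=
  'N[cara_measure nu]_p%:E[EFin \o G] +
    c%:E * 'N[cara_measure nu]_p%:E[EFin \o \1_(ball o r)].
Proof.
move=> GL c0; pose g (x : caratheodory_type nu) := (c * \1_(ball o r) x)%R.
have mball : nu.-caratheodory (ball o r) by exact: superlevel_ball (nu_superlevel _ _ _).
have mI : measurable_fun [set: caratheodory_type nu] (\1_(ball o r) : caratheodory_type nu -> R).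
  exact: (@measurable_indic _ (caratheodory_type nu) R).
have mG := measurable_lipschitz (nu_superlevel mu theta E) GL.
have mnG : measurable_fun [set: caratheodory_type nu] (Num.norm \o G : caratheodory_type nu -> R).
  exact: measurableT_comp.
rewrite -Lnorm_scale//.
have -> : 'N[cara_measure nu]_p%:E[EFin \o G] =
    'N[cara_measure nu]_p%:E[EFin \o (Num.norm \o G)].
  by apply/eqP; rewrite eq_le; apply/andP; split; apply: le_Lnorm => // x /=;
    rewrite normr_id.
apply: le_trans (minkowski_EFin _ mnG _ p1); last by apply: measurable_funM.
apply: le_Lnorm => // x; rewrite [leLHS]/= [leRHS]/= lee_fin.
rewrite [leLHS]ger0_norm ?envelope_ge0//; apply: le_trans _ (ler_norm _).
by rewrite /g /envelope setIT mulrDl lerD2r ler_piMr// indicE.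
Qed.

(** The norm over the layer of width [t] gains the factor [t ^ s] over the norm
    on [E]. *)
Lemma Lnorm_envelope : exists2 C : R, (0 < C)%R &
  forall (G : X -> R) (o : X) (L K e rho d t : R), bump_scales G o L K e rho d ->
  (0 < t <= 2 * rho)%R ->
  'N[cara_measure mu]_p%:E[EFin \o envelope G o d (K + 1) (thickening t)] <=
  (C * t `^ s)%:E *
    'N[cara_measure nu]_p%:E[EFin \o envelope G o (2 * d) (K + 2) setT].
Proof.
have [C C0 HC] := mu_nu_Lnorm mmsX dblX ADE En0 p0.
exists C => // G o L K e rho d t sc /andP[t0 tr].
have d0 := scale_d10 sc; have [_ _ _ rho16 _ _ _] := sc.
apply: HC => [|y|y|y|y z yz].
- by apply/andP; split => //; lra.
- by rewrite lee_fin envelope_ge0.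
- by rewrite lee_fin envelope_ge0// mulr_ge0.
- rewrite /= lte_fin /envelope indicE; case: (boolP (y \in _)); last by rewrite mulr0 ltxx.
  by rewrite inE => -[].
- by rewrite lee_fin; exact: envelope_transfer sc _ yz.
Qed.

Lemma avg_small_scale G o L K e rho d t x : bump_scales G o L K e rho d ->
  (0 < t <= e)%R ->
  avg mu (ball x t) (fun y => `|bump E G e y - bump E G e x|%:E) <=
  (t / e * envelope G o d (K + 1) (thickening (2 * e)) x)%:E.
Proof.
move=> sc te; have /andP[t0 _] := te; have d0 := scale_d10 sc.
have [_ e0 _ _ _ _ _] := sc.
apply: avg_le => //.
- by rewrite mulr_ge0 ?envelope_ge0// divr_ge0// ltW.
- move=> y; rewrite ballEmdist/= => xy; rewrite lee_fin.
  exact: bump_small_scale sc te xy.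
Qed.

(** Centres farther than [2 * t] from [E] do not see the layer; for the others the
    layer fills a fraction [(e / t) ^ theta] of the ball. *)
Lemma avg_mid_scale : exists2 C : R, (0 < C)%R &
  forall G o L K e rho d t x, bump_scales G o L K e rho d -> (e <= t < rho)%R ->
  avg mu (ball x t) (fun y => `|bump E G e y|%:E) <=
  (C * (e / t) `^ theta * envelope G o d (K + 1) (thickening (2 * t)) x)%:E.
Proof.
have [C C0 HC] := mu_layer_density mmsX dblX theta0 ADE En0.
exists C => // G o L K e rho d t x sc etr; have /andP[et tr] := etr.
have d0 := scale_d10 sc.
have [_ e0 _ rho16 _ _ _] := sc.
have t0 : (0 < t)%R by lra.
have env0 := envelope_ge0 G o (K + 1) (thickening (2 * t)) x d0.
have [xt|xt] := ltP (set_dist E x) (2 * t)%R.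
  rewrite mulrC; apply: (@avg_indic_le _ _ _ mmsX _ _ _ _ (thickening e)) => //.
  - exact: superlevel_thickening (mu_superlevel mmsX).
  - by move=> y; rewrite ballEmdist/= lee_fin; exact: bump_mid_scale sc etr.
  - by apply: HC => //; [rewrite e0|lra].
have envx : envelope G o d (K + 1) (thickening (2 * t)) x = 0%R.
  by rewrite /envelope indicE memNset ?mulr0// => -[_]; rewrite /thickening/= ltNge xt.
rewrite envx mulr0; apply: avg_le => // y; rewrite ballEmdist/= => xy.
have := bump_mid_scale sc etr xy.
by rewrite envx mul0r lee_fin.
Qed.

(** Balls of radius at least [rho] around the points that matter have measure at
    least [c], whereas the support of the bump has measure at most [v]. *)
Lemma avg_large_scale G o (L K e rho d M v c t : R) x : bump_scales G o L K e rho d ->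
  (0 <= M)%R -> (forall y, `|G y| <= M)%R -> (0 < c)%R -> (0 <= v)%R ->
  mu (ball o K `&` thickening e) <= v%:E ->
  (forall x, ball o (K + 1) x -> c%:E <= mu (ball x rho)) ->
  (rho <= t < 1)%R ->
  avg mu (ball x t) (fun y => `|bump E G e y|%:E) <=
  (M * (v / c) * \1_(ball o (K + 1)) x)%:E.
Proof.
move=> sc M0 GM c0 v0 muv muc /andP[rt t1].
have [_ e0 er _ _ _ Gsupp] := sc; have t0 : (0 < t)%R by lra.
have [xK|xK] := pselect (ball o (K + 1) x).
  rewrite indicE mem_set// mulr1.
  apply: (@avg_indic_le _ _ _ mmsX _ _ _ _ (ball o K `&` thickening e)) => //.
  - apply: caratheodory_measurable_setI; first exact: superlevel_ball (mu_superlevel mmsX).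
    exact: superlevel_thickening (mu_superlevel mmsX).
  - move=> y xy; rewrite lee_fin.
    have [->|fy] := eqVneq (bump E G e y) 0%R; first by rewrite normr0 mulr_ge0.
    have [yE yK] := bump_neq0 e0 Gsupp fy.
    rewrite indicE mem_set ?mulr1; first exact: le_trans (bump_le E G e0 y) (GM y).
    by split => //; rewrite ballEmdist.
  - apply: (@le_trans _ _ v%:E).
      by apply: le_trans muv; apply: le_outer_measure => y [].
    apply: (@le_trans _ _ ((v / c)%:E * c%:E)); first by rewrite -EFinM divfK// gt_eqF.
    apply: lee_wpmul2l; first by rewrite lee_fin divr_ge0// ltW.
    apply: le_trans (muc x xK) _; apply: le_outer_measure.
    by apply: ball_subset; rewrite mdistxx add0r.
rewrite indicE memNset// mulr0; apply: avg_le => // y; rewrite ballEmdist/= => xy.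
have [->|fy] := eqVneq (bump E G e y) 0%R; first by rewrite normr0.
have [_ yK] := bump_neq0 e0 Gsupp fy.
exfalso; apply: xK; rewrite ballEmdist/=.
by have := metric_triangle o y x; rewrite (metric_sym y x); lra.
Qed.

Lemma half_powR_lt1 (r : R) : (0 < r -> 0 < 2^-1 `^ r < 1)%R.
Proof.
move=> r0; rewrite powR_gt0 ?invr_gt0//=.
apply: (@lt_le_trans _ _ (1 `^ r)%R); last by rewrite powR1.
apply: gt0_ltr_powR => //.
- by rewrite nnegrE invr_ge0.
- by rewrite nnegrE.
- by rewrite invf_lt1// ltr1n.
Qed.

(** The parameters are chosen one after the other.  First [d1], the tolerated
    variation of [G], so small that adding it to [G] on the support costs at most [d]
    in [L_p(nu)]; then [rho], by the Lipschitz constant of [G]; then [d2], an upper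
    bound for all averages at scales above [rho], so small that the finitely many
    dyadic scales above [rho] contribute at most [d]; and last the width [e], which
    has to make the layer small enough for [d2], and is at most [d] because only
    the scales below [e] use nonzero constants.  The scales below [rho] contribute
    [C3 * S * (N + d)], with [S] the sum of the two geometric series, whatever [e]
    is. *)
Lemma exists_layer_extension : exists2 C : R, (0 < C)%R &
  forall (G : X -> R) (N d : R), lipschitz_fun G ->
    (exists M : R, forall x, `|G x| <= M)%R ->
    (exists o (K : R), forall y, G y != 0 -> mdist o y < K)%R ->
    'N[cara_measure nu]_p%:E[EFin \o G] <= N%:E -> (0 < d)%R ->
    exists f, layer_extension C N d G f.
Proof.
have [Ce Ce0 HCe] := Lnorm_envelope.
have [Cm Cm0 HCm] := avg_mid_scale.
have s0 : (0 < s)%R by rewrite divr_gt0.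
have s1 : (s < 1)%R by rewrite ltr_pdivrMr// mul1r.
have s01 : (0 <= s <= 1)%R by rewrite !ltW.
pose q : R := Num.max (2^-1 `^ (1 - s))%R (2^-1 `^ theta)%R.
have q01 : (0 < q < 1)%R.
  have /andP[a0 a1] : (0 < 2^-1 `^ (1 - s) < 1)%R by apply: half_powR_lt1; rewrite subr_gt0.
  have /andP[b0 b1] := half_powR_lt1 theta0.
  by rewrite lt_max a0/= gt_max a1.
have qs : (2^-1 `^ (1 - s) <= q)%R by rewrite le_max lexx.
have qt : (2^-1 `^ theta <= q)%R by rewrite le_max lexx orbT.
pose C3 : R := (Ce * 2 `^ s * (1 + Cm * 2 `^ theta))%R.
have C30 : (0 <= C3)%R by rewrite !mulr_ge0 ?addr_ge0 ?mulr_ge0 ?powR_ge0// ltW.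
pose S : R := (2 / (1 - q))%R.
have S0 : (0 <= S)%R by rewrite divr_ge0// subr_ge0 ltW//; case/andP: q01.
pose C : R := (C3 * S + 1 + Ce)%R.
have C0 : (0 < C)%R by rewrite ltr_wpDl// addr_ge0// mulr_ge0.
exists C => // G N d GL [M GM] [ o [K Gs]] GN d0.
have N0 : (0 <= N)%R by rewrite -lee_fin; apply: le_trans GN; exact: Lnorm_ge0.
have M0 : (0 <= M)%R by apply: le_trans (GM o).
have [L' GL'] := GL; pose L := `|L'|%R.
have GLL y z : (`|G y - G z| <= L * mdist y z)%R.
  by apply: le_trans (GL' y z) _; rewrite ler_wpM2r ?mdist_ge0// ler_norm.
have mballs r : mu.-caratheodory (ball o r) := superlevel_ball o r (mu_superlevel mmsX).
have nballs r : nu.-caratheodory (ball o r) := superlevel_ball o r (nu_superlevel mu theta E).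
have [b b0 bE] : exists2 b : R, (0 <= b)%R &
    'N[cara_measure nu]_p%:E[EFin \o \1_(ball o (K + 2)%R)] = b%:E.
  have Noo := Lnorm_indic_lty (nballs (K + 2)%R) (nu_ball_fin mmsX dblX theta0 ADE En0 o (K + 2)%R).
  exists (fine 'N[cara_measure nu]_p%:E[EFin \o \1_(ball o (K + 2)%R)]).
    by rewrite fine_ge0// Lnorm_ge0.
  by rewrite fineK// ge0_fin_numE// Lnorm_ge0.
have [b2 b20 b2E] : exists2 b : R, (0 <= b)%R &
    'N[cara_measure mu]_p%:E[EFin \o \1_(ball o (K + 1)%R)] = b%:E.
  have muoo : mu (ball o (K + 1)%R) < +oo.
    have [K1|K1] := ltP 0%R (K + 1)%R; first by have [a _ ->] := mu_ballE mmsX o K1; rewrite ltry.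
    rewrite (_ : ball o _ = set0) ?outer_measure0//; apply/seteqP; split => // y.
    by rewrite ballEmdist/= => yo; have := mdist_ge0 o y; lra.
  have Noo := Lnorm_indic_lty (mballs (K + 1)%R) muoo.
  exists (fine 'N[cara_measure mu]_p%:E[EFin \o \1_(ball o (K + 1)%R)]).
    by rewrite fine_ge0// Lnorm_ge0.
  by rewrite fineK// ge0_fin_numE// Lnorm_ge0.
pose d1 : R := (d / (2 * b + 1))%R.
have b1 : (0 < 2 * b + 1)%R by rewrite ltr_wpDl// mulr_ge0.
have d10 : (0 < d1)%R by rewrite divr_gt0.
have d1d : (d1 <= d)%R by rewrite ler_pdivrMr// ler_peMr ?(ltW d0)// lerDr mulr_ge0.
(* [2 * d1] is the constant in the envelope over [E], and [b] the norm of the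
   indicator of the enlarged support *)
have d1b : (2 * d1 * b <= d)%R.
  have -> : (2 * d1 * b = d * (2 * b / (2 * b + 1)))%R by rewrite /d1; field; rewrite gt_eqF.
  by rewrite ler_piMr ?(ltW d0)// ler_pdivrMr// mul1r lerDl.
have L0 : (0 <= L)%R by rewrite /L.
have L1 : (0 < 10 * L + 1)%R by rewrite ltr_wpDl// mulr_ge0.
have [|n0] := @exists_pow_half R (Num.min 16^-1 (d1 / (10 * L + 1)))%R.
  by rewrite lt_min invr_gt0/= divr_gt0// ltr0n.
set rho := (2^-1 ^+ n0)%R; rewrite le_min => /andP[rho16 rhoL].
have rho0 : (0 < rho)%R by rewrite exprn_gt0// invr_gt0.
have Lrho : (L * (10 * rho) <= d1)%R.
  move: rhoL; rewrite ler_pdivlMr// => rhoL; apply: le_trans rhoL.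
  have -> : (rho * (10 * L + 1) = L * (10 * rho) + rho)%R by ring.
  by rewrite lerDl ltW.
have [c c0 muc] := mu_ball_ge mmsX dblX o (K + 1)%R rho0.
pose d2 : R := Num.min d (d * rho `^ s * rho / (b2 + 1))%R.
have b21 : (0 < b2 + 1)%R by rewrite ltr_wpDl.
have rhos0 : (0 < rho `^ s)%R by rewrite powR_gt0.
have d20 : (0 < d2)%R by rewrite lt_min d0 divr_gt0// !mulr_gt0.
(* at the scale [t >= rho] the weight [t ^ (- s)] is at most [rho ^ (- s)], and the
   factor [rho] makes room for a summable factor [t] *)
have d2b : (d2 * b2 <= d * rho `^ s * rho)%R.
  apply: (@le_trans _ _ (d * rho `^ s * rho / (b2 + 1) * (b2 + 1))%R); last first.
    by rewrite divfK// gt_eqF.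
  by apply: ler_pM => //; [exact: ltW|rewrite ge_min lexx orbT|rewrite lerDl].
have M1 : (0 < M + 1)%R by rewrite ltr_wpDl.
pose v : R := (c * (d2 / (M + 1)))%R.
have v0 : (0 < v)%R by rewrite mulr_gt0// divr_gt0.
have Mv : (M * (v / c) <= d2)%R.
  have -> : (M * (v / c) = d2 * (M / (M + 1)))%R by rewrite /v; field; rewrite !gt_eqF.
  by rewrite ler_piMr ?(ltW d20)// ler_pdivrMr// mul1r lerDl.
have [ev ev0 muv] := mu_layer_vanish mmsX dblX theta0 ADE En0 o K v0.
have [|m] := @exists_pow_half R (Num.min rho (Num.min ev d))%R.
  by rewrite !lt_min rho0 ev0 d0.
(* taking the width to be a power of 1/2 turns quotients of scales into powers of [q] *)
set e := (2^-1 ^+ m)%R; rewrite !le_min => /and3P[erho eev ed].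
have e0 : (0 < e)%R by rewrite exprn_gt0// invr_gt0.
have sc : bump_scales G o L K e rho d1 by split.
have {}muv : mu (ball o K `&` thickening e) <= v%:E by apply: muv; rewrite e0.
have large t x := @avg_large_scale _ _ _ _ _ _ _ M v c t x sc M0 GM c0 (ltW v0) muv muc.
have envA : 'N[cara_measure nu]_p%:E[EFin \o envelope G o (2 * d1) (K + 2) setT] <=
    (N + d)%:E.
  apply: le_trans (Lnorm_envelope_nu _ _ GL _) _; first by rewrite mulr_ge0// ltW.
  by rewrite EFinD leeD// bE -EFinM lee_fin.
have env t : (0 < t <= 2 * rho)%R ->
    'N[cara_measure mu]_p%:E[EFin \o envelope G o d1 (K + 1) (thickening t)] <=
    (Ce * t `^ s * (N + d))%:E.
  move=> t0; apply: le_trans (HCe _ _ _ _ _ _ _ _ sc t0) _.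
  rewrite [leRHS]EFinM lee_wpmul2l// lee_fin mulr_ge0 ?powR_ge0// ltW//.
have Nd0 : (0 <= N + d)%R by rewrite addr_ge0// ltW.
have flip := bump_lipschitz E e0 GLL GM.
exists (bump E G e); split.
- exact: flip.
- by move=> x; exact: bump_on.
- move=> x r Ex /andP[r0 r1]; have [rr|rr] := ltP r rho.
    apply: avg_le => // [|y]; first by rewrite addr_ge0// ltW.
    rewrite ballEmdist/= lee_fin => xy; apply: le_trans (bump_le E G e0 y) _.
    have Gyx : (`|G y| <= `|G x| + `|G y - G x|)%R.
      by rewrite -[in leLHS](subrK (G x) (G y)) addrC ler_normD.
    apply: (le_trans Gyx); rewrite lerD2l; apply: le_trans (GLL y x) _.
    apply: le_trans d1d; apply: le_trans Lrho; rewrite ler_wpM2l// metric_sym.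
    by apply/ltW/(lt_le_trans xy)/(le_trans (ltW rr)); rewrite ler_peMl ?(ltW rho0)// ler1n.
  apply: le_trans (large r x _) _; first by rewrite rr.
  rewrite lee_fin -[leLHS]add0r lerD//.
  apply: (@le_trans _ _ (M * (v / c))%R).
    apply: ler_piMr; first by rewrite mulr_ge0// divr_ge0// ltW.
    by rewrite indicE; case: (_ \in _).
  by apply: (le_trans Mv); rewrite ge_min lexx.
- apply: (@le_trans _ _ 'N[cara_measure mu]_p%:E[EFin \o envelope G o d1 (K + 1) (thickening (2 * e))]).
    apply: le_Lnorm => // x; rewrite [leLHS]/= [leRHS]/= lee_fin.
    by apply: le_trans (ler_norm _); exact: bump_le_envelope sc.
  apply: le_trans (env _ _) _.
    by rewrite mulr_gt0//= ler_pM2l.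
  rewrite lee_fin ler_wpM2r//; apply: (@le_trans _ _ Ce).
    rewrite ler_piMr ?(ltW Ce0)//; apply: le_trans (_ : 1 `^ s <= _)%R; last by rewrite powR1.
    apply: ge0_ler_powR; rewrite ?nnegrE ?(ltW s0)// ?mulr_ge0 ?(ltW e0)//.
    rewrite -ler_pdivlMl// mulr1; apply: (le_trans erho); apply: (le_trans rho16).
    by rewrite lef_pV2 ?posrE// ler_nat.
  by rewrite /C lerDr addr_ge0// mulr_ge0.
pose a k : R := (2^-1 ^+ k)%R.
have a0 k : (0 < a k)%R by rewrite exprn_gt0// invr_gt0.
have a_le j k : (j <= k)%N -> (a k <= a j)%R.
  by move=> jk; apply: ler_wiXn2l => //; rewrite invf_le1// ler1n.
have as0 k : (0 < a k `^ s)%R by rewrite powR_gt0.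
have /andP[q0 q1] := q01.
have qk k : (0 <= q ^+ k)%R by rewrite exprn_ge0// ltW.
(* the first term serves the scales above [rho], the second those below *)
pose b' k : R := (a k `^ s * (d * a k.+1 + C3 * (q ^+ (k - m) * q ^+ (m - k)) * (N + d)))%R.
have b'E k : (a k `^ (- s) * b' k =
    d * a k.+1 + C3 * (N + d) * (q ^+ (k - m) * q ^+ (m - k)))%R.
  by rewrite powRN mulKf ?gt_eqF//; ring.
have mthick t : mu.-caratheodory (thickening t).
  exact: superlevel_thickening (mu_superlevel mmsX).
have menv t := measurable_envelope o d1 (K + 1) GL (mu_superlevel mmsX) (mthick t).
exists b' => [n|n t tn].
  rewrite (eq_bigr _ (fun k _ => b'E k)) big_split/= -!mulr_sumr.
  apply: (@le_trans _ _ (d * 1 + C3 * (N + d) * S)%R).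
    apply: lerD; first by apply: ler_wpM2l; [exact: ltW|exact: half_pow_sum].
    by apply: ler_wpM2l; [rewrite mulr_ge0|exact: two_sided_geometric].
  have -> : (C * (N + d) = C3 * (N + d) * S + N + d + Ce * (N + d))%R by rewrite /C; ring.
  have : (0 <= Ce * (N + d))%R by rewrite mulr_ge0// ltW.
  by move=> Z0; rewrite mulr1 [leLHS]addrC -!addrA lerD2l addrCA lerDl addr_ge0.
have /andP[t1 t2] := tn.
have t0 : (0 < t)%R by apply: lt_le_trans t1; rewrite exprn_gt0// invr_gt0.
have sub0 : (fun y => `|bump E G e y - 0|%:E) = (fun y => `|bump E G e y|%:E).
  by apply/funext => y; rewrite subr0.
have [nn0|n0n] := ltnP n n0.
  (* above [rho] the averages themselves are small, wherever the centre is *)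
  exists (fun=> 0%R), (fun x => d2 * \1_(ball o (K + 1)) x)%R; split => //.
  - apply: measurable_funM => //.
    exact: (@measurable_indic _ (caratheodory_type mu) R _ _ (mballs _)).
  - by move=> x; rewrite mulr_ge0// ltW.
  - move=> x; rewrite sub0; apply: le_trans (large t x _) _.
      rewrite (le_trans _ t1)/=; last exact: a_le.
      by apply: lt_le_trans t2 _; exact: (a_le 0%N).
    by rewrite lee_fin ler_wpM2r.
  - rewrite Lnorm_scale ?(ltW d20)//; last exact: (@measurable_indic _ (caratheodory_type mu) R _ _ (mballs _)).
    rewrite b2E -EFinM lee_fin; apply: (le_trans d2b).
    apply: (@le_trans _ _ (a n `^ s * (d * a n.+1))%R); last first.
      have kap0 : (0 <= C3 * (q ^+ (n - m) * q ^+ (m - n)) * (N + d))%R.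
        by apply: mulr_ge0 => //; apply: mulr_ge0 => //; exact: mulr_ge0.
      by apply: ler_wpM2l; [exact: ltW|rewrite lerDl].
    have -> : (d * rho `^ s * rho = rho `^ s * (d * rho))%R by ring.
    apply: ler_pM; [exact: ltW|by rewrite mulr_ge0// ltW| |by rewrite ler_pM2l// a_le].
    by apply: ge0_ler_powR; rewrite ?nnegrE ?(ltW s0) ?(ltW rho0) ?(ltW (a0 n)) ?a_le// ltnW.
have [mn|nm] := leqP m n.
  have te : (t <= e)%R by apply: ltW; apply: lt_le_trans t2 _; exact: a_le.
  (* scales below [e]: the bump is compared with its value at the centre *)
  exists (bump E G e), (fun x => t / e * envelope G o d1 (K + 1) (thickening (2 * e)) x)%R.
  have te0 : (0 <= t / e)%R by rewrite divr_ge0// ltW.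
  split.
  - by apply: measurable_funM => //; exact: menv.
  - by move=> x; rewrite mulr_ge0// envelope_ge0// ltW.
  - by move=> x; apply: avg_small_scale sc _; rewrite t0.
  - rewrite Lnorm_scale//.
    apply: (@le_trans _ _ ((t / e)%:E * (Ce * (2 * e) `^ s * (N + d))%:E)).
      apply: lee_wpmul2l; first by rewrite lee_fin.
      by apply: env; rewrite mulr_gt0//= ler_pM2l.
    rewrite -EFinM lee_fin.
    have w := small_scale_weight s01 mn qs.
    apply: (@le_trans _ _ (a n / a m * (2 * a m) `^ s * (Ce * (N + d)))%R).
      rewrite [leLHS](_ : _ = t / e * (2 * e) `^ s * (Ce * (N + d)))%R; last by ring.
      rewrite ler_wpM2r ?mulr_ge0 ?(ltW Ce0)// ler_wpM2r ?powR_ge0//.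
      by rewrite ler_pM2r ?invr_gt0// ltW.
    apply: (@le_trans _ _ (2 `^ s * a n `^ s * q ^+ (n - m) * (Ce * (N + d)))%R).
      by rewrite ler_wpM2r// mulr_ge0// ltW.
    rewrite /b'; have -> : (m - n = 0)%N by apply/eqP; rewrite subn_eq0.
    rewrite expr0 mulr1.
    apply: (@le_trans _ _ (a n `^ s * (C3 * q ^+ (n - m) * (N + d)))%R).
      rewrite [leLHS](_ : _ = a n `^ s * (Ce * 2 `^ s * 1 * q ^+ (n - m) * (N + d)))%R; last by ring.
      rewrite ler_wpM2l ?(ltW (as0 n))// ler_wpM2r// ler_wpM2r//.
      rewrite ler_wpM2l ?mulr_ge0 ?powR_ge0 ?(ltW Ce0)// lerDl.
      by rewrite mulr_ge0 ?powR_ge0// ltW.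
    by rewrite ler_wpM2l ?(ltW (as0 n))// lerDr mulr_ge0// ltW.
  - move=> dt x; exfalso; move: t2; rewrite ltNge => /negP; apply.
    by rewrite (le_trans _ dt)// (le_trans _ ed)// a_le.
have et : (e <= t < rho)%R.
  rewrite (le_trans _ t1)/=; last exact: a_le.
  by apply: lt_le_trans t2 _; exact: a_le.
have /andP[_ trho] := et.
(* between [e] and [rho]: the size of the bump times the fraction filled by the layer *)
exists (fun=> 0%R), (fun x => Cm * (e / t) `^ theta *
  envelope G o d1 (K + 1) (thickening (2 * t)) x)%R.
have k0 : (0 <= Cm * (e / t) `^ theta)%R by rewrite mulr_ge0 ?powR_ge0// ltW.
split => //.
- by apply: measurable_funM => //; exact: menv.
- by move=> x; rewrite mulr_ge0// envelope_ge0// ltW.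
- by move=> x; rewrite sub0; exact: HCm sc et.
- rewrite Lnorm_scale//.
  apply: (@le_trans _ _ ((Cm * (e / t) `^ theta)%:E * (Ce * (2 * t) `^ s * (N + d))%:E)).
    apply: lee_wpmul2l; first by rewrite lee_fin.
    by apply: env; rewrite mulr_gt0//= ler_pM2l// ltW.
  rewrite -EFinM lee_fin.
  have w := mid_scale_weight (ltW s0) (ltW theta0) nm qt tn.
  rewrite [leLHS](_ : _ = (e / t) `^ theta * (2 * t) `^ s * (Cm * Ce * (N + d)))%R; last by ring.
  have CmCe : (0 <= Cm * Ce * (N + d))%R by rewrite !mulr_ge0// ltW.
  apply: le_trans (ler_wpM2r CmCe w) _.
  rewrite /b'; have -> : (n - m = 0)%N by apply/eqP; rewrite subn_eq0 ltnW.
  rewrite expr0 mul1r.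
  apply: (@le_trans _ _ (a n `^ s * (C3 * q ^+ (m - n) * (N + d)))%R).
    rewrite [leLHS](_ : _ = a n `^ s * (Ce * 2 `^ s * (Cm * 2 `^ theta) * q ^+ (m - n) * (N + d)))%R; last by rewrite /a; ring.
    rewrite ler_wpM2l ?(ltW (as0 n))// ler_wpM2r// ler_wpM2r//.
    by rewrite ler_wpM2l ?mulr_ge0 ?powR_ge0 ?(ltW Ce0)// lerDr.
  by rewrite ler_wpM2l ?(ltW (as0 n))// lerDr mulr_ge0// ltW.
Qed.

End layer_extension.

(** * Density of Lipschitz functions in L_p *)

Section Lp_density.
Local Open Scope ereal_scope.
Context {R : realType} {X : completeMetricType R}.
Variables (m : {outer_measure set X -> \bar R}) (p : R).
Hypotheses (p1 : (1 <= p)%R) (mm : superlevel_measurable m)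
  (mfin : forall x r, m (ball x r) < +oo)
  (mreg : forall (A : set X) o r (d : R), m.-caratheodory A -> A `<=` ball o r ->
    (0 < d)%R -> exists V, [/\ open V, V `<=` ball o r, m (V `\` A) <= d%:E &
      m (A `\` V) <= 0]).

Local Notation N := (Lnorm (cara_measure m) p%:E).
Implicit Types (f g h : X -> R) (A V : set X).

Let p0 : (0 < p)%R. Proof. exact: lt_le_trans p1. Qed.

Definition test_function g := [/\ lipschitz_fun g,
  exists M : R, forall x, (`|g x| <= M)%R &
  exists o (K : R), forall x, g x != 0%R -> (mdist o x < K)%R].

Definition approximable f :=
  measurable_fun [set: caratheodory_type m] (f : caratheodory_type m -> R) /\
  forall d : R, (0 < d)%R -> exists2 g, test_function g &
    N (EFin \o (f \- g)%R) <= d%:E.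

Lemma test_function_measurable g : test_function g ->
  measurable_fun [set: caratheodory_type m] (g : caratheodory_type m -> R).
Proof. by case=> gL _ _; exact: measurable_lipschitz. Qed.

Lemma test_functionZ (k : R) g : test_function g -> test_function (fun x => k * g x)%R.
Proof.
case=> [[L gL] [M gM] [ o [K gK]]]; split.
- exists (`|k| * L)%R => x y; rewrite -mulrBr normrM -mulrA.
  exact: ler_wpM2l.
- by exists (`|k| * M)%R => x; rewrite normrM ler_wpM2l.
- by exists o, K => x kg; apply: gK; move: kg; apply: contra_neq => ->; rewrite mulr0.
Qed.

Lemma test_functionD g h : test_function g -> test_function h ->
  test_function (g \+ h)%R.
Proof.
case=> [[L gL] [M gM] [ o [K gK]]] [[L' hL] [M' hM] [ o' [K' hK]]]; split.
- exists (L + L')%R => x y; rewrite /= opprD addrACA mulrDl.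
  by apply: le_trans (ler_normD _ _) _; exact: lerD.
- by exists (M + M')%R => x; apply: le_trans (ler_normD _ _) _; exact: lerD.
- exists o, (Num.max K (mdist o o' + K'))%R => x /=.
  have [gx|/gK gx] := eqVneq (g x) 0%R; last by rewrite lt_max gx.
  rewrite gx add0r => /hK hx; rewrite lt_max; apply/orP; right.
  by apply: le_lt_trans (metric_triangle o o' x) _; rewrite ltrD2l.
Qed.

(** Density is obtained from open sets to measurable sets to simple functions, and
    each step only has to approximate by functions already reached. *)
Lemma approximable_closed f :
  measurable_fun [set: caratheodory_type m] (f : caratheodory_type m -> R) ->
  (forall d : R, (0 < d)%R -> exists2 g, approximable g & N (EFin \o (f \- g)%R) <= d%:E) ->
  approximable f.
Proof.
move=> mf H; split => // d d0; have d20 : (0 < d / 2)%R by rewrite divr_gt0.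
have [g [mg apg] fg] := H _ d20; have [h th gh] := apg _ d20.
exists h => //; have mh := test_function_measurable th.
have -> : (f \- h)%R = ((f \- g) \+ (g \- h))%R.
  by apply/funext => x /=; rewrite addrA subrK.
apply: le_trans (minkowski_EFin _ _ _ p1) _; rewrite /=.
- exact: measurable_funB.
- exact: measurable_funB.
by rewrite [d in leRHS]splitr EFinD leeD.
Qed.

Lemma approximableD f g : approximable f -> approximable g -> approximable (f \+ g)%R.
Proof.
move=> [mf af] [mg ag]; split; first exact: measurable_funD.
move=> d d0; have d20 : (0 < d / 2)%R by rewrite divr_gt0.
have [f' tf' ff'] := af _ d20; have [g' tg' gg'] := ag _ d20.
exists (f' \+ g')%R; first exact: test_functionD.
have -> : ((f \+ g) \- (f' \+ g'))%R = ((f \- f') \+ (g \- g'))%R.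
  by apply/funext => x /=; rewrite opprD addrACA.
have mf' := test_function_measurable tf'; have mg' := test_function_measurable tg'.
apply: le_trans (minkowski_EFin _ _ _ p1) _; rewrite /=.
- exact: measurable_funB.
- exact: measurable_funB.
by rewrite [d in leRHS]splitr EFinD leeD.
Qed.

Lemma eq_norm_Lnorm (f g : X -> R) : (forall x, (`|f x| = `|g x|)%R) ->
  N (EFin \o f) = N (EFin \o g).
Proof.
move=> fg; apply/eqP; rewrite eq_le; apply/andP; split; apply: le_Lnorm => // x;
  by rewrite /= fg.
Qed.

Lemma approximableZ (k : R) f : approximable f -> approximable (fun x => k * f x)%R.
Proof.
move=> [mf af]; split; first exact: measurable_funM.
move=> d d0; have k1 : (0 < `|k| + 1)%R by rewrite ltr_wpDl.
have [|g tg fg] := af (d / (`|k| + 1))%R; first by rewrite divr_gt0.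
have mg := test_function_measurable tg.
exists (fun x => k * g x)%R; first exact: test_functionZ.
rewrite (@eq_norm_Lnorm _ (fun x => `|k| * (f x - g x))%R); last first.
  by move=> x /=; rewrite -mulrBr !normrM normr_id.
rewrite (@Lnorm_scale _ _ _ (cara_measure m) p `|k|%R (f \- g)%R)//; last exact: measurable_funB.
apply: (le_trans (lee_wpmul2l _ fg)); first by rewrite lee_fin.
rewrite -EFinM lee_fin mulrCA ler_piMr ?(ltW d0)// ler_pdivrMr// mul1r lerDl//.
Qed.

Lemma approximable_sum I (r : seq I) (F : I -> X -> R) : (forall i, approximable (F i)) ->
  approximable (fun x => \sum_(i <- r) F i x)%R.
Proof.
move=> aF; elim: r => [|i r ih].
  have -> : (fun x => \sum_(i <- [::]) F i x)%R = cst 0%R by apply/funext => x; rewrite big_nil.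
  split; first exact: measurable_cst.
  move=> d d0; exists (cst 0%R).
    split; [exists 0%R|exists 0%R|exists point, 0%R] => x; rewrite /= ?normr0 ?eqxx//.
    by move=> y; rewrite subrr normr0 mul0r.
  have -> : EFin \o (cst 0 \- cst 0)%R = cst 0 :> (X -> \bar R).
    by apply/funext => x /=; rewrite subrr.
  by rewrite Lnorm0 ?lee_fin ?(ltW d0)// eqe gt_eqF.
have -> : (fun x => \sum_(j <- i :: r) F j x)%R = (F i \+ (fun x => \sum_(j <- r) F j x))%R.
  by apply/funext => x; rewrite big_cons.
exact: approximableD.
Qed.

Lemma Lnorm_indic_le A (d : R) : (0 <= d)%R -> m.-caratheodory A ->
  m A <= (d `^ p)%:E -> N (EFin \o \1_A) <= d%:E.
Proof.
move=> d0 mA mAd; rewrite (Lnorm_indic p0 mA).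
have -> : d%:E = (d `^ p)%:E `^ p^-1.
  by rewrite poweR_EFin -powRrM mulfV ?gt_eqF// powRr1.
by apply: le_poweR => //; rewrite ?invr_ge0 ?outer_measure_ge0// ltW.
Qed.

Lemma open_caratheodory V : open V -> m.-caratheodory V.
Proof.
move=> oV; have [VT|/set0P Vn0] := eqVneq (~` V) set0.
  rewrite -(setCK V) VT; apply: caratheodory_measurable_setC.
  exact: caratheodory_measurable_set0.
have -> : V = [set x | (0 < set_dist (~` V) x)%R].
  apply/seteqP; split => x /=; last first.
    by apply: contraPP => nVx; rewrite set_dist0 ?ltxx.
  move=> Vx; apply: set_dist_gt0 => //.
  exact: open_closedC.
by apply: mm; exact: set_dist_lip.
Qed.

(** The functions [min 1 (n * dist x (~` V))] are Lipschitz and differ from the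
    indicator on the part of [V] within [1 / n] of its complement; these parts
    decrease to the empty set and have finite measure. *)
Lemma approximable_open V o r : open V -> V `<=` ball o r -> approximable (\1_V).
Proof.
move=> oV Vr; have mV := open_caratheodory oV.
have mI : measurable_fun [set: caratheodory_type m] (\1_V : caratheodory_type m -> R).
  exact: (@measurable_indic _ (caratheodory_type m) R _ _ mV).
split => // d d0; have [VT|/set0P Vn0] := eqVneq (~` V) set0.
  (* an open set without complement is the whole space, and its indicator is constant *)
  exists \1_V.
    have V1 x : \1_V x = 1%R :> R.
      by rewrite indicE mem_set//; apply: contrapT => nV; have : (~` V) x by []; rewrite VT.
    split; [exists 0%R|exists 1%R|exists o, r] => x; rewrite ?V1 ?normr1//.
      by move=> y; rewrite !V1 subrr normr0 mul0r.
    move=> _; have : V x by apply: contrapT => nV; have : (~` V) x by []; rewrite VT.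
    by move/Vr; rewrite ballEmdist.
  have -> : EFin \o (\1_V \- \1_V)%R = cst 0 :> (X -> \bar R).
    by apply/funext => x /=; rewrite subrr.
  by rewrite Lnorm0 ?lee_fin ?(ltW d0)// eqe gt_eqF.
pose F n := V `&` [set x | (set_dist (~` V) x < n.+1%:R^-1)%R].
have mF n : m.-caratheodory (F n).
  by apply: caratheodory_measurable_setI => //; exact: superlevel_thickening.
have F0 : \bigcap_n F n = set0.
  apply/seteqP; split => // x Fx; have [Vx _] := Fx 0%N Logic.I.
  have dx : (0 < set_dist (~` V) x)%R.
    by apply: set_dist_gt0 => //; exact: open_closedC.
  have [n _ hn] := near_infty_natSinv_lt (PosNum dx).
  have := hn n (leqnn n); have [_ /= xn] := Fx n Logic.I.
  by move=> /(lt_trans xn); rewrite ltxx.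
have cvgF : m (F n) @[n --> \oo] --> 0.
  have := @nonincreasing_cvg_mu _ (caratheodory_type m) R (cara_measure m) F.
  rewrite F0 measure0; apply => //; first by apply: le_lt_trans (mfin o r);
    apply: le_outer_measure => x [/Vr].
  move=> i j ij; apply/subsetPset => x [Vx /= xj]; split => //=.
  by apply: lt_le_trans xj _; rewrite lef_pV2 ?posrE// ler_nat.
have [n nd] : exists n, m (F n) <= (d `^ p)%:E.
  have dp : (0 < d `^ p)%R by rewrite powR_gt0.
  have /fine_cvgP[[n1 _ fin1] /cvgrPdist_lt/(_ _ dp)[n2 _ lt2]] := cvgF.
  exists (maxn n1 n2); rewrite -[leLHS]fineK; last by apply: fin1 => /=; rewrite leq_maxl.
  have := lt2 _ (leq_maxr n1 n2); rewrite /= sub0r normrN => lt.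
  by rewrite lee_fin; apply: le_trans (ler_norm _) (ltW lt).
exists (fun x => Num.min 1 (n.+1%:R * set_dist (~` V) x))%R.
  split.
  - exists n.+1%:R => x y.
    wlog xy : x y / (set_dist (~` V) y <= set_dist (~` V) x)%R.
      move=> wl; have [/wl//|/ltW/wl] := leP (set_dist (~` V) y) (set_dist (~` V) x).
      by rewrite distrC metric_sym.
    have nxy : (n.+1%:R * set_dist (~` V) x - n.+1%:R * set_dist (~` V) y
        <= n.+1%:R * mdist x y)%R.
      by rewrite -mulrBr ler_wpM2l// set_dist_lip.
    have : (0 <= n.+1%:R * mdist x y)%R by rewrite mulr_ge0// mdist_ge0.
    have : (n.+1%:R * set_dist (~` V) y <= n.+1%:R * set_dist (~` V) x)%R.
      by rewrite ler_wpM2l.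
    move: nxy; rewrite /Num.min; case: ifP; case: ifP => h1 h2; rewrite ler_norml; lra.
  - exists 1%R => x; rewrite ger0_norm ?ge_min ?lexx//.
    by rewrite le_min ler01 mulr_ge0// set_dist_ge0.
  - exists o, r => x; apply: contra_neqT => nx.
    rewrite set_dist0 ?mulr0 ?min_r// => /Vr; rewrite ballEmdist/= => ox.
    by rewrite ox in nx.
apply: le_trans (Lnorm_indic_le (ltW d0) (mF n) nd).
apply: le_Lnorm => // x; rewrite [leLHS]/= [leRHS]/= lee_fin !indicE.
have [Vx|nVx] := pselect (V x); last first.
  rewrite memNset// set_dist0// mulr0 min_r// subrr normr0//.
rewrite mem_set//; have [xn|xn] := ltP (set_dist (~` V) x) (n.+1%:R^-1)%R.
  rewrite (mem_set (_ : F n x))// normr1 ger0_norm; last by rewrite subr_ge0 ge_min lexx.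
  by rewrite gerBl le_min ler01 mulr_ge0// set_dist_ge0.
by rewrite min_l ?subrr ?normr0// -ler_pdivrMl// mulr1.
Qed.

(** Outer regularity replaces the set by an open one; the indicators differ on the
    symmetric difference, whose measure is small. *)
Lemma approximable_indic A o r : m.-caratheodory A -> A `<=` ball o r -> approximable (\1_A).
Proof.
move=> mA Ar; have mI : measurable_fun [set: caratheodory_type m] (\1_A : caratheodory_type m -> R).
  exact: (@measurable_indic _ (caratheodory_type m) R _ _ mA).
apply: approximable_closed => // d d0; have dp : (0 < d `^ p)%R by rewrite powR_gt0.
have [V [oV Vr VA AV]] := mreg mA Ar dp.
have mV := open_caratheodory oV.
exists \1_V; first exact: approximable_open oV Vr.
have mD : m.-caratheodory ((V `\` A) `|` (A `\` V)).
  by apply: caratheodory_measurable_setU; exact: caratheodory_measurable_setD.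
apply: (@le_trans _ _ (N (EFin \o \1_((V `\` A) `|` (A `\` V))))); last first.
  apply: Lnorm_indic_le => //; first exact: ltW.
  apply: le_trans (outer_measureU2 _ _ _) _.
  by rewrite -[leRHS]adde0 leeD.
apply: le_Lnorm => // x; rewrite [leLHS]/= [leRHS]/= lee_fin !indicE.
have [Vx|nVx] := pselect (V x); have [Ax|nAx] := pselect (A x).
- by rewrite (mem_set Ax) (mem_set Vx) subrr normr0.
- rewrite (memNset nAx) (mem_set Vx) (mem_set (_ : (V `\` A `|` A `\` V) x)); last by left.
  by rewrite sub0r normrN.
- rewrite (mem_set Ax) (memNset nVx) (mem_set (_ : (V `\` A `|` A `\` V) x)); last by right.
  by rewrite subr0.
- by rewrite (memNset nAx) (memNset nVx) subrr normr0.
Qed.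

Import HBNNSimple.

(** Simple functions increasing to [f], cut off to the balls of radius [n], converge
    to [f] in L_p by dominated convergence. *)
Lemma approximable_ge0 f :
  measurable_fun [set: caratheodory_type m] (f : caratheodory_type m -> R) ->
  (forall x, (0 <= f x)%R) -> N (EFin \o f) < +oo -> approximable f.
Proof.
move=> mf f0 Nf; apply: approximable_closed => // d d0.
have mEf : measurable_fun [set: caratheodory_type m] (EFin \o f).
  exact/measurable_EFinP.
pose S := nnsfun_approx measurableT mEf.
have f0' x : [set: caratheodory_type m] x -> 0 <= (EFin \o f) x by rewrite lee_fin.
pose B n := ball (point : X) n%:R.
pose g n x : R := (S n x * \1_(B n) x)%R.
have mB n : m.-caratheodory (B n) by exact: superlevel_ball.
have ag n : approximable (g n).
  have mS (c : R) : m.-caratheodory (S n @^-1` [set c]).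
    by have := @measurable_funPTI _ _ (caratheodory_type m) R (S n) [set c] (measurable_set1 c).
  have -> : g n = (fun x => \sum_(y <- finmap.enum_fset (fset_set (range (S n))))
      (y * \1_(S n @^-1` [set y] `&` B n) x))%R.
    apply/funext => x; rewrite /g fimfunE fsbig_finite//= mulr_suml.
    by apply: eq_bigr => i _; rewrite -mulrA indicI.
  apply: approximable_sum => i; apply: approximableZ.
  apply: (@approximable_indic _ point n%:R); last by move=> x [].
  exact: caratheodory_measurable_setI.
have g0 n x : (0 <= g n x)%R by rewrite mulr_ge0// fun_ge0.
have gf n x : (g n x <= f x)%R.
  apply: (@le_trans _ _ (S n x)).
    by apply: ler_piMr; [exact: fun_ge0|rewrite indicE; case: (_ \in _)].
  by rewrite -lee_fin /S nnsfun_approxE; exact: le_approx.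
have mg n := (ag n).1.
pose F n (x : caratheodory_type m) : \bar R := (`|f x - g n x| `^ p)%:E.
have mpow (h : X -> R) : measurable_fun [set: caratheodory_type m] (h : caratheodory_type m -> R) ->
    measurable_fun [set: caratheodory_type m] (fun x => (`|h x| `^ p)%:E : \bar R).
  move=> mh; apply/measurable_EFinP.
  apply: (@measurableT_comp _ _ _ _ _ _ (@powR R ^~ p)) => //.
  exact: measurableT_comp.
have Fcvg x : F n x @[n --> \oo] --> 0.
  have Scv : (S n x @[n --> \oo] --> f x)%R.
    have /fine_cvgP[_] := cvg_nnsfun_approx measurableT mEf f0' (Logic.I : setT (x : caratheodory_type m)).
    exact.
  apply/fine_cvgP; split; first exact: nearW.
  apply/cvgrPdist_lt => e e0; have ep : (0 < e `^ p^-1)%R by rewrite powR_gt0.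
  have Bx : \forall n \near \oo, B n x.
    exists (Num.bound (mdist (point : X) x)) => // n /= hn; rewrite /B ballEmdist/=.
    apply: lt_le_trans (archi_boundP _) _; first exact: mdist_ge0.
    by rewrite ler_nat.
  have /cvgrPdist_lt/(_ _ ep) Sx := Scv.
  near=> n; rewrite /= sub0r normrN ger0_norm ?powR_ge0//.
  have -> : g n x = S n x.
    by rewrite /g indicE mem_set ?mulr1//; near: n.
  rewrite -[ltRHS]powRr1 ?(ltW e0)// -(@mulVf _ p) ?gt_eqF// powRrM.
  by apply: gt0_ltr_powR; rewrite ?nnegrE ?powR_ge0//; near: n.
have iG : (cara_measure m).-integrable setT (fun x : caratheodory_type m => (`|f x| `^ p)%:E).
  apply/integrableP; split; first exact: mpow.
  move: Nf; rewrite unlock /Lnorm => /lty_poweRy; rewrite invr_eq0 gt_eqF// => /(_ isT).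
  by apply: le_lt_trans; apply: le_nnintegral => // x _; rewrite gee0_abs ?lee_fin ?powR_ge0.
have cvgI : \int[cara_measure m]_x F n x @[n --> \oo] --> 0.
  rewrite -[X in _ --> X](integral0 (cara_measure m) setT).
  apply: (@dominated_cvg _ _ _ (cara_measure m) setT measurableT F (cst 0) _ _ _ _ iG) => //.
  - by move=> n; apply: mpow; exact: measurable_funB.
  - move=> n x _; rewrite gee0_abs ?lee_fin ?powR_ge0//.
    apply: ge0_ler_powR; rewrite ?nnegrE ?(ltW p0)//.
    by rewrite !ger0_norm ?subr_ge0// gerBl.
have dp : (0 < d `^ p)%R by rewrite powR_gt0.
have /fine_cvgP[[n1 _ fin1] /cvgrPdist_lt/(_ _ dp)[n2 _ lt2]] := cvgI.
pose n := maxn n1 n2; exists (g n); first exact: ag.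
rewrite unlock /Lnorm.
have -> : d%:E = (d `^ p)%:E `^ p^-1.
  by rewrite poweR_EFin -powRrM mulfV ?gt_eqF// powRr1// ltW.
apply: le_poweR; first by rewrite invr_ge0 ltW.
  by apply: integral_ge0 => x _; exact: poweR_ge0.
rewrite -[leLHS]fineK; last exact: (fin1 _ (leq_maxl n1 n2)).
have := lt2 _ (leq_maxr n1 n2); rewrite /= sub0r normrN => lt.
by rewrite lee_fin; apply: le_trans (ler_norm _) (ltW lt).
Unshelve. all: by end_near. Qed.

Lemma Lp_approximable f :
  measurable_fun [set: caratheodory_type m] (f : caratheodory_type m -> R) ->
  N (EFin \o f) < +oo -> approximable f.
Proof.
move=> mf Nf; pose fp x := Num.max (f x) 0%R; pose fn x := Num.max (- f x)%R 0%R.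
have mfp : measurable_fun [set: caratheodory_type m] (fp : caratheodory_type m -> R).
  exact: measurable_maxr.
have mfn : measurable_fun [set: caratheodory_type m] (fn : caratheodory_type m -> R).
  by apply: measurable_maxr => //; exact: measurableT_comp.
have -> : f = (fp \+ (fun x => -1 * fn x))%R.
  apply/funext => x; rewrite /fp /fn /= mulN1r.
  by have [fx|fx] := leP (f x) 0%R; rewrite maxElt; case: ifP; lra.
apply: approximableD; first apply: approximable_ge0 => //.
- by move=> x; rewrite le_max lexx orbT.
- apply: le_lt_trans Nf; apply: le_Lnorm => // x; rewrite [leLHS]/= [leRHS]/= lee_fin /fp.
  by rewrite maxEle; case: ifP => _; rewrite ?normr0.
apply: approximableZ; apply: approximable_ge0 => //.
- by move=> x; rewrite le_max lexx orbT.
- apply: le_lt_trans Nf; apply: le_Lnorm => // x; rewrite [leLHS]/= [leRHS]/= lee_fin /fn.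
  by rewrite maxEle; case: ifP => _; rewrite ?normr0 ?normrN.
Qed.

End Lp_density.

(** * Outer regularity of the restricted Hausdorff measure *)

Section outer_regularity.
Local Open Scope ereal_scope.
Context {R : realType} {X : completeMetricType R}.
Variables (mu : {outer_measure set X -> \bar R}) (theta : R) (E : set X).

Local Notation H := (codim_hausdorff mu theta).
Local Notation nu := (outer_restr H E : {outer_measure set X -> \bar R}).
Hypothesis nufin : forall x r, nu (ball x r) < +oo.

Lemma open_mball (x : X) (r : R) : open (ball x r).
Proof.
have -> : ball x r = [set y | (0 < r - mdist x y)%R].
  by rewrite ballEmdist; apply/seteqP; split => y /=; rewrite subr_gt0.
by apply: open_superlevel; exact: short_ball.
Qed.

(** The union of a nearly optimal cover is open and is covered by the same balls.  It
    is the content at the fixed scale [delta] that is controlled: the Hausdorff measure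
    of the union may be infinite. *)
Lemma codim_content_open (A : set X) (delta e : R) : H A < +oo ->
  (0 < delta)%R -> (0 < e)%R -> exists U, [/\ open U, A `<=` U &
    codim_content mu theta delta U <= H A + e%:E].
Proof.
move=> Aoo de0 e0; have cA := codim_content_le_hausdorff mu theta A de0.
have fin : codim_content mu theta delta A \is a fin_num.
  by rewrite ge0_fin_numE ?codim_content_ge0// (le_lt_trans cA).
have [_ [J [x [r [[Jr AJ] ->]]]] Jlt] := lb_ereal_inf_adherent e0 fin.
exists (\bigcup_(i in J) ball (x i) (r i)); split => //.
  by apply: bigcup_open => i _; exact: open_mball.
apply: (@le_trans _ _ (\esum_(i in J) codim_gauge mu theta (x i) (r i))).
  by apply: ereal_inf_lbound; exists J, x, r; split => //; split.
by apply: (le_trans (ltW Jlt)); rewrite leeD2r.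
Qed.

(** Intersect with a ball the open sets given by covers at scales tending to 0.  Every
    content of the total intersection, hence its Hausdorff measure, is at most the
    measure of [A `&` E]; as [nu] is finite on the ball, it is continuous along the
    decreasing finite intersections.  These contain [A `&` E] rather than [A], which
    is why [A `\` V] is only claimed to be negligible. *)
Lemma nu_outer_regular (A : set X) (o : X) (r d : R) : nu.-caratheodory A ->
  A `<=` ball o r -> (0 < d)%R -> exists V, [/\ open V, V `<=` ball o r,
    nu (V `\` A) <= d%:E & nu (A `\` V) <= 0].
Proof.
move=> mA Ar d0; pose A' := A `&` E.
have Aoo : H A' < +oo.
  by apply: le_lt_trans (nufin o r); rewrite /= /outer_restr; apply: le_outer_measure; exact: setSI.
pose c n : R := (n.+1%:R^-1)%R.
have c0 n : (0 < c n)%R by rewrite invr_gt0.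
have /choice[U HU] : forall n, exists U, [/\ open U, A' `<=` U &
    codim_content mu theta (c n) U <= H A' + (c n)%:E].
  by move=> n; exact: codim_content_open.
pose V n := ball o r `&` \bigcap_(k < n.+1) U k.
have oV n : open (V n).
  apply: openI; first exact: open_mball.
  rewrite bigcap_mkord; elim/big_ind : _ => //; first exact: openT.
    by move=> B D; exact: openI.
  by move=> i _; have [] := HU i.
have AV n : A' `<=` V n.
  move=> x A'x; split; first by apply: Ar; case: A'x.
  by move=> k _; have [_ + _] := HU k; exact.
have mV n : nu.-caratheodory (V n) by apply: open_caratheodory (oV n); exact: nu_superlevel.
have capV : nu (\bigcap_n V n) <= nu A.
  apply: (@le_trans _ _ (H (\bigcap_n V n))); first by apply: le_outer_measure => x [].
  rewrite codim_hausdorffE; apply: ge_ereal_sup => _ [delta /= + <-].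
  rewrite in_itv/= andbT => de0; apply/lee_addgt0Pr => e e0.
  have me0 : (0 < Num.min delta e)%R by rewrite lt_min de0.
  have [n _ hn] := near_infty_natSinv_lt (PosNum me0).
  have /= := hn n (leqnn n); rewrite lt_min => /andP[nd ne].
  apply: (@le_trans _ _ (codim_content mu theta (c n) (U n))).
    apply: le_trans (codim_content_nonincreasing mu theta _ (ltW nd)) _.
    by apply: le_codim_content => x /(_ n Logic.I)[_]; apply => /=.
  have [_ _ le] := HU n; apply: (le_trans le).
  by apply: leeD => //; rewrite lee_fin ltW.
have cvgV : nu (V n) @[n --> \oo] --> nu (\bigcap_n V n).
  apply: (@nonincreasing_cvg_mu _ (caratheodory_type nu) R (cara_measure nu) V).
  - by apply: le_lt_trans (nufin o r); apply: le_outer_measure => x [].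
  - exact: mV.
  - by apply: (@bigcap_measurable _ (caratheodory_type nu)) => // k _; exact: mV.
  - move=> i j ij; apply/subsetPset => x [xo xj]; split => // k /= ki.
    by apply: xj => /=; exact: leq_trans ki _.
have nuA : nu A \is a fin_num.
  have A0 : 0 <= nu A by exact: outer_measure_ge0.
  rewrite ge0_fin_numE//.
have [n Vn] : exists n, nu (V n) <= nu A + d%:E.
  apply: contrapT => no.
  suff : nu A + d%:E <= nu A by rewrite leNgt lteDl// lte_fin d0.
  apply: le_trans capV; apply: (cvge_ge _ cvgV); apply: nearW => n.
  by rewrite leNgt; apply/negP => /ltW Vn; apply: no; exists n.
have VA : nu (V n `&` A) = nu A.
  apply/eqP; rewrite eq_le; apply/andP; split; first by apply: le_outer_measure => x [].
  by rewrite /= /outer_restr; apply: le_outer_measure => x A'x; split => //; [split|]; [exact: AV|case: A'x|case: A'x].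
exists (V n); split => //; first by move=> x [].
  have := mA (V n); rewrite VA -setDE => VE.
  by move: Vn; rewrite VE leeD2lE.
rewrite /= /outer_restr (_ : _ `&` E = set0) ?outer_measure0//.
apply/seteqP; split => // x [[Ax nVx] Ex]; apply: nVx; exact: AV.
Qed.

End outer_regularity.

(** * Real series, dyadic integrals and mean oscillation *)

Section real_series.
Local Open Scope ereal_scope.
Context {R : realType}.

(** A total sum: the positive and the negative parts are summed separately, and an
    infinite sum is replaced by 0.  It is the usual one for absolutely convergent
    series, and it depends measurably on the terms. *)
Definition series_sum (a : nat -> R) : R :=
  (fine (\sum_(k <oo) (Num.max (a k) 0)%:E) -
   fine (\sum_(k <oo) (Num.max (- a k) 0)%:E))%R.

(** As [c] is eventually 0, the right-hand side is finite only if [a] converges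
    absolutely, so the default value of a divergent sum is harmless. *)
Lemma series_sum_dist (a c : nat -> R) n : (forall k, (n <= k)%N -> c k = 0%R) ->
  `|(series_sum a - \sum_(0 <= k < n) c k)%:E| <= \sum_(k <oo) `|a k - c k|%:E.
Proof.
move=> cn; set S := (X in _ <= X).
have [Soo|] := ltP S +oo; last by rewrite leye_eq => /eqP ->; rewrite leey.
have S_split : S = \sum_(0 <= k < n) `|a k - c k|%:E + \sum_(n <= k <oo) `|a k|%:E.
  rewrite /S (nneseries_split 0 n) ?add0n; last by move=> k _; rewrite lee_fin.
  congr (_ + _); rewrite -[LHS]nneseries_addn; last by move=> k; rewrite lee_fin.
  rewrite -[RHS]nneseries_addn; last by move=> k; rewrite lee_fin.
  by apply: eq_eseriesr => k _; rewrite cn ?leq_addl// subr0.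
(* applied to the positive and to the negative part of [a] *)
have part (b : nat -> R) : (forall k, (0 <= b k <= `|a k|)%R) ->
    exists2 t : R, (0 <= t)%R & \sum_(n <= k <oo) (b k)%:E = t%:E /\
    fine (\sum_(k <oo) (b k)%:E) = (\sum_(0 <= k < n) b k + t)%R.
  move=> ba.
  have b0 k : 0 <= (b k)%:E by rewrite lee_fin; have /andP[] := ba k.
  have tle : \sum_(n <= k <oo) (b k)%:E <= \sum_(n <= k <oo) `|a k|%:E.
    apply: lee_nneseries => k *; first exact: b0.
    by rewrite lee_fin; have /andP[] := ba k.
  have tf : \sum_(n <= k <oo) (b k)%:E \is a fin_num.
    rewrite ge0_fin_numE; last by apply: nneseries_ge0 => *; exact: b0.
    apply: le_lt_trans tle _; apply: le_lt_trans Soo; rewrite S_split leeDr//.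
    by apply: sume_ge0 => k _; rewrite lee_fin.
  exists (fine (\sum_(n <= k <oo) (b k)%:E)).
    by rewrite fine_ge0// nneseries_ge0// => *; exact: b0.
  rewrite fineK//; split => //.
  rewrite (nneseries_split 0 n) ?add0n; last by move=> k _; exact: b0.
  by rewrite sumEFin fineD.
have maxP (x : R) : (0 <= Num.max x 0 <= `|x|)%R.
  by rewrite le_max lexx orbT/= ge_max ler_norm normr_ge0.
have [tp tp0 [tpE PE]] := part (fun k => Num.max (a k) 0)%R (fun k => maxP (a k)).
have [|tq tq0 [tqE QE]] := part (fun k => Num.max (- a k) 0)%R.
  by move=> k; rewrite -(normrN (a k)).
rewrite /series_sum PE QE S_split.
have -> : \sum_(n <= k <oo) `|a k|%:E = (tp + tq)%:E.
  rewrite EFinD -tpE -tqE -nneseriesD; last 2 first.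
  - by move=> k _ _; rewrite lee_fin le_max lexx orbT.
  - by move=> k _ _; rewrite lee_fin le_max lexx orbT.
  apply: eq_eseriesr => k _; rewrite -EFinD; congr (_%:E).
  have [ak|ak] := leP (a k) 0%R.
    by rewrite ler0_norm// max_l ?add0r// oppr_ge0.
  by rewrite gtr0_norm// max_r ?addr0// oppr_le0 ltW.
rewrite sumEFin -EFinD [leLHS]/= lee_fin.
have -> : (\sum_(0 <= k < n) Num.max (a k) 0 + tp -
    (\sum_(0 <= k < n) Num.max (- a k) 0 + tq) - \sum_(0 <= k < n) c k =
    \sum_(0 <= k < n) (a k - c k) + (tp - tq))%R.
  have -> : (\sum_(0 <= k < n) (a k - c k) = \sum_(0 <= k < n) Num.max (a k) 0 -
     \sum_(0 <= k < n) Num.max (- a k) 0 - \sum_(0 <= k < n) c k)%R.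
    rewrite -!sumrB; apply: eq_bigr => k _; congr (_ - _)%R.
    have [ak|ak] := leP (a k) 0%R.
      by rewrite max_l ?sub0r ?opprK// oppr_ge0.
    by rewrite max_r ?subr0// oppr_le0 ltW.
  lra.
apply: le_trans (ler_normD _ _) _; apply: lerD; first exact: ler_norm_sum.
by rewrite ler_norml; apply/andP; split; lra.
Qed.

End real_series.

Section dyadic_integral.
Local Open Scope ereal_scope.
Context {R : realType}.

Lemma exists_dyadic_scale (t : R) : (0 < t < 1)%R -> exists n, (2^-1 ^+ n.+1 <= t < 2^-1 ^+ n)%R.
Proof.
move=> /andP[t0 t1]; have [n0 hn0] := exists_pow_half t0.
have exn : exists n, ((2^-1 : R) ^+ n <= t)%R by exists n0.
case: (ex_minnP exn) => -[|m]; first by rewrite expr0 leNgt t1.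
move=> mt min; exists m; rewrite mt/= ltNge; apply/negP => /min; rewrite ltnn//.
Qed.

Lemma dyadic_integral_le (F : R -> \bar R) (w : nat -> \bar R) :
  (forall t, (0 < t < 1)%R -> 0 <= F t) -> (forall n, 0 <= w n) ->
  (forall n t, (2^-1 ^+ n.+1 <= t < 2^-1 ^+ n)%R -> F t <= w n) ->
  \int[lebesgue_measure]_(t in `]0%R, 1%R[) F t <= \sum_(n <oo) w n * (2^-1 ^+ n.+1)%:E.
Proof.
move=> F0 w0 Fw; pose B n : set R := `[(2^-1 ^+ n.+1)%R, (2^-1 ^+ n)%R[%classic.
have lB n : lebesgue_measure (B n) = (2^-1 ^+ n.+1)%:E.
  rewrite lebesgue_measure_itv/= lte_fin ifT.
    by rewrite -EFinB; congr (_%:E); rewrite exprS; lra.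
  by rewrite exprS gtr_pMl ?exprn_gt0 ?invr_gt0// invf_lt1// ltr1n.
under [leRHS]eq_eseriesr do rewrite -lB.
rewrite -integral_simple_series//; last by move=> j; exact: measurable_itv.
rewrite [leLHS]integral_mkcond; apply: le_nnintegral => t _.
  by rewrite patchE; case: ifPn => //; rewrite inE/= in_itv/=; exact: F0.
have S0 : 0 <= \sum_(n <oo) w n * (\1_(B n) t)%:E.
  by apply: nneseries_ge0 => n _ _; rewrite mule_ge0// lee_fin.
rewrite patchE; case: ifPn => // ; rewrite inE/= in_itv/= => t01.
have [n tn] := exists_dyadic_scale t01.
apply: le_trans (nneseries_ge_term n _); last by move=> k; rewrite mule_ge0// lee_fin.
rewrite indicE mem_set ?mule1; first exact: Fw.
by rewrite /B/= in_itv/=.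
Qed.

End dyadic_integral.

Section mean_oscillation.
Local Open Scope ereal_scope.
Context {R : realType} {X : completeMetricType R}.
Variables (mu : {outer_measure set X -> \bar R}).
Hypotheses (mmsX : metric_measure_space mu).

Let mball x r : mu.-caratheodory (ball x r).
Proof. exact: superlevel_ball (mu_superlevel mmsX). Qed.

(** The mean value is within the average of [|f - c|] of the constant [c]. *)
Lemma mean_osc_le (f : X -> R) (c t : R) (x : X) :
  measurable_fun [set: caratheodory_type mu] (f : caratheodory_type mu -> R) ->
  (0 < t)%R ->
  mean_osc mu f t x <= 2%:E * avg mu (ball x t) (fun y => `|f y - c|%:E).
Proof.
move=> mf t0; have [a a0 aE] := mu_ballE mmsX x t0.
have mB : measurable (ball x t : set (caratheodory_type mu)) by exact: mball.
have mfc : measurable_fun (ball x t : set (caratheodory_type mu)) (fun y => (f y - c)%:E : \bar R).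
  apply/measurable_EFinP; apply: measurable_funB => //.
  exact: (measurable_funS measurableT).
set I := \int[cara_measure mu]_(y in ball x t) `|f y - c|%:E.
have I0 : 0 <= I by apply: integral_ge0 => y _; rewrite lee_fin.
have avgE : avg mu (ball x t) (fun y => `|f y - c|%:E) = (a^-1)%:E * I.
  by rewrite /avg aE inver gt_eqF.
(* a function that is not integrable on the ball makes the bound infinite *)
rewrite avgE; have [Ioo|] := ltP I +oo; last first.
  rewrite leye_eq => /eqP ->; rewrite gt0_muley ?lte_fin ?invr_gt0// gt0_muley ?leey//.
have intfc : (cara_measure mu).-integrable (ball x t) (fun y => (f y - c)%:E).
  by apply/integrableP; split.
have intc : (cara_measure mu).-integrable (ball x t) (cst c%:E).
  apply/integrableP; split; first exact: measurable_cst.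
  rewrite (eq_integral (cst `|c|%:E))// integral_cst//.
  by rewrite /cara_measure/= aE -EFinM ltry.
pose J := \int[cara_measure mu]_(y in ball x t) (f y - c)%:E.
have Jfin : J \is a fin_num by exact: integrable_fin_num.
have JI : `|J| <= I by exact: le_abse_integral.
have If : \int[cara_measure mu]_(y in ball x t) (f y)%:E = J + (c * a)%:E.
  have -> : (c * a)%:E = \int[cara_measure mu]_(y in ball x t) (cst c%:E) y.
    by rewrite integral_cst// /cara_measure/= aE.
  rewrite -integralD//; apply: eq_integral => y _ /=.
  by rewrite -EFinD subrK.
have avgf : avg mu (ball x t) (EFin \o f) = (c + a^-1 * fine J)%:E.
  rewrite /avg aE inver gt_eqF//= If -(fineK Jfin) -EFinD -EFinM; congr (_%:E).
  by field; rewrite gt_eqF.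
rewrite /mean_osc avgf.
have -> : 2%:E * ((a^-1)%:E * I) = (a^-1)%:E * (I + I).
  have Ifin : I \is a fin_num by rewrite ge0_fin_numE.
  by rewrite -(fineK Ifin) -EFinD -!EFinM; congr (_%:E); ring.
rewrite [leLHS]/avg aE inver gt_eqF//; apply: lee_wpmul2l; first by rewrite lee_fin invr_ge0 ltW.
apply: (@le_trans _ _ (\int[cara_measure mu]_(y in ball x t) (`|f y - c|%:E + (a^-1 * `|fine J|)%:E))).
  apply: le_nnintegral => y _; first exact: abse_ge0.
  rewrite -EFinB [`|_|]/= -EFinD lee_fin.
  have -> : (f y - (c + a^-1 * fine J) = (f y - c) - a^-1 * fine J)%R by ring.
  apply: le_trans (ler_normB _ _) _; rewrite lerD2l normrM ger0_norm// invr_ge0 ltW//.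
have mabs : measurable_fun (ball x t : set (caratheodory_type mu)) (fun y => `|f y - c|%:E : \bar R).
  by have := measurableT_comp (@abse_measurable R setT) mfc.
have cst0 y : ball x t y -> 0 <= (a^-1 * `|fine J|)%:E.
  by rewrite lee_fin mulr_ge0// invr_ge0 ltW.
have abs0 y : ball x t y -> 0 <= `|f y - c|%:E by rewrite lee_fin.
rewrite (ge0_integralD _ mB abs0 mabs cst0 (measurable_cst _)).
rewrite leeD2l//.
rewrite (integral_cst (cara_measure mu) mB) /cara_measure/= aE -EFinM mulrAC mulVf ?gt_eqF// mul1r.
by apply: le_trans JI; rewrite -[in leRHS](fineK Jfin).
Qed.

Lemma avg_nneseries (x : X) (t : R) (h : nat -> X -> R) : (0 < t)%R ->
  (forall k, measurable_fun [set: caratheodory_type mu] (h k : caratheodory_type mu -> R)) ->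
  (forall k y, (0 <= h k y)%R) ->
  avg mu (ball x t) (fun y => \sum_(k <oo) (h k y)%:E) =
  \sum_(k <oo) avg mu (ball x t) (fun y => (h k y)%:E).
Proof.
move=> t0 mh h0; rewrite /avg; have [a a0 ->] := mu_ballE mmsX x t0.
rewrite inver gt_eqF// integral_nneseries//; last 3 first.
- exact: mball.
- by move=> k; apply/measurable_EFinP; exact: (measurable_funS measurableT).
- by move=> k y _; rewrite lee_fin.
rewrite nneseriesZl// => k _; apply: integral_ge0 => y _; rewrite lee_fin//.
Qed.

Lemma avg_dist_le (f : X -> R) (c c' t : R) (x : X) :
  measurable_fun [set: caratheodory_type mu] (f : caratheodory_type mu -> R) ->
  (0 < t)%R ->
  avg mu (ball x t) (fun y => `|f y - c'|%:E) <=
  avg mu (ball x t) (fun y => `|f y - c|%:E) + `|c - c'|%:E.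
Proof.
move=> mf t0; have [a a0 aE] := mu_ballE mmsX x t0.
have mB : measurable (ball x t : set (caratheodory_type mu)) by exact: mball.
have abs0 y : ball x t y -> 0 <= `|f y - c|%:E by rewrite lee_fin.
have cst0 y : ball x t y -> 0 <= `|c - c'|%:E by rewrite lee_fin.
have mabs : measurable_fun (ball x t : set (caratheodory_type mu)) (fun y => `|f y - c|%:E : \bar R).
  apply/measurable_EFinP; apply: (measurable_funS measurableT) => //.
  by apply: measurableT_comp => //; exact: measurable_funB.
have -> : avg mu (ball x t) (fun y => `|f y - c|%:E) + `|c - c'|%:E =
    avg mu (ball x t) (fun y => `|f y - c|%:E + `|c - c'|%:E).
  rewrite /avg (ge0_integralD _ mB abs0 mabs cst0 (measurable_cst _)).
  rewrite (integral_cst (cara_measure mu) mB) {2}/cara_measure/= aE inver gt_eqF//.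
  have I0 : 0 <= \int[cara_measure mu]_(y in ball x t) `|f y - c|%:E by exact: integral_ge0.
  have J0 : 0 <= `|c - c'|%:E * a%:E by rewrite mule_ge0// lee_fin ltW.
  rewrite (ge0_muleDr _ I0 J0).
  by congr (_ + _); rewrite -!EFinM; congr (_%:E); field; rewrite gt_eqF.
apply: (le_avg mmsX) => // y _; rewrite -EFinD lee_fin.
have -> : (f y - c' = (f y - c) + (c - c'))%R by ring.
exact: ler_normD.
Qed.

End mean_oscillation.

Lemma cvg_at_right0_nneg (R : realType) (F : R -> \bar R) :
  (forall r, (0 < r)%R -> (0 <= F r)%E) ->
  (forall e : R, 0 < e -> exists2 d : R, 0 < d &
    forall r, 0 < r < d -> (F r <= e%:E)%E) ->
  F r @[r --> (0 : R)^'+] --> 0%E.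
Proof.
move=> F0 Fe.
have near_le (e : R) : 0 < e -> \forall r \near (0 : R)^'+, (0 <= F r <= e%:E)%E.
  move=> e0; have [d d0 Fd] := Fe e e0; near=> r.
  have r0 : 0 < r by near: r; exact: nbhs_right_gt.
  by rewrite F0//= Fd// r0/=; near: r; exact: nbhs_right_lt.
apply/fine_cvgP; split.
  near=> r; have /andP[r0 r1] : (0 <= F r <= 1%:E)%E by near: r; exact: near_le.
  by rewrite ge0_fin_numE// (le_lt_trans r1)// ltry.
apply/cvgrPdist_le => e e0; near=> r.
have /andP[r0 r1] : (0 <= F r <= e%:E)%E by near: r; exact: near_le.
have Ff : F r \is a fin_num by rewrite ge0_fin_numE// (le_lt_trans r1)// ltry.
by rewrite /= sub0r normrN ger0_norm ?fine_ge0// -lee_fin fineK.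
Unshelve. all: by end_near. Qed.

(** * Series of layer extensions *)

Section layered_sum.
Local Open Scope ereal_scope.
Context {R : realType} {X : completeMetricType R}.
Variables (mu : {outer_measure set X -> \bar R}) (theta p : R) (E : set X).
Hypotheses (mmsX : metric_measure_space mu) (theta0 : (0 < theta)%R)
  (p1 : (1 <= p)%R) (thetap : (theta < p)%R).
Variables (C S : R) (N_ d_ : nat -> R) (G_ f_ : nat -> X -> R).
Hypotheses (C0 : (0 <= C)%R) (N0 : forall k, (0 <= N_ k)%R) (d0 : forall k, (0 < d_ k)%R)
  (dcvg : forall e : R, (0 < e)%R -> exists n, forall k, (n <= k)%N -> (d_ k <= e)%R)
  (NdS : forall n, (\sum_(0 <= k < n) (N_ k + d_ k) <= S)%R)
  (ext : forall k, layer_extension mu theta p E C (N_ k) (d_ k) (G_ k) (f_ k)).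

Local Notation s := (theta / p)%R.

Definition layered_sum (x : X) : R := series_sum (fun k => f_ k x).

Let mf k : measurable_fun [set: caratheodory_type mu] (f_ k : caratheodory_type mu -> R).
Proof.
by apply: measurable_lipschitz; [exact: mu_superlevel|exact: layer_lipschitz (ext k)].
Qed.

Let p0 : (0 < p)%R. Proof. exact: lt_le_trans p1. Qed.

Lemma nneseries_le (a : nat -> R) (M : R) : (forall k, (0 <= a k)%R) ->
  (forall n, (\sum_(0 <= k < n) a k <= M)%R) -> \sum_(k <oo) (a k)%:E <= M%:E.
Proof.
move=> a0 aM; apply: lime_le; first by apply: is_cvg_nneseries => *; rewrite lee_fin.
by apply: nearW => n; rewrite sumEFin lee_fin.
Qed.

Lemma measurable_layered_sum :
  measurable_fun [set: caratheodory_type mu] (layered_sum : caratheodory_type mu -> R).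
Proof.
have part (g : nat -> X -> R) : (forall k,
    measurable_fun [set: caratheodory_type mu] (g k : caratheodory_type mu -> R)) ->
    measurable_fun [set: caratheodory_type mu]
      (fun x => fine (\sum_(k <oo) (Num.max (g k x) 0)%:E)).
  move=> mg.
  have mS : measurable_fun [set: caratheodory_type mu]
      (fun x => \sum_(k <oo) (Num.max (g k x) 0)%:E : \bar R).
    apply: ge0_emeasurable_sum => [k x _ _|k _]; first by rewrite lee_fin le_max lexx orbT.
    by apply/measurable_EFinP; exact: measurable_maxr.
  exact: (measurableT_comp (fine_measurable measurableT) mS).
apply: measurable_funB; first exact: part.
apply: (part (fun k x => - f_ k x)%R) => k.
exact: measurableT_comp.
Qed.

Lemma layered_sum_le x : `|(layered_sum x)%:E| <= \sum_(k <oo) `|f_ k x|%:E.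
Proof.
have := @series_sum_dist _ (fun k => f_ k x) (fun=> 0%R) 0%N (fun _ _ => erefl).
rewrite big_geq// subr0; under eq_eseriesr do rewrite subr0.
exact.
Qed.

Lemma Lnorm_layered_sum : 'N[cara_measure mu]_p%:E[EFin \o layered_sum] <= (C * S)%:E.
Proof.
apply: (@le_trans _ _ 'N[cara_measure mu]_p%:E[(fun x => \sum_(k <oo) `|f_ k x|%:E)]).
  apply: le_Lnorm => // x; apply: le_trans (layered_sum_le x) _.
  by rewrite gee0_abs// nneseries_ge0// => *; rewrite lee_fin.
apply: le_trans (@Lnorm_nneseries _ _ _ (cara_measure mu) p (fun k x => `|f_ k x|%R) p1 _ _) _ => //.
  by move=> k; exact: measurableT_comp.
apply: (@le_trans _ _ (\sum_(k <oo) (C * (N_ k + d_ k))%:E)).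
  apply: lee_nneseries => [k _ _|k _]; first exact: Lnorm_ge0.
  apply: le_trans (layer_Lp (ext k)); apply: le_Lnorm => // x /=.
  by rewrite normr_id.
apply: nneseries_le => [k|n]; first by rewrite mulr_ge0// addr_ge0// ltW.
by rewrite -mulr_sumr ler_wpM2l.
Qed.

Lemma avg_layered_sum_le (x : X) (t : R) (c : nat -> R) n : (0 < t)%R ->
  (forall k, (n <= k)%N -> c k = 0%R) ->
  avg mu (ball x t) (fun y => `|layered_sum y - \sum_(0 <= k < n) c k|%:E) <=
  \sum_(k <oo) avg mu (ball x t) (fun y => `|f_ k y - c k|%:E).
Proof.
move=> t0 cn; rewrite -(@avg_nneseries _ _ _ mmsX x t (fun k y => `|f_ k y - c k|%R))//.
  by apply: le_avg => // y _; exact: series_sum_dist.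
move=> k; apply: measurableT_comp => //; exact: measurable_funB.
Qed.

(** The sum of the constants of all terms, finite in number at a given scale, is a
    constant for the series; countable Minkowski then adds up the norms. *)
Lemma Lnorm_mean_osc_layered_sum (b : nat -> nat -> R) :
  (forall k, oscillation_bounds mu p (d_ k) (b k) (f_ k)) ->
  forall n t, (2^-1 ^+ n.+1 <= t < 2^-1 ^+ n)%R ->
  'N[cara_measure mu]_p%:E[mean_osc mu layered_sum t] <= \sum_(k <oo) (2 * b k n)%:E.
Proof.
move=> H n t tn; have /andP[t1 _] := tn.
have t0 : (0 < t)%R by apply: lt_le_trans t1; rewrite exprn_gt0// invr_gt0.
have /choice[c Hc] := fun k => H k n t tn.
have /choice[h Hh] := Hc.
have [n1 dn1] := dcvg t0.
have mh k : measurable_fun [set: caratheodory_type mu] (h k : caratheodory_type mu -> R).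
  by have [] := Hh k.
have h0 k x : (0 <= h k x)%R by have [] := Hh k.
apply: (@le_trans _ _ 'N[cara_measure mu]_p%:E[(fun x => \sum_(k <oo) (2 * h k x)%:E)]).
  apply: le_Lnorm => // x; rewrite !gee0_abs; last 2 first.
  - by apply: nneseries_ge0 => k _ _; rewrite lee_fin mulr_ge0.
  - by apply: (avg_ge0 mmsX) => // y _; exact: abse_ge0.
  apply: le_trans (mean_osc_le mmsX (\sum_(0 <= k < n1) c k x)%R x measurable_layered_sum t0) _.
  under eq_eseriesr do rewrite EFinM.
  rewrite nneseriesZl; last by move=> k _; rewrite lee_fin.
  apply: lee_wpmul2l; first by rewrite lee_fin.
  apply: le_trans (@avg_layered_sum_le x t (fun k => c k x) n1 t0 _) _.
    by move=> k n1k; have [_ _ _ _] := Hh k; apply; exact: dn1.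
  apply: lee_nneseries => [k _ _|k _]; last by have [_ _ + _ _] := Hh k; apply.
  by apply: (avg_ge0 mmsX) => // y _; rewrite lee_fin.
apply: le_trans (@Lnorm_nneseries _ _ _ (cara_measure mu) p (fun k x => 2 * h k x)%R p1 _ _) _.
- by move=> k; apply: measurable_funM.
- by move=> k x; rewrite mulr_ge0.
apply: lee_nneseries => [k _ _|k _]; first exact: Lnorm_ge0.
rewrite (@Lnorm_scale _ _ _ (cara_measure mu) p 2%R (h k))//.
by rewrite EFinM; apply: lee_wpmul2l; [rewrite lee_fin|have [] := Hh k].
Qed.

(** The factor 4 is a 2 from replacing mean values by constants and a 2 from comparing
    [t ^ (- s)] over a dyadic interval with its value at the upper endpoint. *)
Lemma besov_layered_sum : besov_seminorm mu s p layered_sum <= (4 * (C * S))%:E.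
Proof.
have s0 : (0 < s)%R by rewrite divr_gt0.
have s1 : (s < 1)%R by rewrite ltr_pdivrMr// mul1r.
have /choice[b Hb] : forall k, exists b : nat -> R,
    (forall n, \sum_(0 <= j < n) ((2^-1 ^+ j) `^ (- s) * b j) <= C * (N_ k + d_ k))%R /\
    oscillation_bounds mu p (d_ k) b (f_ k).
  by move=> k; have [b b1 b2] := layer_besov (ext k); exists b; split.
pose a n : R := (2^-1 ^+ n)%R.
have a0 n : (0 < a n)%R by rewrite exprn_gt0// invr_gt0.
have b0 k n : (0 <= b k n)%R.
  have [_ /(_ n (a n.+1))] := Hb k.
  have aa : (2^-1 ^+ n.+1 <= a n.+1 < 2^-1 ^+ n)%R.
    by rewrite lexx/= /a exprS gtr_pMl ?a0// invf_lt1// ltr1n.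
  move=> /(_ aa)[c [h [_ _ _ hb _]]].
  by rewrite -lee_fin; apply: le_trans hb; exact: Lnorm_ge0.
pose B n : \bar R := \sum_(k <oo) (2 * b k n)%:E.
have B0 n : 0 <= B n by apply: nneseries_ge0 => k _ _; rewrite lee_fin mulr_ge0.
have osc := Lnorm_mean_osc_layered_sum (fun k => (Hb k).2).
pose w n : \bar R := (a n.+1 `^ (- s))%:E * B n * ((a n.+1)^-1)%:E.
have w0 n : 0 <= w n.
  by rewrite /w !mule_ge0// lee_fin ?powR_ge0// invr_ge0 ltW.
apply: le_trans (@dyadic_integral_le _ _ w _ w0 _) _.
- move=> t /andP[t0 _]; rewrite !mule_ge0 ?Lnorm_ge0// lee_fin ?powR_ge0//.
  by rewrite invr_ge0 ltW.
- move=> n t tn; have /andP[t1 _] := tn.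
  have t0 : (0 < t)%R by apply: lt_le_trans t1.
  apply: lee_pmul.
  + by rewrite mule_ge0 ?Lnorm_ge0// lee_fin powR_ge0.
  + by rewrite lee_fin invr_ge0 ltW.
  + apply: lee_pmul; rewrite ?Lnorm_ge0 ?lee_fin ?powR_ge0//; last exact: osc.
    rewrite !powRN lef_pV2 ?posrE ?powR_gt0//.
    by apply: ge0_ler_powR; rewrite ?nnegrE ?(ltW s0) ?(ltW t0)// ltW.
  + by rewrite lee_fin lef_pV2 ?posrE.
apply: (@le_trans _ _ (\sum_(n <oo) \sum_(k <oo) (4 * (a n `^ (- s) * b k n))%:E)).
  apply: lee_nneseries => [n _ _|n _].
    by rewrite mule_ge0// lee_fin ltW// exprn_gt0 ?invr_gt0.
  rewrite /w -muleA -EFinM mulVf ?gt_eqF// mule1 /B -nneseriesZl; last first.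
    by move=> k _; rewrite lee_fin mulr_ge0.
  apply: lee_nneseries => [k _ _|k _].
    by rewrite -EFinM lee_fin !mulr_ge0 ?powR_ge0.
  rewrite -EFinM lee_fin mulrCA (_ : 4 * _ = 2 * (2 * a n `^ (- s) * b k n))%R; last by ring.
  rewrite ler_pM2l// ler_wpM2r//.
  rewrite /a exprS !powRN powRM ?invr_ge0 ?exprn_ge0 ?invr_ge0// invfM ler_wpM2r ?invr_ge0 ?powR_ge0//.
  rewrite -powRN -powR_inv1// -powRrM mulN1r opprK.
  apply: le_trans (_ : 2 `^ 1 <= _)%R; last by rewrite powRr1.
  by apply: ler_powR; [rewrite ler1n|exact: ltW].
(* summing over the scales first uses the bound of each layer *)
rewrite (nneseries_interchange xpredT xpredT); last first.
  by move=> n k; rewrite lee_fin !mulr_ge0 ?powR_ge0.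
apply: (@le_trans _ _ (\sum_(k <oo) (4 * (C * (N_ k + d_ k)))%:E)).
  apply: lee_nneseries => [k _ _|k _].
    by apply: nneseries_ge0 => n _ _; rewrite lee_fin !mulr_ge0 ?powR_ge0.
  apply: nneseries_le => [n|n]; first by rewrite !mulr_ge0 ?powR_ge0.
  by rewrite -mulr_sumr ler_pM2l//; have [+ _] := Hb k; exact.
apply: nneseries_le => [k|n]; first by rewrite !mulr_ge0// addr_ge0// ltW.
by rewrite -!mulr_sumr ler_pM2l// ler_wpM2l.
Qed.

(** Split the series at [n].  The terms below [n] are Lipschitz with values [G_ k x]
    at [x]; the averages of the k-th term above [n] are at most [|G_ k x| + d_ k], and
    [|G_ k x| <= u k + u k.+1] by the triangle inequality.  So for a large [n] and then
    a small radius there remain five quantities of size at most [e / 5]: [u n], the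
    oscillation of the first terms, and the tails of the sums of [u k], [u k.+1] and
    [d_ k]. *)
Lemma trace_layered_sum (x : X) (phix : R) : E x ->
  \sum_(k <oo) `|phix - \sum_(0 <= j < k) G_ j x|%:E < +oo ->
  avg mu (ball x r) (fun y => `|layered_sum y - phix|%:E) @[r --> (0%R : R)^'+] --> 0.
Proof.
move=> Ex; set u := fun k : nat => `|phix - \sum_(0 <= j < k) G_ j x|%R => uoo.
apply: cvg_at_right0_nneg => [r r0|e e0].
  by apply: (avg_ge0 mmsX) => // y _; rewrite lee_fin.
have doo : \sum_(k <oo) (d_ k)%:E < +oo.
  apply: (@le_lt_trans _ _ S%:E); last exact: ltry.
  apply: nneseries_le => [k|n]; first exact: ltW.
  by apply: le_trans (NdS n); apply: ler_sum => k _; rewrite lerDr.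
have e5 : (0 < e / 5)%R by rewrite divr_gt0.
have tail (v : nat -> R) : (forall k, (0 <= v k)%R) -> \sum_(k <oo) (v k)%:E < +oo ->
    exists n0, forall n, (n0 <= n)%N -> \sum_(n <= k <oo) (v k)%:E <= (e / 5)%:E.
  move=> v0 voo; have := nneseries_tail_cvg voo (fun k _ => v0 k).
  move=> /fine_cvgP[[n1 _ fin1] /cvgrPdist_lt/(_ _ e5)[n2 _ lt2]].
  exists (maxn n1 n2) => n; rewrite geq_max => /andP[n1n n2n].
  rewrite -[leLHS]fineK; last exact: fin1.
  have := lt2 _ n2n; rewrite /= sub0r normrN => lt.
  by rewrite lee_fin; apply: le_trans (ler_norm _) (ltW lt).
have u0 k : (0 <= u k)%R by exact: normr_ge0.
have [n1 un1] := tail u u0 uoo.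
have [n2 dn2] := tail d_ (fun k => ltW (d0 k)) doo.
pose n := maxn n1 n2.
have un : \sum_(n <= k <oo) (u k)%:E <= (e / 5)%:E by apply: un1; exact: leq_maxl.
have un' : \sum_(n <= k <oo) (u k.+1)%:E <= (e / 5)%:E.
  apply: le_trans un; rewrite -[leLHS]nneseries_addn; last by move=> k; rewrite lee_fin.
  rewrite [leRHS](nneseries_split n 1) ?addn1; last by move=> k _; rewrite lee_fin.
  rewrite -[X in _ <= _ + X]nneseries_addn; last by move=> k; rewrite lee_fin.
  under [X in _ <= _ + X]eq_eseriesr do rewrite addnS.
  by rewrite leeDr// sume_ge0// => k _; rewrite lee_fin.
have dn : \sum_(n <= k <oo) (d_ k)%:E <= (e / 5)%:E by apply: dn2; exact: leq_maxr.
have unn : (u n)%:E <= (e / 5)%:E.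
  apply: le_trans un; rewrite (nneseries_split n 1) ?addn1; last by move=> k _; rewrite lee_fin.
  by rewrite big_nat1 leeDl// nneseries_ge0// => *; rewrite lee_fin.
have /choice[L fL] : forall k, exists L : R, forall y z, (`|f_ k y - f_ k z| <= L * mdist y z)%R.
  by move=> k; exact: (layer_lipschitz (ext k)).
pose Ls : R := (\sum_(0 <= k < n) `|L k|)%R.
have Ls0 : (0 <= Ls)%R by apply: sumr_ge0.
exists (Num.min 1 (e / 5 / (Ls + 1)))%R.
  by rewrite lt_min ltr01 divr_gt0// ltr_wpDl.
move=> r /andP[r0]; rewrite lt_min => /andP[r1 rL].
pose c k : R := if (k < n)%N then f_ k x else 0%R.
have cn k : (n <= k)%N -> c k = 0%R by rewrite /c ltnNge => ->.
apply: le_trans (avg_dist_le mmsX (\sum_(0 <= k < n) c k)%R phix x measurable_layered_sum r0) _.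
have -> : (`|\sum_(0 <= k < n) c k - phix| = u n)%R.
  rewrite distrC /u; congr (`|_ - _|)%R.
  rewrite big_nat [RHS]big_nat; apply: eq_bigr => k /andP[_ kn].
  by rewrite /c kn; exact: layer_trace (ext k) x Ex.
have -> : e%:E = (e / 5)%:E + (e / 5 + e / 5 + e / 5)%:E + (e / 5)%:E.
  by rewrite -!EFinD; congr (_%:E); field.
apply: leeD; last exact: unn.
apply: le_trans (avg_layered_sum_le x r0 cn) _.
rewrite (nneseries_split 0 n) ?add0n; last first.
  by move=> k _; apply: (avg_ge0 mmsX) => // y _; rewrite lee_fin.
apply: leeD.
  apply: (@le_trans _ _ (\sum_(0 <= k < n) (`|L k| * r)%:E)).
    rewrite big_nat [leRHS]big_nat; apply: lee_sum => k /andP[_ kn].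
    apply: (avg_le mmsX) => //; first by rewrite mulr_ge0// ltW.
    move=> y; rewrite ballEmdist/= lee_fin /c kn => xy; apply: le_trans (fL k y x) _.
    apply: (@le_trans _ _ (`|L k| * mdist y x)%R).
      by rewrite ler_wpM2r ?mdist_ge0// ler_norm.
    by rewrite ler_wpM2l// metric_sym ltW.
  rewrite sumEFin lee_fin -mulr_suml -/Ls.
  apply: (@le_trans _ _ ((Ls + 1) * r)%R); first by rewrite ler_wpM2r ?(ltW r0)// lerDl.
  by rewrite mulrC -ler_pdivlMr ?ltW// ltr_wpDl.
apply: (@le_trans _ _ (\sum_(n <= k <oo) (u k + u k.+1 + d_ k)%:E)).
  rewrite -[leLHS]nneseries_addn; last first.
    by move=> k; apply: (avg_ge0 mmsX) => // y _; rewrite lee_fin.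
  rewrite -[leRHS]nneseries_addn; last first.
    by move=> k; rewrite lee_fin !addr_ge0// ltW.
  apply: lee_nneseries => [k _ _|k _].
    by apply: (avg_ge0 mmsX) => // y _; rewrite lee_fin.
  rewrite cn ?leq_addl//; under eq_fun do rewrite subr0.
  apply: le_trans (layer_averages (ext (k + n)%N) Ex _) _; first by rewrite r0.
  rewrite lee_fin lerD2r /u big_nat_recr//=.
  set a := (\sum_(0 <= j < _) _)%R; set g := G_ _ x.
  have gE : g = ((phix - a) - (phix - (a + g)))%R by ring.
  by rewrite [in leLHS]gE ler_normB.
have -> : \sum_(n <= k <oo) (u k + u k.+1 + d_ k)%:E =
    \sum_(n <= k <oo) (u k)%:E + \sum_(n <= k <oo) (u k.+1)%:E + \sum_(n <= k <oo) (d_ k)%:E.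
  rewrite -nneseriesD//; try by move=> k _ _; rewrite lee_fin.
  rewrite -nneseriesD//; try by move=> k _ _; rewrite lee_fin ?addr_ge0// ltW.
by rewrite !EFinD !leeD.
Qed.

End layered_sum.

(** * Almost everywhere classes *)

Section lebesgue_classes.
Local Open Scope ereal_scope.
Local Open Scope quotient_scope.
Context d (T : measurableType d) (R : realType) (m : {measure set T -> \bar R}).

Lemma ae_imply (P Q : T -> Prop) : (forall x, P x -> Q x) ->
  {ae m, forall x, P x} -> {ae m, forall x, Q x}.
Proof. by move=> PQ; apply: filterS => x; exact: PQ. Qed.

Lemma exists_ae_representative (f : T -> R) : measurable_fun setT f ->
  exists q : {mfun_ m, T >-> measurableTypeR R}, f = (q : T -> R) %[ae m].
Proof.
move=> mf; have fP : (f : T -> measurableTypeR R) \in (mfun : {pred T -> measurableTypeR R}).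
  by rewrite inE.
pose g : {mfun T >-> measurableTypeR R} := mfun_Sub fP.
exists (\pi_({mfun_ m, T >-> measurableTypeR R}) g).
apply/asboolP.
have : (g == repr (\pi_({mfun_ m, T >-> measurableTypeR R}) g) %[mod {mfun_ m, T >-> measurableTypeR R}]).
  by rewrite reprK.
by rewrite eqmodE.
Qed.

Lemma ae_eq_class (q1 q2 : {mfun_ m, T >-> measurableTypeR R}) :
  (q1 : T -> R) = q2 %[ae m] -> q1 = q2.
Proof.
move=> q12; rewrite -[LHS]reprK -[RHS]reprK; apply/eqP.
by rewrite eqmodE; apply/asboolP.
Qed.

Lemma measurable_class (q : {mfun_ m, T >-> measurableTypeR R}) :
  measurable_fun setT (q : T -> R).
Proof. exact: (@measurable_funPT _ _ _ _ (repr q)). Qed.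

Lemma ae_eq_Lnorm (p : R) (f g : T -> R) : measurable_fun setT f -> measurable_fun setT g ->
  f = g %[ae m] -> 'N[m]_p%:E[EFin \o f] = 'N[m]_p%:E[EFin \o g].
Proof.
have mpow (h : T -> R) : measurable_fun setT h ->
    measurable_fun setT (fun x => `|(h x)%:E| `^ p : \bar R).
  move=> mh; have mah : measurable_fun setT (fun x => `|(h x)%:E| : \bar R).
    by apply: measurableT_comp => //; exact/measurable_EFinP.
  exact: (measurableT_comp (measurable_poweR p) mah).
move=> mf mg fg; rewrite unlock /Lnorm; congr (_ `^ _).
apply: ae_eq_integral => //; [exact: mpow|exact: mpow|].
by apply: filterS fg => x fg _ /=; rewrite fg.
Qed.

Lemma exists_Lspace (p : \bar R) (p1 : 1 <= p) (q : {mfun_ m, T >-> measurableTypeR R}) :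
  finite_norm m p q -> exists F : LspaceType m p1, (F : T -> R) = q.
Proof.
move=> qfin; pose F : LspaceType m p1 := HB.pack q (isFinLebesgue.Build d T R m p p1 q qfin).
by exists F.
Qed.

End lebesgue_classes.

Section ae_invariance.
Local Open Scope ereal_scope.
Context {R : realType} {X : completeMetricType R}.
Variables (mu : {outer_measure set X -> \bar R}).
Hypotheses (mmsX : metric_measure_space mu).

Lemma ae_eq_avg (x : X) (r : R) (u v : X -> \bar R) :
  measurable_fun [set: caratheodory_type mu] (u : caratheodory_type mu -> \bar R) ->
  measurable_fun [set: caratheodory_type mu] (v : caratheodory_type mu -> \bar R) ->
  (u : caratheodory_type mu -> \bar R) = v %[ae cara_measure mu] ->
  avg mu (ball x r) u = avg mu (ball x r) v.
Proof.
move=> mu_ mv uv; rewrite /avg; congr (_ * _).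
have mB : measurable (ball x r : set (caratheodory_type mu)).
  exact: superlevel_ball (mu_superlevel mmsX).
apply: ae_eq_integral => //.
- exact: (measurable_funS measurableT).
- exact: (measurable_funS measurableT).
- by apply: filterS uv => y uv _; exact: uv.
Qed.

Variables (f g : X -> R).
Hypotheses (mf : measurable_fun [set: caratheodory_type mu] (f : caratheodory_type mu -> R))
  (mg : measurable_fun [set: caratheodory_type mu] (g : caratheodory_type mu -> R))
  (fg : (f : caratheodory_type mu -> R) = g %[ae cara_measure mu]).

Lemma ae_eq_avg_dist (x : X) (r c : R) :
  avg mu (ball x r) (fun y => `|f y - c|%:E) = avg mu (ball x r) (fun y => `|g y - c|%:E).
Proof.
apply: ae_eq_avg.
- by apply/measurable_EFinP; apply: measurableT_comp => //; exact: measurable_funB.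
- by apply/measurable_EFinP; apply: measurableT_comp => //; exact: measurable_funB.
- by apply: filterS fg => y + _ => ->.
Qed.

Lemma ae_eq_mean_osc (t : R) : mean_osc mu f t = mean_osc mu g t.
Proof.
apply/funext => x; rewrite /mean_osc.
have -> : avg mu (ball x t) (EFin \o f) = avg mu (ball x t) (EFin \o g).
  apply: ae_eq_avg; [exact/measurable_EFinP|exact/measurable_EFinP|].
  by apply: filterS fg => y + _ /= => ->.
set c := avg mu (ball x t) (EFin \o g); have mc (h : X -> R) :
    measurable_fun [set: caratheodory_type mu] (h : caratheodory_type mu -> R) ->
    measurable_fun [set: caratheodory_type mu] (fun y => `|(h y)%:E - c| : \bar R).
  move=> mh; have mhE : measurable_fun [set: caratheodory_type mu] (fun y => (h y)%:E : \bar R).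
    exact/measurable_EFinP.
  have mhc := emeasurable_funB mhE (measurable_cst c).
  by have := measurableT_comp (@abse_measurable R setT) mhc.
apply: ae_eq_avg; [exact: mc|exact: mc|].
by apply: filterS fg => y + _ => ->.
Qed.

End ae_invariance.

(** * Existence of an extension of an L_p function *)

Section extension.
Local Open Scope ereal_scope.
Context {R : realType} {X : completeMetricType R}.
Variables (mu : {outer_measure set X -> \bar R}) (theta p : R) (E : set X).
Hypotheses (mmsX : metric_measure_space mu)
  (dblX : uniformly_locally_doubling mu) (theta0 : (0 < theta)%R)
  (ADE : ahlfors_david_regular mu theta E)
  (p1 : (1 <= p)%R) (thetap : (theta < p)%R).

Local Notation nu := (outer_restr (codim_hausdorff mu theta) E
  : {outer_measure set X -> \bar R}).
Local Notation s := (theta / p)%R.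

Definition extends (K : R) (phi f : X -> R) : Prop := [/\
  measurable_fun [set: caratheodory_type mu] (f : caratheodory_type mu -> R),
  'N[cara_measure mu]_p%:E[EFin \o f] <= K%:E * 'N[cara_measure nu]_p%:E[EFin \o phi],
  besov_seminorm mu s p f <= K%:E * 'N[cara_measure nu]_p%:E[EFin \o phi] &
  is_trace mu nu E f phi].

Let p0 : (0 < p)%R. Proof. exact: lt_le_trans p1. Qed.

(** Disposes of an empty [E] and of functions [phi] of norm 0; in the latter case
    positive errors proportional to the norm do not exist. *)
Lemma extends_zero (K : R) (phi : X -> R) : (0 <= K)%R ->
  {ae cara_measure nu, forall x, E x -> phi x = 0%R} -> extends K phi (cst 0%R).
Proof.
move=> K0 phi0.
have KN : 0 <= K%:E * 'N[cara_measure nu]_p%:E[EFin \o phi].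
  by rewrite mule_ge0 ?Lnorm_ge0// lee_fin.
have avg0 (c : \bar R) x t : c = 0 -> avg mu (ball x t) (fun=> c) = 0.
  by move=> ->; rewrite /avg integral0 mule0.
have pE : p%:E != 0 by rewrite eqe gt_eqF.
split.
- exact: measurable_cst.
- have -> : EFin \o cst 0%R = cst 0 :> (X -> \bar R) by [].
  by rewrite Lnorm0.
- rewrite /besov_seminorm; under eq_integral => t _.
    have -> : mean_osc mu (cst 0%R) t = cst 0.
      apply/funext => x; rewrite /mean_osc.
      rewrite (_ : avg mu (ball x t) (EFin \o cst 0%R) = 0); last exact: (avg0 0).
      by apply: (avg0 `|0%:E - 0|); rewrite sube0 abse0.
    rewrite Lnorm0// mule0 mul0e; over.
  by rewrite integral0.
- apply: ae_imply phi0 => x phix Ex; rewrite phix//.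
  apply: cvg_near_cst; apply: nearW => r.
  by apply: (avg0 `|0 - 0 : R|%:E); rewrite subrr normr0.
Qed.

(** The choice [g 0 = 0] makes the partial sums of the differences [G k] equal to
    [g k].  Their norms decay geometrically, and so do the errors [d_ k], which are
    proportional to the norm [P] of [phi] and also tend to 0 independently of it. *)
Lemma exists_extends : exists2 K : R, (0 < K)%R & forall phi : X -> R,
  measurable_fun [set: caratheodory_type nu] (phi : caratheodory_type nu -> R) ->
  'N[cara_measure nu]_p%:E[EFin \o phi] < +oo -> exists f, extends K phi f.
Proof.
have [E0|/set0P En0] := eqVneq E set0.
  exists 1%R => // phi _ _; exists (cst 0%R); apply: extends_zero => //.
  by apply: aeW => x; rewrite E0.
have [C C0 HC] := exists_layer_extension mmsX dblX theta0 ADE En0 p1 thetap.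
(* [24 = 4 * 6]: the sum of all [N_ k + d_ k] is at most [6 * P], and the seminorm of
   the series costs another factor 4 *)
exists (24 * C)%R; first by rewrite mulr_gt0.
move=> phi mphi phioo.
have [N0|N0] := eqVneq 'N[cara_measure nu]_p%:E[EFin \o phi] 0.
  exists (cst 0%R); apply: extends_zero; first by rewrite mulr_ge0// ltW.
  have mE : measurable_fun [set: caratheodory_type nu] (EFin \o phi) by exact/measurable_EFinP.
  have := Lnorm_eq0_eq0 mE _ N0; rewrite lte_fin => /(_ p0).
  by apply: ae_imply => x /(_ Logic.I)[].
pose P : R := fine 'N[cara_measure nu]_p%:E[EFin \o phi].
have PE : 'N[cara_measure nu]_p%:E[EFin \o phi] = P%:E.
  by rewrite fineK// ge0_fin_numE// Lnorm_ge0.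
have P0 : (0 < P)%R by rewrite -lte_fin -PE lt0e N0 Lnorm_ge0.
have nufin := nu_ball_fin mmsX dblX theta0 ADE En0.
have approx := Lp_approximable p1 (nu_superlevel mu theta E) nufin
  (nu_outer_regular nufin) mphi phioo.
pose a k : R := (2^-1 ^+ k)%R.
have a0 k : (0 < a k)%R by rewrite exprn_gt0// invr_gt0.
have /choice[g Hg] : forall k, exists g : X -> R, [/\ test_function g,
    'N[cara_measure nu]_p%:E[EFin \o (phi \- g)%R] <= (a k * P)%:E & k = 0%N -> g = cst 0%R].
  move=> [|k].
    exists (cst 0%R); split => //.
      split; [exists 0%R|exists 0%R|exists point, 0%R] => x; rewrite /= ?normr0 ?eqxx//.
      by move=> y; rewrite subrr normr0 mul0r.
    rewrite /a expr0 mul1r -PE (_ : EFin \o (phi \- cst 0)%R = EFin \o phi)//.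
    by apply/funext => x /=; rewrite subr0.
  have [|h th hP] := approx.2 (a k.+1 * P)%R; first by rewrite mulr_gt0.
  by exists h; split.
have tg k : test_function (g k) by have [] := Hg k.
have mg k : measurable_fun [set: caratheodory_type nu] (g k : caratheodory_type nu -> R).
  exact (test_function_measurable (nu_superlevel mu theta E) (tg k)).
pose G k x : R := (g k.+1 x + -1 * g k x)%R.
have sumG k x : (\sum_(0 <= j < k) G j x = g k x)%R.
  elim: k => [|k ih]; first by have [_ _ ->//] := Hg 0%N; rewrite big_geq.
  by rewrite big_nat_recr//= ih /G; ring.
have tG k : test_function (G k) by apply: test_functionD => //; exact: test_functionZ.
pose N_ k : R := (2 * (a k * P))%R.
have GN k : 'N[cara_measure nu]_p%:E[EFin \o G k] <= (N_ k)%:E.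
  have -> : 'N[cara_measure nu]_p%:E[EFin \o G k] =
      'N[cara_measure nu]_p%:E[EFin \o ((phi \- g k) \+ (g k.+1 \- phi))%R].
    by congr (Lnorm _ _ _); apply/funext => x /=; congr (_%:E); rewrite /G; ring.
  apply: le_trans (minkowski_EFin _ _ _ p1) _; [exact: measurable_funB|exact: measurable_funB|].
  rewrite /N_ mulr_natl mulr2n EFinD; apply: leeD; first by have [] := Hg k.
  apply: (@le_trans _ _ (a k.+1 * P)%:E).
    have [_ + _] := Hg k.+1; apply: le_trans; apply: le_Lnorm => // x /=.
    by rewrite distrC.
  by rewrite lee_fin ler_pM2r// /a exprS ler_piMl ?(ltW (a0 k))// invf_le1 ?ler1n.
(* the factor [P] keeps the final bound proportional to the norm of [phi] *)
pose d_ k : R := (a k * Num.min 1 P)%R.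
have m0 : (0 < Num.min 1 P)%R by rewrite lt_min ltr01.
have d0 k : (0 < d_ k)%R by rewrite mulr_gt0.
have /choice[f_ Hf] : forall k, exists f, layer_extension mu theta p E C (N_ k) (d_ k) (G k) f.
  by move=> k; have [L M K] := tG k; exact (HC _ _ _ L M K (GN k) (d0 k)).
have dcvg (e : R) : (0 < e)%R -> exists n, forall k, (n <= k)%N -> (d_ k <= e)%R.
  move=> e0; have [n an] := exists_pow_half e0; exists n => k nk.
  apply: (@le_trans _ _ (a k)); first by rewrite ler_piMr ?(ltW (a0 k))// ge_min lexx.
  apply: le_trans an; by apply: ler_wiXn2l => //; rewrite invf_le1 ?ler1n.
have N_0 k : (0 <= N_ k)%R by rewrite !mulr_ge0 ?(ltW (a0 k)) ?(ltW P0).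
have NdS n : (\sum_(0 <= k < n) (N_ k + d_ k) <= 6 * P)%R.
  apply: (@le_trans _ _ (\sum_(0 <= k < n) 6 * P * a k.+1)%R).
    apply: ler_sum => k _; rewrite /N_ /d_.
    have -> : (6 * P * a k.+1 = 2 * (a k * P) + a k * P)%R by rewrite /a exprS; field.
    by rewrite lerD2l ler_pM2l// ge_min lexx orbT.
  by rewrite -mulr_sumr ler_piMr ?mulr_ge0 ?(ltW P0)//; exact: half_pow_sum.
have C0' := ltW C0.
exists (layered_sum f_); split.
- exact: (measurable_layered_sum mmsX Hf).
- apply: le_trans (Lnorm_layered_sum mmsX p1 C0' N_0 d0 NdS Hf) _.
  rewrite PE -EFinM lee_fin (_ : 24 * C * P = 4 * (C * (6 * P)))%R; last by ring.
  by rewrite ler_peMl ?mulr_ge0 ?(ltW P0)// ler1n.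
- apply: le_trans (besov_layered_sum mmsX theta0 p1 thetap C0' N_0 d0 dcvg NdS Hf) _.
  by rewrite PE -EFinM lee_fin (_ : 24 * C * P = 4 * (C * (6 * P)))%R//; ring.
- pose h k (x : caratheodory_type nu) : R := `|phi x - g k x|%R.
  have mh k : measurable_fun [set: caratheodory_type nu] (h k).
    exact (measurableT_comp (@normr_measurable R setT) (measurable_funB mphi (mg k))).
  have h0 k x : (0 <= h k x)%R := normr_ge0 _.
  have hfin : \sum_(k <oo) 'N[cara_measure nu]_p%:E[EFin \o h k] < +oo.
    apply: (@le_lt_trans _ _ (2 * P)%:E); last exact: ltry.
    apply: (@le_trans _ _ (\sum_(k <oo) (2 * P * a k.+1)%:E)).
      apply: lee_nneseries => [k _ _|k _]; first exact: Lnorm_ge0.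
      have -> : (2 * P * a k.+1 = a k * P)%R by rewrite /a exprS; field.
      have [_ + _] := Hg k; apply: le_trans; apply: le_Lnorm => // x /=.
      by rewrite normr_id.
    apply: nneseries_le => [k|n]; first by rewrite !mulr_ge0 ?(ltW P0) ?(ltW (a0 _)).
    by rewrite -mulr_sumr ler_piMr ?mulr_ge0 ?(ltW P0)//; exact: half_pow_sum.
  have := ae_nneseries_lty p1 mh h0 hfin.
  apply: ae_imply => x phix Ex.
  refine (trace_layered_sum mmsX N_0 d0 NdS Hf Ex _).
  by under eq_eseriesr do rewrite sumG.
Qed.

End extension.

(** * Uniqueness of the trace and the extension operator *)

Lemma ae_imply2 d (T : measurableType d) (R : realType) (m : {measure set T -> \bar R})
    (P Q S : T -> Prop) : (forall x, P x -> Q x -> S x) ->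
  {ae m, forall x, P x} -> {ae m, forall x, Q x} -> {ae m, forall x, S x}.
Proof. by move=> PQS; apply: filterS2 => x; exact: PQS. Qed.

Section trace_uniqueness.
Local Open Scope ereal_scope.
Context {R : realType} {X : completeMetricType R}.
Variables (mu nu : {outer_measure set X -> \bar R}) (E : set X).
Hypotheses (mmsX : metric_measure_space mu).

(** Average the triangle inequality over the ball: the left-hand side is constant. *)
Lemma dist_le_avgD (f : X -> R) (c c' t : R) (x : X) :
  measurable_fun [set: caratheodory_type mu] (f : caratheodory_type mu -> R) ->
  (0 < t)%R -> `|c - c'|%:E <=
  avg mu (ball x t) (fun y => `|f y - c|%:E) + avg mu (ball x t) (fun y => `|f y - c'|%:E).
Proof.
move=> mf t0; have [a a0 aE] := mu_ballE mmsX x t0.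
have mB : measurable (ball x t : set (caratheodory_type mu)).
  exact: superlevel_ball (mu_superlevel mmsX).
have abs0 b y : ball x t y -> 0 <= `|f y - b|%:E by rewrite lee_fin.
have mabs b : measurable_fun (ball x t : set (caratheodory_type mu)) (fun y => `|f y - b|%:E : \bar R).
  apply/measurable_EFinP; apply: (measurable_funS measurableT) => //.
  by apply: measurableT_comp => //; exact: measurable_funB.
have -> : avg mu (ball x t) (fun y => `|f y - c|%:E) + avg mu (ball x t) (fun y => `|f y - c'|%:E) =
    avg mu (ball x t) (fun y => `|f y - c|%:E + `|f y - c'|%:E).
  rewrite /avg (ge0_integralD _ mB (abs0 c) (mabs c) (abs0 c') (mabs c')).
  have I0 b : 0 <= \int[cara_measure mu]_(y in ball x t) `|f y - b|%:E.
    exact: integral_ge0.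
  by rewrite (ge0_muleDr _ (I0 c) (I0 c')).
have -> : `|c - c'|%:E = avg mu (ball x t) (fun=> `|c - c'|%:E).
  rewrite /avg (integral_cst (cara_measure mu) mB) /cara_measure/= aE inver gt_eqF//.
  by rewrite -!EFinM; congr (_%:E); field; rewrite gt_eqF.
apply: (le_avg mmsX) => // y _; rewrite -EFinD lee_fin.
have -> : (c - c' = (f y - c') - (f y - c))%R by ring.
by rewrite [leRHS]addrC; exact: ler_normB.
Qed.

Lemma is_trace_unique (f phi psi : X -> R) :
  measurable_fun [set: caratheodory_type mu] (f : caratheodory_type mu -> R) ->
  is_trace mu nu E f phi -> is_trace mu nu E f psi ->
  {ae cara_measure nu, forall x, E x -> phi x = psi x}.
Proof.
move=> mf fphi fpsi; apply: ae_imply2 fphi fpsi => x + + Ex => /(_ Ex) fphi /(_ Ex) fpsi.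
have cvg0 : avg mu (ball x r) (fun y => `|f y - phi x|%:E) +
    avg mu (ball x r) (fun y => `|f y - psi x|%:E) @[r --> (0%R : R)^'+] --> 0.
  by rewrite -[0]adde0; apply: cvgeD.
apply/eqP; rewrite -subr_eq0 -normr_le0 -lee_fin.
apply: (cvge_ge _ cvg0); near=> r; apply: dist_le_avgD => //.
Unshelve. all: by end_near. Qed.

(** As [E] is closed, its complement is measurable, and it is null for the
    restriction to [E]. *)
Lemma ae_restr (H : {outer_measure set X -> \bar R}) (P : X -> Prop) : closed E ->
  superlevel_measurable (outer_restr H E : {outer_measure set X -> \bar R}) ->
  {ae cara_measure (outer_restr H E : {outer_measure set X -> \bar R}), forall x, E x -> P x} ->
  {ae cara_measure (outer_restr H E : {outer_measure set X -> \bar R}), forall x, P x}.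
Proof.
move=> cE mE EP.
have offE : {ae cara_measure (outer_restr H E : {outer_measure set X -> \bar R}), forall x, E x}.
  exists (~` E); split => //; first by apply: open_caratheodory mE _ _; exact: closed_openC.
  by rewrite /cara_measure/= /outer_restr setICl outer_measure0.
by apply: ae_imply2 EP offE => x; exact.
Qed.

End trace_uniqueness.

Theorem theorem1p4 (R : realType) (p : R) (p1 : (1 <= p%:E)%E)
    (X : completeMetricType R) (mu : {outer_measure set X -> \bar R})
    (mmsX : metric_measure_space mu) (padm : admissible mu p)
    (theta : R) (theta_bounds : 0 < theta < p)
    (E : set X) (ADE : ahlfors_david_regular mu theta E) :
  let nu : {outer_measure set X -> \bar R} :=
    outer_restr (codim_hausdorff mu theta) E in
  exists Ext : Lp nu p1 -> Lp mu p1,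
    [/\ forall phi : Lp nu p1, besov mu (theta / p) p1 (Ext phi),
        exists2 C : R, 0 < C & forall phi : Lp nu p1,
          (besov_norm mu (theta / p) p (Ext phi) <= C%:E * Lp_norm nu p phi)%E
      & forall phi : Lp nu p1, Tr mu nu E (Ext phi) = [set (phi : L0 nu)]].
Proof.
move=> nu; have /andP[theta0 thetap] := theta_bounds.
have p1R : 1 <= p by rewrite -lee_fin.
have [K K0 HK] := exists_extends mmsX padm.1 theta0 ADE p1R thetap.
have finphi (phi : Lp nu p1) : ('N[cara_measure nu]_p%:E[EFin \o phi] < +oo)%E.
  exact: Lebesgue_finite.
have Kfin (phi : Lp nu p1) : (K%:E * 'N[cara_measure nu]_p%:E[EFin \o phi] < +oo)%E.
  by rewrite lte_mul_pinfty ?lee_fin ?(ltW K0)// (finphi phi).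
have ext (phi : Lp nu p1) : exists F : Lp mu p1, extends mu theta p E K phi F.
  have [f [mf fLp fbesov ftr]] := HK phi (measurable_class phi) (finphi phi).
  have [q fq] := exists_ae_representative (cara_measure mu) mf.
  have mq := measurable_class q.
  have NE : ('N[cara_measure mu]_p%:E[EFin \o q] = 'N[cara_measure mu]_p%:E[EFin \o f])%E.
    by apply: ae_eq_Lnorm => //; exact: ae_eq_sym.
  have [|F FE] := @exists_Lspace _ _ _ _ _ p1 q.
    rewrite /finite_norm NE; exact: le_lt_trans fLp (Kfin phi).
  exists F; rewrite FE; split; first exact mq.
  - by rewrite NE.
  - rewrite /besov_seminorm; under eq_integral => t _.
      rewrite -(ae_eq_mean_osc mmsX mf mq fq); over.
    exact: fbesov.
  - apply: ae_imply ftr => x + Ex => /(_ Ex).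
    by under eq_fun do rewrite (ae_eq_avg_dist mmsX mf mq fq).
have /choice[Ext HExt] := ext.
exists Ext; split => [phi||phi].
- have [_ _ besovK _] := HExt phi; exact: le_lt_trans besovK (Kfin phi).
- exists (2 * K) => [|phi]; first by rewrite mulr_gt0.
  have [_ LpK besovK _] := HExt phi.
  rewrite /besov_norm mulr_natl mulr2n EFinD ge0_muleDl ?lee_fin ?(ltW K0)//.
  exact: leeD.
- have [mF _ _ trF] := HExt phi; apply/seteqP; split=> [psi trpsi|_ ->//].
  apply: ae_eq_class.
  have := is_trace_unique mmsX mF trpsi trF.
  move=> /(ae_restr ADE.1 (nu_superlevel mu theta E)) psiphi.
  by apply: ae_imply psiphi => x ->.
Qed.
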